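(* Let $s,t\ge 1$ be fixed integers. For each $n\ge 1$ let $G=G_n$ be the type-$(s,t)$ bipartite graph on $[n]\sqcup[n']$, let $\mathcal{M}(G)$ be its set of perfect matchings, let $\nu$ be the uniform distribution on $\mathcal{M}(G)$, and let $\mu$ be the sampling distribution on $\mathcal{M}(G)$ of the sequential algorithm run in the top-down order $v_i=i$ for $1\le i\le n$. Let $\rho=\frac{d\nu}{d\mu}$ and let $Y$ be a random perfect matching with distribution $\nu$. Then there exist positive constants $c_1,c_2$ (not depending on $n$) such that, as $n\to\infty$, $$\mathbb{E}_\nu \log\rho(Y)+\log|\mathcal{M}(G)| = c_1 n+o(n),\qquad \operatorname{Var}_\nu \log\rho(Y)=c_2 n+o(n).$$ Furthermore, as $n\to\infty$, $$\frac{\log\rho(Y)-\mathbb{E}_\nu\log\rho(Y)}{\sqrt{\operatorname{Var}_\nu\log\rho(Y)}}\ \xrightarrow{\ d\ }\ N(0,1).$$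
   Context: Type-$(s,t)$ graph: the bipartite graph with left vertices $[n]=\{1,\dots,n\}$, right vertices $[n']=\{1',\dots,n'\}$, and an edge between $i$ and $j'$ ($1\le i,j\le n$) if and only if $-s\le j-i\le t$. A perfect matching is a set of $n$ vertex-disjoint edges; it is identified with the permutation $\pi$ of $\{1,\dots,n\}$ such that $i$ is matched to $\pi(i)'$. Sequential algorithm (top-down order): start with the empty matching $\pi_0$. For $i=1,2,\dots,n$ in order, let $J_i$ be the set of edges $e$ from vertex $i$ to a not-yet-matched right vertex such that $\pi_{i-1}\cup\{e\}$ can be completed to a perfect matching of $G$; choose $e\in J_i$ uniformly at random and set $\pi_i=\pi_{i-1}\cup\{e\}$. The output is the perfect matching $\pi_n$, and its probability is $\mu(\pi_n)=\prod_{i=1}^n |J_i|^{-1}$. Since $\nu$ is uniform, $\rho(Y)=\frac{1}{|\mathcal{M}(G)|\,\mu(Y)}$, i.e. $\log\rho(Y)=-\log|\mathcal{M}(G)|-\log\mu(Y)$. *)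

(* Defs.v *)
From HB Require Import structures.
From mathcomp Require Import all_boot all_order all_algebra all_fingroup.
From mathcomp Require Import all_classical all_reals all_analysis.
Set Implicit Arguments.
Unset Strict Implicit.
Unset Printing Implicit Defensive.
Import Order.TTheory GRing.Theory Num.Theory.
Import numFieldNormedType.Exports.

Local Open Scope ring_scope.

Section Matchings.
Variable n : nat.

(* A bipartite graph with left and right vertices 'I_n: the pair (i, j) is the
   edge between the left vertex i and the right vertex j.  Sets of edges are
   finite sets (finset), not the classical sets of MathComp-Analysis. *)
Definition bigraph := {set 'I_n * 'I_n}.

Definition perm_edges (p : {perm 'I_n}) : {set 'I_n * 'I_n} :=
  [set (i, p i) | i : 'I_n].

Definition perfect_matchings (G : bigraph) : {set {perm 'I_n}} :=
  [set p | perm_edges p \subset G].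

Definition completable (G : bigraph) (m : {set 'I_n * 'I_n}) : bool :=
  [exists p in perfect_matchings G, m \subset perm_edges p].

Definition matched_right (m : {set 'I_n * 'I_n}) : {set 'I_n} :=
  [set e.2 | e in m].

Definition admissible_edges (G : bigraph) (m : {set 'I_n * 'I_n}) (i : 'I_n) :
    {set 'I_n * 'I_n} :=
  [set e in G | [&& e.1 == i, e.2 \notin matched_right m
                  & completable G (e |: m)]].

(* The vertices are 0, ..., n - 1 rather than 1, ..., n; the condition only
   involves the difference j - i. *)
Definition type_graph (s t : nat) : bigraph :=
  [set e : 'I_n * 'I_n | - (s%:Z) <= (e.2 : nat)%:Z - (e.1 : nat)%:Z <= t%:Z].

Variable R : realType.

(* Probability that the sequential algorithm, started at the partial matching m
   and processing the left vertices in the order vs, outputs the set of edges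
   m'. *)
Fixpoint sequential_law (G : bigraph) (vs : seq 'I_n)
    (m m' : {set 'I_n * 'I_n}) : R :=
  if vs is i :: vs' then
    \sum_(e in admissible_edges G m i)
      (#|admissible_edges G m i|%:R)^-1 * sequential_law G vs' (e |: m) m'
  else (m' == m)%:R.

(* enum 'I_n is the increasing enumeration 0, 1, ..., n - 1. *)
Definition topdown_law (G : bigraph) (p : {perm 'I_n}) : R :=
  sequential_law G (enum 'I_n) finset.set0 (perm_edges p).

Definition uniform_law (G : bigraph) (p : {perm 'I_n}) : R :=
  (p \in perfect_matchings G)%:R / #|perfect_matchings G|%:R.

(* Density of the uniform distribution with respect to the sampling
   distribution: both are discrete, so it is the quotient of their mass
   functions. *)
Definition rn_density (G : bigraph) (p : {perm 'I_n}) : R :=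
  uniform_law G p / topdown_law G p.

Definition log_density (G : bigraph) (p : {perm 'I_n}) : R :=
  ln (rn_density G p).

End Matchings.

(* Probability distributions on a finite type are given by their mass function
   P, and X is a real random variable on that type. *)
Section FiniteProbability.
Variables (R : realType) (T : finType).

Definition fmean (P X : T -> R) : R := \sum_w P w * X w.

Definition fvariance (P X : T -> R) : R :=
  fmean P (fun w => (X w - fmean P X) ^+ 2).

Definition fcdf (P X : T -> R) (x : R) : R := \sum_(w | X w <= x) P w.

End FiniteProbability.

(* Convergence in distribution to Q of random variables X n with distribution
   functions F n: pointwise convergence at the continuity points of the
   distribution function of Q. *)
Definition cvg_in_distribution (R : realType) (F : nat -> R -> R)
    (Q : set R -> \bar R) : Prop :=
  forall x : R,
    {for x, continuous (fun y : R => fine (Q `]-oo, y]%classic))} ->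
    ((fun n => F n x) @ \oo --> fine (Q `]-oo, x]))%classic.

(* Main.v *)
Require Import Defs.
From HB Require Import structures.
From mathcomp Require Import all_boot all_order all_algebra all_fingroup.
From mathcomp Require Import all_classical all_reals all_analysis.
From mathcomp Require Import measurable_realfun zify ring lra.
Import Order.TTheory GRing.Theory Num.Theory.
Import numFieldNormedType.Exports.
Set Implicit Arguments.
Unset Strict Implicit.
Unset Printing Implicit Defensive.
Local Open Scope classical_set_scope.
Local Open Scope ring_scope.

(** Number the rows and columns from 0, let p be a perfect matching of the
    type-(s, t) graph, and run the sequential algorithm along p.  Before step i
    the rows below i have used i of the columns below i + t, so t of these are
    still vacant (as long as i + t <= n).  If the column i - s is among the
    vacant ones then row i is the last row that can take it, and the step is
    forced.  Otherwise every vacant column up to i + t can be completed ([in_admissible], by a repair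
    argument), which leaves min (t + 1, n - i) choices ([card_admissible]).
    Hence, if N p is the number of forced steps, that is, of rows with
    p i = i - s, then - ln mu p = ln (t + 1) * (n - N p) - B p, where the
    boundary term B p lies between 0 and t ln (t + 1) ([log_densityE],
    [deficit_bound]).  Everything reduces to the law of N under the uniform
    distribution.

    The vacant columns in a window of width s + t form the state of a finite
    automaton, and matchings are the closed walks of length n at its initial
    state o; a step is forced exactly when the oldest column of the window is
    vacant ([sum_matchings_walk]).  So N is an additive functional of a uniform
    random closed walk in a strongly connected multigraph that has a loop at o.
    Such walks satisfy a central limit theorem ([walk_clt]):
    - Perron eigenvectors of the transfer matrix and of its transpose turn the
      uniform measure on walks into a Markov chain X with a positive stationary
      law, conditioned to return to o at time n ([perron], [doob_transform]);
    - subtracting the stationary mean m of the weights and adding the coboundary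
      of a solution of the Poisson equation turns the weights into martingale
      increments d, and lowers the total weight of a closed walk of length n by
      n m exactly ([poisson_equation]);
    - if S is the sum of the increments then S_n has mean 0 and variance
      n s2 + O(1), and k being another solution of a Poisson equation, the
      function cos (eta x + c) (1 + eta^2 k a) is, up to O(eta^3), an
      eigenfunction of the transition operator with eigenvalue
      exp (- eta^2 s2 / 2) ([step_cos]); iterating n times with eta = th / sqrt n
      gives the limit of the characteristic function ([cvg_iter_step_cos]);
    - by mixing, conditioning on the endpoint does not change the limits
      ([cvg_iter_step_cond]).
    If s2 were 0, all closed walks of length n would have the same weight n m.
    The identity matching has no forced step, but a cyclic shift of s + 1 rows
    has one, so s2 > 0.  Comparing the sum of the p i with the sum of the i gives
    (s + t) N p <= t n, so m < 1, and c1 = ln (t + 1) (1 - m) and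
    c2 = ln (t + 1)^2 s2 are positive.

    The passage from characteristic functions to distribution functions
    ([levy_continuity]) rests on one-sided approximations of step functions by
    trigonometric polynomials on a long interval, the second moment controlling
    what happens outside, and on the characteristic function of the normal law
    ([gauss_cos]), obtained from a differential equation.  The bounded term B
    and the exact normalization by the mean and the variance of the log-density
    are absorbed in [normalized_clt]. *)

(** * Sequential sampling of a band matching *)

Section BandMatchings.
Local Open Scope nat_scope.
Local Open Scope set_scope.
Variables (n s t : nat).
Local Notation G := (type_graph n s t).
Implicit Types (p q : {perm 'I_n}) (i k l : 'I_n) (e : 'I_n * 'I_n).

Lemma in_type_graph e : (e \in G) = (e.1 <= e.2 + s) && (e.2 <= e.1 + t).
Proof. by rewrite inE; apply/idP/idP; lia. Qed.

Lemma in_perm_edges p e : (e \in perm_edges p) = (e.2 == p e.1).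
Proof.
apply/imsetP/eqP => [[i _ ->]//|h]; exists e.1 => //.
by rewrite -h -surjective_pairing.
Qed.

Lemma matchingP p :
  reflect (forall i, (i <= p i + s) /\ (p i <= i + t)) (p \in perfect_matchings G).
Proof.
rewrite inE; apply: (iffP fintype.subsetP) => [h i|h e].
  have := h (i, p i); rewrite in_perm_edges eqxx => /(_ isT).
  by rewrite in_type_graph => /andP[].
by rewrite in_perm_edges in_type_graph => /eqP ->; apply/andP; exact: h.
Qed.

(** The permutation q respects the band except that the value q k may be too
    small for the row k.  Among the rows i + 1, ..., q k + s, which could take
    the value q k, one has a larger value: otherwise the numbers q l + s would
    be distinct in a set with one element less.  Exchanging the two values makes
    the row that receives q k legal and increases the value at k, so that the
    defect N decreases, and the rows up to i are not touched. *)
Lemma repair N q i k : i < k -> (forall l, l != k -> l <= q l + s) ->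
  (forall l, q l <= l + t) -> i < q k + s -> k <= q k + s + N ->
  exists2 q', q' \in perfect_matchings G & forall l, l <= i -> q' l = q l.
Proof.
elim: N q => [|N ih] q ik low up iq kN.
  exists q => //; apply/matchingP => l; split=> //.
  by have [->|/low//] := eqVneq l k; rewrite addn0 in kN.
have [kq|qk] := leqP k (q k + s).
  exists q => //; apply/matchingP => l; split=> //.
  by have [->|/low//] := eqVneq l k.
have [l /and3P[il ly ql]] : exists l, [&& i < l, l <= q k + s & q k < q l].
  apply/existsP; apply: contraT; rewrite negb_exists => /forallP hl.
  (* otherwise the numbers ql l, for l = i + 1, ..., q k + s, contradict the
     pigeonhole principle *)
  pose ql (j : nat) := if insub j is Some l then (q l + s)%N else 0%N.
  have qlE (j : nat) (hj : j < n) : ql j = (q (Ordinal hj) + s)%N.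
    by rewrite /ql insubT.
  have jn j : j <= q k + s -> j < n.
    by move=> h; apply: leq_ltn_trans h _; apply: leq_trans qk _; exact: ltnW.
  pose js := iota i.+1 (q k + s - i).
  have jsP j : j \in js -> i < j /\ j <= q k + s by rewrite mem_iota; lia.
  have : uniq [seq ql j | j <- js].
    rewrite map_inj_in_uniq ?iota_uniq// => j1 j2 /jsP[_ h1] /jsP[_ h2].
    rewrite (qlE _ (jn _ h1)) (qlE _ (jn _ h2)) => /addIn/val_inj/perm_inj [] //.
  move=> /(@uniq_leq_size _ _ (iota i.+1 (q k + s - i).-1)).
  rewrite size_map !size_iota => H.
  have : q k + s - i <= (q k + s - i).-1; last by lia.
  apply: H => v /mapP[j /jsP[ij jy] ->].
  have jn' := jn j jy; rewrite (qlE _ jn') mem_iota; set l := Ordinal jn'.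
  have lk : l != k by apply/eqP => lk; have jk : j = k :> nat; [rewrite -lk|lia].
  have lE : nat_of_ord l = j by [].
  have h1 := low l lk.
  have h2 : q l <= q k by have := hl l; rewrite lE ij jy /= -leqNgt.
  have h3 : nat_of_ord (q l) != q k by rewrite (inj_eq val_inj) (inj_eq perm_inj).
  lia.
pose q' := (tperm l k * q)%g.
have kl : k != l by apply/eqP => kl; move: qk ly; rewrite kl; lia.
have q'k : q' k = q l by rewrite permM tpermR.
have q'l : q' l = q k by rewrite permM tpermL.
have q'x x : x != l -> x != k -> q' x = q x.
  by move=> xl xk; rewrite permM tpermD// eq_sym.
have lk : l < k by lia.
have [||||q'' q''M q''E] := ih q' ik.
- move=> x xk; have [->|xl] := eqVneq x l; first by rewrite q'l.
  by rewrite q'x//; exact: low.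
- move=> x; have [->|xl] := eqVneq x l; first by rewrite q'l; have := up l; lia.
  have [->|xk] := eqVneq x k; first by rewrite q'k; have := up l; lia.
  by rewrite q'x.
- by rewrite q'k; lia.
- by rewrite q'k; lia.
exists q'' => // x xi; rewrite q''E// q'x//; apply/eqP => xE; subst x; lia.
Qed.

Definition prefix_edges p (j : nat) : {set 'I_n * 'I_n} :=
  [set e in perm_edges p | e.1 < j].

Lemma in_prefix p j e : (e \in prefix_edges p j) = (e.2 == p e.1) && (e.1 < j).
Proof. by rewrite inE in_perm_edges. Qed.

Lemma matched_prefix p j k : (p k \in matched_right (prefix_edges p j)) = (k < j).
Proof.
apply/imsetP/idP => [[e]|kj].
  by rewrite in_prefix => /andP[/eqP e2 e1] /eqP; rewrite e2 (inj_eq perm_inj) => /eqP->.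
by exists (k, p k); rewrite // in_prefix/= eqxx.
Qed.

Lemma completableP p i k :
  reflect (exists q, [/\ q \in perfect_matchings G, q i = p k & forall l, l < i -> q l = p l])
    (completable G ((i, p k) |: prefix_edges p i)).
Proof.
apply: (iffP existsP) => [[q /andP[qM /fintype.subsetP h]]|[q [qM qi ql]]]; exists q.
  split=> //; first by have := h (i, p k); rewrite !inE eqxx => /(_ isT); rewrite in_perm_edges => /eqP.
  move=> l li; have := h (l, p l).
  by rewrite in_setU1 in_prefix/= eqxx li orbT in_perm_edges => /(_ isT)/eqP.
rewrite qM/=; apply/fintype.subsetP => e; rewrite in_setU1 in_prefix in_perm_edges.
by move=> /orP[/eqP->/=|/andP[/eqP-> /ql ->]//]; rewrite qi.
Qed.

(** If the column i - s is vacant then only row i can still take it.  If not,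
    moving the column of row k to row i and the column of row i to row k
    respects the band everywhere, except that p i may be too small for k; as
    p i is not i - s, [repair] applies with the rows up to i fixed. *)
Lemma in_admissible p i k : p \in perfect_matchings G ->
  ((i, p k) \in admissible_edges G (prefix_edges p i) i) =
  if p i + s == i then k == i else (i <= k) && (p k <= i + t).
Proof.
move=> pM; have /matchingP pB := pM.
rewrite inE/= eqxx matched_prefix -leqNgt in_type_graph/=.
apply/idP/idP.
  move=> /andP[/andP[h1 h2] /andP[ik /completableP[q [/matchingP qM qi ql]]]].
  case: ifP => [/eqP pi|_]; last by rewrite ik h2.
  have [k' kE] : exists k', q k' = p i.
    by exists ((q^-1)%g (p i)); rewrite permKV.
  have k'i : k' <= i by have [] := qM k'; rewrite kE pi.
  have : ~~ (k' < i).
    apply/negP => h; have := ql k' h; rewrite kE => /perm_inj e.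
    by move: h; rewrite e ltnn.
  rewrite -leqNgt => ik'.
  have e : k' = i by apply/val_inj/eqP; rewrite eqn_leq k'i.
  by move: kE; rewrite e qi => /perm_inj->.
case: ifP => [/eqP pi /eqP ->|pi].
  rewrite !(pB i).1 !(pB i).2 leqnn/=; apply/completableP; exists p; split => //.
move=> /andP[ik h2]; rewrite ik h2 andbT (leq_trans ik (pB k).1)/=.
apply/completableP.
have [kE|ki] := eqVneq k i; first by exists p; rewrite kE.
have {}ik : i < k by rewrite ltn_neqAle ik andbT eq_sym.
pose q := (tperm i k * p)%g.
have qk : q k = p i by rewrite permM tpermR.
have qi : q i = p k by rewrite permM tpermL.
have qx x : x != i -> x != k -> q x = p x by move=> xi xk; rewrite permM tpermD// eq_sym.
have [||||q' q'M q'E] := @repair k q i k ik.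
- move=> x xk; have [->|xi] := eqVneq x i; first by rewrite qi; have := (pB k).1; lia.
  by rewrite qx//; exact: (pB x).1.
- move=> x; have [->|xi] := eqVneq x i; first by rewrite qi.
  have [->|xk] := eqVneq x k; first by rewrite qk; have := (pB i).2; lia.
  by rewrite qx//; exact: (pB x).2.
- by rewrite qk; have := (pB i).1; lia.
- by lia.
exists q'; split => //; first by rewrite q'E.
move=> x xi; rewrite (q'E x (ltnW xi)); apply: qx; apply/eqP => xE.
  by rewrite xE ltnn in xi.
by rewrite xE ltnNge (ltnW ik) in xi.
Qed.

(** In a free step, the columns up to i + t that are vacant are those columns
    minus the i columns used before, all of which are at most i - 1 + t. *)
Lemma card_admissible p i : p \in perfect_matchings G ->
  #|admissible_edges G (prefix_edges p i) i| =
  if p i + s == i then 1 else minn t.+1 (n - i).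
Proof.
move=> pM; have /matchingP pB := pM.
set J := admissible_edges _ _ _.
have JE e : e \in J -> exists k, e = (i, p k).
  rewrite inE => /andP[_ /and3P[/eqP e1 _ _]].
  exists ((p^-1)%g e.2); rewrite permKV -e1; exact: surjective_pairing.
have -> : J = [set (i, p k) | k in [set k | (i, p k) \in J]].
  apply/setP => e; apply/idP/imsetP => [eJ|[k + ->]]; last by rewrite inE.
  by have [k kE] := JE e eJ; exists k => //; rewrite inE -kE.
rewrite card_imset; last by move=> k k' [/perm_inj].
have -> : [set k | (i, p k) \in J] = if p i + s == i then [set i] else
    [set k : 'I_n | (i <= k) && (p k <= i + t)].
  by apply/setP => k; rewrite inE in_admissible//; case: ifP => _; rewrite inE.
case: ifP => _; first by rewrite cards1.
have -> : [set k : 'I_n | (i <= k) && (p k <= i + t)] =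
   [set k : 'I_n | p k <= i + t] :\: [set k : 'I_n | k < i].
  by apply/setP => k; rewrite !inE -leqNgt.
rewrite cardsD (_ : _ :&: _ = [set k : 'I_n | k < i]); last first.
  apply/finset.setIidPr/fintype.subsetP => k; rewrite !inE => ki.
  by have := (pB k).2; lia.
have cardI m : m <= n -> #|[set k : 'I_n | k < m]| = m.
  by move=> mn; rewrite -sum1dep_card (big_ord_narrow mn) sum1_card card_ord.
rewrite cardI; last exact: ltnW.
have -> : #|[set k : 'I_n | p k <= i + t]| = minn n (i + t).+1.
  have -> : [set k : 'I_n | p k <= i + t] = p @^-1: [set k : 'I_n | k < minn n (i + t).+1].
    by apply/setP => k; rewrite !inE leq_min ltn_ord ltnS.
  rewrite card_preimset; last exact: perm_inj.
  by rewrite cardI// geq_minl.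
have := ltn_ord i; lia.
Qed.

Variable R : realType.

(** The algorithm only adds edges, so a positive probability forces inclusion;
    along a given matching a single term of each sum survives. *)
Lemma sequential_law_sub vs (m m' : {set 'I_n * 'I_n}) :
  sequential_law R G vs m m' != 0%R -> m \subset m'.
Proof.
elim: vs m => [|i vs ih] m /=; first by have [->|_] := eqVneq m' m; rewrite ?eqxx.
apply: contra_neqT => h; apply: big1 => e _; apply/eqP; rewrite mulf_eq0.
apply/orP; right; apply: contraNT h => /ih.
by rewrite finset.subUset => /andP[].
Qed.

(** Only the choice of the edge of p contributes at each step, so that the law
    is the product of the selection probabilities along p. *)
Lemma sequential_law_prefix p j : p \in perfect_matchings G -> j <= n ->
  sequential_law R G (drop j (enum 'I_n)) (prefix_edges p j) (perm_edges p) =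
  (\prod_(i : 'I_n | (j <= i)%N) (#|admissible_edges G (prefix_edges p i) i|%:R)^-1)%R.
Proof.
move=> pM; elim: {j}(n - j) {-2}j (leqnn (n - j)) => [|N ih] j jN jn.
  have -> : j = n by lia.
  rewrite drop_oversize ?size_enum_ord//= big_pred0; last first.
    by move=> i; rewrite leqNgt ltn_ord.
  rewrite (_ : prefix_edges p n = perm_edges p) ?eqxx//.
  by apply/setP => e; rewrite inE ltn_ord andbT.
have [jn'|] := ltnP j n; last by move=> h; apply: ih => //; lia.
pose i := Ordinal jn'.
rewrite (drop_nth i) ?size_enum_ord//.
have -> : nth i (enum 'I_n) j = i by apply: val_inj; rewrite /= nth_enum_ord.
rewrite [LHS]/= (bigD1 (i, p i))/=; last first.
  rewrite (_ : j = i)// in_admissible//; case: ifP => _ //.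
  by rewrite leqnn; have /matchingP/(_ i)[] := pM.
rewrite big1 ?addr0 => [|e /andP[eJ ei]]; last first.
  apply/eqP; rewrite mulf_eq0; apply/orP; right; apply: contraNT ei => /sequential_law_sub.
  rewrite finset.subUset finset.sub1set in_perm_edges => /andP[/eqP e2 _].
  move: eJ; rewrite inE => /andP[_ /and3P[/eqP e1 _ _]].
  by rewrite [e]surjective_pairing e2 e1.
have -> : (i, p i) |: prefix_edges p j = prefix_edges p j.+1.
  apply/setP => e; rewrite in_setU1 !in_prefix ltnS (leq_eqVlt e.1 j) andb_orr; congr (_ || _).
  apply/eqP/andP => [->/=|[/eqP e2 /eqP e1]]; first by rewrite !eqxx.
  by rewrite [e]surjective_pairing e2; have -> : e.1 = i by exact: val_inj.
rewrite ih//; last by lia.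
rewrite [RHS](bigD1 i)//=; congr (_ * _)%R.
apply: eq_bigl => k; rewrite ltn_neqAle andbC; congr andb.
by rewrite eq_sym.
Qed.

Lemma topdown_lawE p : p \in perfect_matchings G ->
  topdown_law R G p =
  (\prod_(i : 'I_n) (if (p i + s == i)%N then 1 else (minn t.+1 (n - i)%N)%:R)^-1)%R.
Proof.
move=> pM; have := sequential_law_prefix pM (leq0n n); rewrite drop0.
rewrite (_ : prefix_edges p 0 = finset.set0); last by apply/setP => e; rewrite in_prefix ltn0 andbF inE.
rewrite /topdown_law => ->; apply: eq_bigr => i _.
by rewrite card_admissible//; case: ifP.
Qed.

Lemma perfect_matching1 : (1%g : {perm 'I_n}) \in perfect_matchings G.
Proof. by apply/matchingP => i; rewrite perm1; lia. Qed.

End BandMatchings.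

(** * Matchings as the words of a finite automaton *)

Section Automaton.
Local Open Scope nat_scope.
Local Open Scope set_scope.
Variables (s t : nat).
(** Before row i is processed, u c tells whether the column i - s + c is vacant,
    columns with a negative number counting as used. *)
Definition window := {ffun 'I_(s + t) -> bool}.
Implicit Types (u v : window) (c : nat) (w : seq nat).

(** Columns beyond the window have not been reached yet, hence the default. *)
Definition vacant u c : bool := if insub c is Some j then u j else true.

Definition start : window := [ffun j : 'I_(s + t) => s <= j].

Definition shift_window u c : window := [ffun j : 'I_(s + t) => (j.+1 != c) && vacant u j.+1].

(** The letter c stands for the choice of the column i - s + c.  The last
    condition is the forced step: the oldest column leaves the window after this
    row, so it must be used now if it is vacant. *)
Definition legal u c := [&& c <= s + t, vacant u c & vacant u 0 ==> (c == 0)].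

Lemma vacant_ffun (F : nat -> bool) c : (forall j, s + t <= j -> F j) ->
  vacant [ffun j : 'I_(s + t) => F j] c = F c.
Proof.
move=> h; rewrite /vacant; case: insubP => [j _ <-|]; first by rewrite ffunE.
by rewrite -leqNgt => /h ->.
Qed.

Lemma vacant_start c : vacant start c = (s <= c).
Proof. by apply: (vacant_ffun (F := fun j => s <= j)) => j; lia. Qed.

Lemma vacant_far u c : s + t <= c -> vacant u c.
Proof. by rewrite /vacant; case: insubP => // j cj; rewrite leqNgt cj. Qed.

Lemma vacant_shift u c j : c <= s + t -> vacant (shift_window u c) j = (j.+1 != c) && vacant u j.+1.
Proof.
move=> cst; apply: (vacant_ffun (F := fun j => (j.+1 != c) && vacant u j.+1)) => i si.
rewrite vacant_far ?andbT; lia.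
Qed.

Lemma vacant_inj u v : (forall c, vacant u c = vacant v c) -> u = v.
Proof. by move=> h; apply/ffunP => j; have := h j; rewrite /vacant valK. Qed.

Fixpoint accepts u w := if w is c :: w' then legal u c && accepts (shift_window u c) w' else u == start.

Lemma acceptsE u w : accepts u w <->
  (forall i, i < size w -> legal (foldl shift_window u (take i w)) (nth 0 w i)) /\
  foldl shift_window u w = start.
Proof.
elim: w u => [|c w ih] u /=; first by split=> [/eqP //|[_ ->]].
split=> [/andP[uc /ih[h1 h2]]|[h1 h2]]; first by split=> // -[|i] //=; exact: h1.
apply/andP; split; first exact: (h1 0).
by apply/ih; split => // i iw; exact: (h1 i.+1).
Qed.

(** Letter k of w uses the column k - s + w_k; comparing k + w_k with
    size w + c avoids the subtraction of s. *)
Lemma vacant_run w c : all (fun c => c <= s + t) w ->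
  vacant (foldl shift_window start w) c =
  (s <= size w + c) && [forall k : 'I_(size w), k + nth 0 w k != size w + c].
Proof.
elim/last_ind: w c => [|w d ih] c.
  by rewrite /= vacant_start add0n => _; rewrite [X in _ && X](_ : _ = true) ?andbT//; apply/forallP => -[].
rewrite all_rcons => /andP[dst wst].
rewrite foldl_rcons vacant_shift// ih// size_rcons addnS andbCA; congr andb.
apply/andP/forallP => [[cd /forallP h] k|h].
  rewrite nth_rcons; have [kw|kw|->] := ltngtP (k : nat) (size w).
  - by have := h (Ordinal kw); rewrite /=; lia.
  - by have := ltn_ord k; rewrite ltnS leqNgt kw.
  - by lia.
split.
  by have := h (Ordinal (ltnSn (size w))); rewrite /= nth_rcons ltnn eqxx; lia.
apply/forallP => k; have := h (widen_ord (leqnSn _) k).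
by rewrite /= nth_rcons ltn_ord; lia.
Qed.

Fixpoint words n : seq (seq nat) :=
  if n is n'.+1 then [seq c :: w | c <- iota 0 (s + t).+1, w <- words n'] else [:: [::]].

Lemma mem_words n w : (w \in words n) = (size w == n) && all (fun c => c <= s + t) w.
Proof.
elim: n w => [|n ih] w; first by rewrite /= inE; case: w.
apply/allpairsP/idP => [[[c w'] [+ + ->]]|].
  by rewrite mem_iota add0n ltnS ih /= eqSS => -> .
case: w => // c w /=; rewrite eqSS => /and3P[wn cst wst].
have cI : c \in iota 0 (s + t).+1 by rewrite mem_iota; lia.
by exists (c, w); split; [exact: cI|rewrite ih /= wn|].
Qed.

Lemma uniq_words n : uniq (words n).
Proof.
elim: n => // n ih; apply: (@allpairs_uniq _ _ _ cons (iota 0 (s + t).+1) (words n)) => //.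
  exact: iota_uniq.
by move=> [c w] [c' w'] _ _ /= [-> ->].
Qed.

Section Encoding.
Variable n : nat.
Local Notation G := (type_graph n s t).
Implicit Types (p : {perm 'I_n}) (i k : 'I_n).

Definition word p : seq nat := [seq p i + s - i | i <- enum 'I_n].

Lemma size_word p : size (word p) = n.
Proof. by rewrite size_map size_enum_ord. Qed.

Lemma nth_word p i : nth 0 (word p) i = p i + s - i.
Proof. by rewrite (nth_map i) ?size_enum_ord// nth_ord_enum. Qed.

Lemma add_nth_word p i : p \in perfect_matchings G -> i + nth 0 (word p) i = p i + s.
Proof. by move=> /matchingP/(_ i)[h _]; rewrite nth_word subnKC. Qed.

Lemma word_bounded p : p \in perfect_matchings G -> all (fun c => c <= s + t) (word p).
Proof.
by move=> /matchingP pB; apply/allP => c /mapP[i _ ->]; have := pB i; lia.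
Qed.

(** The legality of a letter is the injectivity of p together with the
    observation that a vacant column j - s can only be matched to row j; the
    final state is the initial one because p is onto. *)
Lemma accepts_word p : p \in perfect_matchings G -> accepts start (word p).
Proof.
move=> pM; have /matchingP pB := pM; have wB := word_bounded pM.
have inv (j : 'I_n) : exists k, p k = j by exists ((p^-1)%g j); rewrite permKV.
apply/acceptsE; split.
  rewrite size_word => j jn; pose i := Ordinal jn.
  have tj : size (take j (word p)) = j by rewrite size_take size_word jn.
  have wB' : all (fun c => c <= s + t) (take j (word p)).
    by apply/allP => c /mem_take; move: c; apply/allP.
  rewrite /legal !vacant_run// !tj.
  have wi : j + nth 0 (word p) j = p i + s by exact: (add_nth_word i pM).
  have wk (k : nat) : k < j -> exists k' : 'I_n, k' < j /\
      k + nth 0 (take j (word p)) k = p k' + s.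
    move=> kj; exists (Ordinal (ltn_trans kj jn)); split=> //; rewrite nth_take//.
    exact: (add_nth_word (Ordinal (ltn_trans kj jn)) pM).
  apply/and3P; split.
  - by move/allP: wB; apply; rewrite mem_nth// size_word.
  - rewrite wi leq_addl/=; apply/forallP => k; have [k' [k'j ->]] := wk k (ltn_ord k).
    rewrite eqn_add2r (inj_eq val_inj) (inj_eq perm_inj).
    by apply/eqP => e; move: k'j; rewrite e /= ltnn.
  - apply/implyP => /andP[sj /forallP h]; rewrite addn0 in sj.
    have js : j - s < n by lia.
    have [k kE] := inv (Ordinal js).
    have pk : p k = j - s :> nat by rewrite kE.
    have kj : k <= j by have := (pB k).1; lia.
    have [kj'|jk] := ltnP k j.
      have := h (Ordinal kj'); rewrite /= nth_take// (add_nth_word k pM) pk; lia.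
    have ki : k = i by apply: val_inj; rewrite /=; lia.
    by rewrite (nth_word p i) -ki pk; lia.
apply: vacant_inj => c; rewrite vacant_run// vacant_start size_word.
have wk (k : nat) : k < n -> exists k' : 'I_n, k + nth 0 (word p) k = p k' + s.
  by move=> kn; exists (Ordinal kn); exact: (add_nth_word (Ordinal kn) pM).
have [sc|cs] := leqP s c.
  apply/andP; split; first by lia.
  by apply/forallP => k; have [k' ->] := wk k (ltn_ord k); have := ltn_ord (p k'); lia.
apply/negbTE/negP => /andP[snc /forallP h].
have cn : n + c - s < n by lia.
have [k kE] := inv (Ordinal cn).
have pk : p k = n + c - s :> nat by rewrite kE.
have := h k; rewrite /= (add_nth_word k pM) pk; lia.
Qed.

Lemma word_inj : {in perfect_matchings G &, injective word}.
Proof.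
move=> p q pM qM pq; apply/permP => i; apply: val_inj.
have h1 := add_nth_word i pM; have h2 := add_nth_word i qM; rewrite pq in h1.
by apply/eqP; rewrite -(eqn_add2r s) -h1 -h2.
Qed.

(** Legal letters choose distinct columns.  None of these exceeds n - 1, since
    in the final window, which equals the initial one, all columns from n on are
    vacant. *)
Lemma word_surj w : size w = n -> all (fun c => c <= s + t) w -> accepts start w ->
  exists2 p, p \in perfect_matchings G & w = word p.
Proof.
move=> wn wB /acceptsE[hl hf].
have wst i : nth 0 w i <= s + t by move/allP: wB; apply; rewrite mem_nth// wn.
have fr i : s <= i + nth 0 w i /\ forall k, k < i -> k + nth 0 w k != i + nth 0 w i.
  have iw : i < size w by rewrite wn.
  have /and3P[_ + _] := hl i iw.
  have ti : size (take i w) = i by rewrite size_take iw.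
  rewrite vacant_run ?ti; last by apply/allP => c /mem_take; move: c; apply/allP.
  move=> /andP[h1 /forallP h2]; split=> // k ki.
  by have := h2 (Ordinal ki); rewrite /= nth_take.
have lt i : i + nth 0 w i - s < n.
  rewrite ltnNge; apply/negP => h.
  have h2 := vacant_run (i + nth 0 w i - n) wB; rewrite hf vacant_start wn in h2.
  have h3 : s <= i + nth 0 w i - n by have := (fr i).1; lia.
  move: h2; rewrite h3 => /esym/andP[_ /forallP h2].
  by have := h2 i; rewrite /= => /eqP; apply; lia.
pose F i := Ordinal (lt i).
have Finj : injective F.
  move=> i k /(congr1 val)/= e; apply: val_inj.
  have [ik|ki|//] := ltngtP i k.
    have := (fr k).2 i ik; have := (fr k).1; have := (fr i).1; lia.
  have := (fr i).2 k ki; have := (fr k).1; have := (fr i).1; lia.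
exists (perm Finj).
  apply/matchingP => i; rewrite permE /=; have := (fr i).1; have := wst i; lia.
apply: (@eq_from_nth _ 0); rewrite ?size_word// wn => j jn.
rewrite (nth_word _ (Ordinal jn)) permE /=.
by have := (fr (Ordinal jn)).1; rewrite /=; lia.
Qed.

Definition forced_steps p := #|[set i | p i + s == i]|.

Lemma count_word p : p \in perfect_matchings G -> count_mem 0 (word p) = forced_steps p.
Proof.
move=> /matchingP pB; rewrite count_map -sum1_count /forced_steps -sum1dep_card.
rewrite big_enum_cond; apply: eq_bigl => i /=.
by have := (pB i).1 => h; apply/eqP/eqP; lia.
Qed.

Lemma perm_words :
  perm_eq [seq word p | p <- enum (perfect_matchings G)] [seq w <- words n | accepts start w].
Proof.
apply: uniq_perm.
- by rewrite map_inj_in_uniq ?enum_uniq// => p q; rewrite !mem_enum; exact: word_inj.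
- exact/filter_uniq/uniq_words.
move=> w; rewrite mem_filter mem_words; apply/mapP/andP => [[p + ->]|[wa /andP[/eqP wn wB]]].
  by rewrite mem_enum => pM; rewrite accepts_word// size_word eqxx word_bounded.
by have [p pM ->] := word_surj wn wB wa; exists p; rewrite ?mem_enum.
Qed.

Lemma sum_matchings (R : nmodType) (g : nat -> R) :
  (\sum_(p in perfect_matchings G) g (forced_steps p) =
   \sum_(w <- words n | accepts start w) g (count_mem 0 w))%R.
Proof.
rewrite -[RHS]big_filter -(perm_big _ perm_words)/= big_map big_enum/=.
by apply: eq_bigr => p pM; rewrite count_word.
Qed.

End Encoding.

End Automaton.

(** * Kernels on a finite set: mixing and the Poisson equation *)

Lemma fin_bound (R : realType) (T : finType) (v : T -> R) :
  exists2 K, 0 <= K & forall a, `|v a| <= K.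
Proof.
exists (\sum_a `|v a|) => [|a]; first by apply: sumr_ge0.
by rewrite (bigD1 a)//= lerDl sumr_ge0.
Qed.

Section MarkovOperator.
Variables (R : realType) (T : finType) (P : T -> T -> R).
Hypothesis P_ge0 : forall a b, 0 <= P a b.
Hypothesis P_sum1 : forall a, \sum_b P a b = 1.
Implicit Types (v w : T -> R).

(** For a stochastic P this is the conditional expectation after one step; for a
    matrix with nonnegative entries it is the product with a column vector. *)
Definition kact v a := \sum_b P a b * v b.

Lemma kact_cst c : kact (fun=> c) = (fun=> c).
Proof. by apply/funext => a; rewrite /kact -mulr_suml P_sum1 mul1r. Qed.

Lemma kactD v w : kact (fun b => v b + w b) = (fun a => kact v a + kact w a).
Proof. by apply/funext => a; rewrite /kact -big_split; apply: eq_bigr => b _; rewrite mulrDr. Qed.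

Lemma kactZ c v : kact (fun b => c * v b) = (fun a => c * kact v a).
Proof. by apply/funext => a; rewrite /kact mulr_sumr; apply: eq_bigr => b _; rewrite mulrCA. Qed.

Lemma le_kact v w : (forall a, v a <= w a) -> forall a, kact v a <= kact w a.
Proof. by move=> h a; apply: ler_sum => b _; rewrite ler_wpM2l. Qed.

Lemma iter_kact_cst n c : iter n kact (fun=> c) = (fun=> c).
Proof. by elim: n => //= n ->; rewrite kact_cst. Qed.

Lemma iter_kactD n v w : iter n kact (fun b => v b + w b) = (fun a => iter n kact v a + iter n kact w a).
Proof. by elim: n => //= n ->; rewrite kactD. Qed.

Lemma iter_kactZ n c v : iter n kact (fun b => c * v b) = (fun a => c * iter n kact v a).
Proof. by elim: n => //= n ->; rewrite kactZ. Qed.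

Lemma le_iter_kact n v w : (forall a, v a <= w a) -> forall a, iter n kact v a <= iter n kact w a.
Proof. by move=> h; elim: n => //= n ih; exact: le_kact. Qed.

Variable pi : T -> R.
Hypothesis pi_sum1 : \sum_a pi a = 1.
Hypothesis pi_stat : forall b, \sum_a pi a * P a b = pi b.

Lemma pi_kact v : \sum_a pi a * kact v a = \sum_a pi a * v a.
Proof.
under eq_bigr do rewrite mulr_sumr.
rewrite exchange_big/=; apply: eq_bigr => b _.
by under eq_bigr do rewrite mulrA; rewrite -mulr_suml pi_stat.
Qed.

Lemma pi_iter_kact n v : \sum_a pi a * iter n kact v a = \sum_a pi a * v a.
Proof. by elim: n => //= n <-; rewrite pi_kact. Qed.

Variables (o : T) (N : nat) (de : R).
Hypothesis de_gt0 : 0 < de.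
Hypothesis minorization : forall a, de <= iter N kact (fun b => (b == o)%:R) a.

Let de_le1 : de <= 1.
Proof.
apply: le_trans (minorization o) _.
rewrite -[leRHS](congr1 (@^~ o) (iter_kact_cst N 1)).
by apply: le_iter_kact => a /=; case: eqP.
Qed.

(** All rows of the N-th power put mass at least de on the point o, so the range
    of a function shrinks by the factor 1 - de (Doeblin). *)
Let shrink v m M : (forall a, m <= v a <= M) ->
  forall a, de * v o + (1 - de) * m <= iter N kact v a <= de * v o + (1 - de) * M.
Proof.
move=> vmM a.
have low w (m' : R) : (forall b, m' <= w b) -> de * w o + (1 - de) * m' <= iter N kact w a.
  move=> wm.
  have h : iter N kact (fun b => (w o - m') * (b == o)%:R + m') a <= iter N kact w a.
    apply: le_iter_kact => b; case: eqP => [->|_]; first by rewrite mulr1 subrK.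
    by rewrite mulr0 add0r.
  apply: le_trans h; rewrite iter_kactD iter_kact_cst iter_kactZ.
  have -> : de * w o + (1 - de) * m' = (w o - m') * de + m' by ring.
  by rewrite lerD2r ler_wpM2l// subr_ge0.
apply/andP; split; first by apply: low => b; case/andP: (vmM b).
have := low (fun b => (-1) * v b) (- M).
rewrite iter_kactZ !mulN1r mulrN => h.
have {}h : - (de * v o) + (1 - de) * - M <= - iter N kact v a.
  by apply: h => b; rewrite mulN1r lerN2; case/andP: (vmM b).
lra.
Qed.

(** Iterating [shrink], the oscillation of the iterates tends to 0, and the
    stationary mean, which is 0, stays within their range. *)
Lemma mixing v e : \sum_a pi a * v a = 0 -> 0 < e ->
  exists m, forall a, `|iter m kact v a| <= e.
Proof.
move=> piv e0.
have [K K0 vK] := fin_bound v.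
have osc j : exists m M, (forall a, m <= iter (N * j) kact v a <= M) /\
    M - m = (1 - de) ^+ j * (2 * K).
  elim: j => [|j [m [M [h1 h2]]]].
    exists (- K), K; split; last by rewrite expr0; ring.
    by move=> a; rewrite muln0/= -ler_norml.
  rewrite mulnSr addnC.
  exists (de * iter (N * j) kact v o + (1 - de) * m), (de * iter (N * j) kact v o + (1 - de) * M).
  split; first by move=> a; rewrite iterD; exact: shrink.
  by rewrite exprS -mulrA -h2; ring.
have [S S0 piS] : exists2 S : R, 0 < S & \sum_a `|pi a| <= S.
  by exists (\sum_a `|pi a| + 1); [rewrite ltr_wpDl// sumr_ge0|rewrite lerDl].
have : (1 - de) ^+ j * (2 * K * S) @[j --> \oo] --> 0.
  rewrite -(mul0r (2 * K * S)); apply: cvgM; last exact: cvg_cst.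
  by apply: cvg_expr; rewrite ger0_norm ?subr_ge0// ltrBlDr ltrDl.
move=> /cvgrPdist_le/(_ e e0)[j _ /(_ j (leqnn j))]; rewrite sub0r normrN => hj.
exists (N * j)%N => a.
have [m [M [h1 h2]]] := osc j.
have -> : iter (N * j) kact v a = \sum_b pi b * (iter (N * j) kact v a - iter (N * j) kact v b).
  under eq_bigr do rewrite mulrBr.
  by rewrite sumrB pi_iter_kact piv subr0 -mulr_suml pi_sum1 mul1r.
apply: le_trans (ler_norm_sum _ _ _) _.
apply: (@le_trans _ _ (\sum_b `|pi b| * (M - m))).
  apply: ler_sum => b _; rewrite normrM ler_wpM2l//.
  have /andP[a1 a2] := h1 a; have /andP[b1 b2] := h1 b.
  by rewrite ler_norml; apply/andP; split; lra.
have Mm : 0 <= M - m by have /andP[a1 a2] := h1 a; lra.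
rewrite -mulr_suml; apply: (@le_trans _ _ (S * (M - m))); first by rewrite ler_wpM2r.
apply: le_trans hj.
have -> : S * (M - m) = (1 - de) ^+ j * (2 * K * S) by rewrite h2; ring.
exact: ler_norm.
Qed.

Lemma harmonic_cst v : kact v = v -> forall a b, v a = v b.
Proof.
move=> hv; have hn n : iter n kact v = v by elim: n => //= n ->.
pose L := \sum_a pi a * v a.
suff h a : v a = L by move=> a b; rewrite !h.
apply/eqP; rewrite -subr_eq0 -normr_le0; apply/ler_addgt0Pr => e e0; rewrite add0r.
have : \sum_a pi a * (v a + - L) = 0.
  under eq_bigr do rewrite mulrDr.
  by rewrite big_split/= -mulr_suml pi_sum1 mul1r subrr.
move=> /mixing/(_ e0)[m /(_ a)].
by rewrite iter_kactD iter_kact_cst hn.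
Qed.

(** The matrix of I - P + 1 pi is invertible: a vector of its kernel has mean 0,
    hence is harmonic, hence constant by mixing, hence 0. *)
Lemma poisson_equation v : \sum_a pi a * v a = 0 -> exists k, forall a, k a - kact k a = v a.
Proof.
move=> piv.
(* the matrix of I - P + 1 pi, in the enumeration of T *)
pose A : 'M[R]_#|T| := \matrix_(i, j) ((i == j)%:R - P (enum_val i) (enum_val j) + pi (enum_val j)).
have AE (k : T -> R) i : (A *m \col_j k (enum_val j)) i 0 =
    k (enum_val i) - kact k (enum_val i) + \sum_a pi a * k a.
  rewrite !mxE; under eq_bigr do rewrite !mxE mulrDl mulrBl.
  rewrite big_split/= sumrB; congr (_ - _ + _).
  - by rewrite (bigD1 i)//= eqxx mul1r big1 ?addr0// => j /negPf ji; rewrite eq_sym ji mul0r.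
  - by rewrite /kact [RHS]big_enum_val.
  - by rewrite [RHS]big_enum_val.
have uA : A \in unitmx.
  rewrite unitmxE unitfE -det_tr; apply/negP => /det0P[x /negP x0 xA]; apply: x0.
  pose k a := x 0 (enum_rank a).
  have kx : x^T = \col_j k (enum_val j).
    by apply/matrixP => i j; rewrite !mxE /k enum_valK ord1.
  have {}xA : A *m x^T = 0 by rewrite -[A]trmxK -trmx_mul xA trmx0.
  have h a : k a - kact k a + \sum_a pi a * k a = 0.
    by have := AE k (enum_rank a); rewrite -kx xA mxE enum_rankK => <-.
  have pik : \sum_a pi a * k a = 0.
    have : \sum_a pi a * (k a - kact k a + \sum_a pi a * k a) = 0.
      by rewrite big1// => a _; rewrite h mulr0.
    under eq_bigr do rewrite mulrDr mulrBr.
    by rewrite big_split/= sumrB pi_kact subrr add0r -mulr_suml pi_sum1 mul1r.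
  have hk : kact k = k.
    by apply/funext => a; apply/esym/eqP; rewrite -subr_eq0 -(h a) pik addr0.
  have kc := harmonic_cst hk.
  have k0 a : k a = 0.
    rewrite -pik; under eq_bigr do rewrite (kc _ a).
    by rewrite -mulr_suml pi_sum1 mul1r.
  by apply/eqP/matrixP => i j; rewrite mxE ord1 -(enum_valK j); exact: k0.
pose y := invmx A *m \col_j v (enum_val j).
pose k a := y (enum_rank a) 0.
exists k => a.
have ky : y = \col_j k (enum_val j).
  by apply/matrixP => i j; rewrite [RHS]mxE /k enum_valK ord1.
have h b : k b - kact k b + \sum_a pi a * k a = v b.
  by have := AE k (enum_rank b); rewrite -ky mulmxA mulmxV// mul1mx mxE enum_rankK.
have : \sum_a pi a * (k a - kact k a + \sum_a pi a * k a) = 0.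
  by rewrite -[RHS]piv; apply: eq_bigr => b _; rewrite h.
under eq_bigr do rewrite mulrDr mulrBr.
rewrite big_split/= sumrB pi_kact subrr add0r -mulr_suml pi_sum1 mul1r => hk.
by have := h a; rewrite hk addr0.
Qed.

End MarkovOperator.

(** * Additive functionals of a Markov chain *)

Section Trigonometry.
Variable R : realType.
Implicit Types x y z : R.

(** Applied four times in a row, starting from cos <= 1, this gives the Taylor
    bounds of sine and cosine. *)
Lemma ge0_of_derive_ge0 (f df : R -> R) : (forall x : R, is_derive x 1 f (df x)) ->
  (forall x, 0 <= x -> 0 <= df x) -> f 0 = 0 -> forall x, 0 <= x -> 0 <= f x.
Proof.
move=> fd df0 f0 x x0; rewrite -f0.
apply: (@ger0_derive1_ndecr R f 0 x) => //.
- move=> y; rewrite in_itv/= => /andP[/ltW y0 _].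
  by rewrite derive1E; have [_ ->] := fd y; exact: df0.
- apply: derivable_within_continuous => y _.
  by have [h _] := fd y; exact: h.
Qed.

Lemma sin_le_id x : 0 <= x -> sin x <= x.
Proof.
have fd (y : R) : is_derive y 1 (fun x : R => x - sin x) (1 - cos y).
  by apply: is_derive_eq; rewrite /GRing.scale/=; ring.
move=> x0; rewrite -subr_ge0; move: x x0; apply: (ge0_of_derive_ge0 fd).
- by move=> x _; rewrite subr_ge0 cos_le1.
- by rewrite sin0 subr0.
Qed.

Lemma cos_ge_taylor x : 0 <= x -> 1 - x ^+ 2 / 2 <= cos x.
Proof.
have fd (y : R) : is_derive y 1 (fun x : R => cos x - (1 - x ^+ 2 / 2)) (y - sin y).
  by apply: is_derive_eq; rewrite /GRing.scale/= !mulr0 !add0r; field.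
move=> x0; rewrite -subr_ge0; move: x x0; apply: (ge0_of_derive_ge0 fd).
- by move=> x x0; rewrite subr_ge0 sin_le_id.
- by rewrite cos0 expr0n/= mul0r subr0 subrr.
Qed.

Lemma sin_ge_taylor x : 0 <= x -> x - x ^+ 3 / 6 <= sin x.
Proof.
have fd (y : R) : is_derive y 1 (fun x : R => sin x - (x - x ^+ 3 / 6)) (cos y - (1 - y ^+ 2 / 2)).
  by apply: is_derive_eq; rewrite /GRing.scale/= !mulr0 !add0r; field.
move=> x0; rewrite -subr_ge0; move: x x0; apply: (ge0_of_derive_ge0 fd).
- by move=> x x0; rewrite subr_ge0 cos_ge_taylor.
- by rewrite sin0 expr0n/= mul0r !subr0.
Qed.

Lemma cos_le_taylor x : 0 <= x -> cos x <= 1 - x ^+ 2 / 2 + x ^+ 4 / 24.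
Proof.
have fd (y : R) : is_derive y 1 (fun x : R => 1 - x ^+ 2 / 2 + x ^+ 4 / 24 - cos x)
    (sin y - (y - y ^+ 3 / 6)).
  by apply: is_derive_eq; rewrite /GRing.scale/= !mulr0 !add0r; field.
move=> x0; rewrite -subr_ge0; move: x x0; apply: (ge0_of_derive_ge0 fd).
- by move=> x x0; rewrite subr_ge0 sin_ge_taylor.
- by rewrite cos0 !expr0n/= !mul0r subr0 addr0 subrr.
Qed.

Lemma cos_taylor2 y z : `|z| <= 1 ->
  `|cos (y + z) - (cos y - z * sin y - z ^+ 2 / 2 * cos y)| <= `|z| ^+ 3.
Proof.
wlog z0 : y z / 0 <= z.
  move=> H; have [z0|z0] := leP 0 z; first exact: H.
  rewrite -normrN => z1.
  have z0' : 0 <= - z by rewrite oppr_ge0 ltW.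
  have := H (- y) (- z) z0' z1.
  by rewrite -opprD cosN cosN sinN sqrrN mulrNN.
rewrite (ger0_norm z0) => z1.
have -> : cos (y + z) - (cos y - z * sin y - z ^+ 2 / 2 * cos y) =
  cos y * (cos z - (1 - z ^+ 2 / 2)) + sin y * (z - sin z) by rewrite cosD; ring.
have h1 := cos_ge_taylor z0; have h2 := cos_le_taylor z0.
have h3 := sin_ge_taylor z0; have h4 := sin_le_id z0.
apply: le_trans (ler_normD _ _) _; rewrite !normrM.
have e1 : `|cos z - (1 - z ^+ 2 / 2)| <= z ^+ 3 / 24.
  have : z ^+ 4 <= z ^+ 3 by apply: ler_wiXn2l.
  by rewrite ger0_norm ?subr_ge0//; lra.
have e2 : `|z - sin z| <= z ^+ 3 / 6 by rewrite ger0_norm ?subr_ge0//; lra.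
have z3 : 0 <= z ^+ 3 by rewrite exprn_ge0.
apply: (@le_trans _ _ (1 * (z ^+ 3 / 24) + 1 * (z ^+ 3 / 6))); last by lra.
by apply: lerD; apply: ler_pM; rewrite ?normr_ge0 ?cos_max ?sin_max.
Qed.

Lemma sin_lip z : `|sin z| <= `|z|.
Proof.
wlog z0 : z / 0 <= z.
  move=> H; have [z0|z0] := leP 0 z; first exact: H.
  by rewrite -normrN -sinN -(normrN z); apply: H; rewrite oppr_ge0 ltW.
rewrite (ger0_norm z0) ler_norml sin_le_id// andbT.
have [z1|z1] := leP z 1.
  have := sin_ge_taylor z0.
  have : z ^+ 3 <= z by rewrite -[leRHS]expr1 ler_wiXn2l.
  lra.
by have := sin_geN1 z; lra.
Qed.

Lemma cos_lip y z : `|cos (y + z) - cos y| <= `|z|.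
Proof.
have -> : cos (y + z) - cos y = - 2 * sin (y + z / 2) * sin (z / 2).
  have -> : y + z = (y + z / 2) + z / 2 by field.
  have {2}-> : y = (y + z / 2) - z / 2 by ring.
  by rewrite (cosB (y + z / 2)) (cosD (y + z / 2)); ring.
rewrite !normrM normrN.
have h1 := sin_lip (z / 2); have h2 := sin_max (y + z / 2).
rewrite normrM (ger0_norm (_ : 0 <= 2^-1))// in h1.
rewrite (ger0_norm (_ : 0 <= 2))//.
have : `|sin (y + z / 2)| * `|sin (z / 2)| <= 1 * (`|z| / 2).
  by apply: ler_pM.
lra.
Qed.

Lemma expRN_taylor y : 0 <= y -> `|expR (- y) - (1 - y)| <= y ^+ 2.
Proof.
move=> y0; have h1 := expR_ge1Dx (- y); have h2 := expR_ge1Dx y.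
rewrite ger0_norm; last by lra.
have p : 0 < expR y by exact: expR_gt0.
have : expR (- y) * expR y = 1 by rewrite mulrC expRxMexpNx_1.
have q : 0 < expR (- y) by exact: expR_gt0.
set E := expR (- y) in q h1 *; set F := expR y in p h2 * => EF.
have : E * (1 + y) <= 1 by rewrite -[leRHS]EF ler_wpM2l// ltW.
have : E <= 1 by nra.
nra.
Qed.

End Trigonometry.

Section AdditiveFunctional.
Variables (R : realType) (T : finType) (P d : T -> T -> R).
Hypothesis P_ge0 : forall a b, 0 <= P a b.
Hypothesis P_sum1 : forall a, \sum_b P a b = 1.
Implicit Types (u v : T -> R -> R).

(** [iter n walk_step u a x] is the expectation of u (X_n) (x + S_n), where X is
    the chain with kernel P started at a and S_n the sum of the d along its
    path.  The same formula with a nonnegative matrix in place of P sums over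
    weighted walks. *)
Definition walk_step u a x := \sum_b P a b * u b (x + d a b).

Lemma le_iter_step n u v : (forall a x, u a x <= v a x) ->
  forall a x, iter n walk_step u a x <= iter n walk_step v a x.
Proof.
move=> h; elim: n => //= n ih a x.
by apply: ler_sum => b _; rewrite ler_wpM2l.
Qed.

Lemma iter_stepD n u v : iter n walk_step (fun a x => u a x + v a x) =
  (fun a x => iter n walk_step u a x + iter n walk_step v a x).
Proof.
elim: n => //= n ->; apply/funext => a; apply/funext => x.
by rewrite /walk_step -big_split; apply: eq_bigr => b _; rewrite mulrDr.
Qed.

Lemma iter_stepZ n c u : iter n walk_step (fun a x => c * u a x) =
  (fun a x => c * iter n walk_step u a x).
Proof.
elim: n => //= n ->; apply/funext => a; apply/funext => x.
by rewrite /walk_step mulr_sumr; apply: eq_bigr => b _; rewrite mulrCA.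
Qed.

Lemma iter_step_kact n (w : T -> R) : iter n walk_step (fun a _ => w a) = (fun a _ => iter n (kact P) w a).
Proof. by elim: n => //= n ->. Qed.

Lemma iter_step_cst n c : iter n walk_step (fun _ _ => c) = (fun _ _ => c).
Proof. by rewrite (iter_step_kact n (fun=> c)) iter_kact_cst. Qed.

Lemma norm_iter_step n u v : (forall a x, `|u a x| <= v a x) ->
  forall a x, `|iter n walk_step u a x| <= iter n walk_step v a x.
Proof.
move=> h a x; rewrite ler_norml; apply/andP; split; last first.
  by apply: le_iter_step => b y; apply: le_trans (h b y); exact: ler_norm.
rewrite -mulN1r -[X in X <= _]/((fun a x => -1 * iter n walk_step v a x) a x) -iter_stepZ.
by apply: le_iter_step => b y; rewrite mulN1r; have := h b y; rewrite ler_norml => /andP[].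
Qed.

Variable D : R.
Hypothesis d_le : forall a b, `|d a b| <= D.

(** In m steps the sum moves by at most m D, so only the values of u within that
    distance matter. *)
Lemma iter_step_local m u a x B : (forall b y, `|y - x| <= m%:R * D -> `|u b y| <= B) ->
  `|iter m walk_step u a x| <= B.
Proof.
elim: m u a x => [|m ih] u a x h /=.
  by apply: h; rewrite subrr normr0 mul0r.
apply: le_trans (ler_norm_sum _ _ _) _.
apply: (@le_trans _ _ (\sum_b P a b * B)); last by rewrite -mulr_suml P_sum1 mul1r.
apply: ler_sum => b _; rewrite normrM ger0_norm// ler_wpM2l//.
apply: ih => c y hy; apply: h.
have -> : y - x = (y - (x + d a b)) + d a b by ring.
by apply: le_trans (ler_normD _ _) _; rewrite -natr1 mulrDl mul1r lerD.
Qed.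

Variable pi : T -> R.
Hypothesis pi_sum1 : \sum_a pi a = 1.
Hypothesis pi_stat : forall b, \sum_a pi a * P a b = pi b.
Variables (o : T) (N : nat) (de : R).
Hypothesis de_gt0 : 0 < de.
Hypothesis minorization : forall a, de <= iter N (kact P) (fun b => (b == o)%:R) a.
Hypothesis d_centered : forall a, \sum_b P a b * d a b = 0.

Let v2 a := \sum_b P a b * d a b ^+ 2.
(** The stationary mean of the conditional variance of an increment, which is
    the asymptotic variance of S_n / sqrt n for centred increments. *)
Definition step_variance := \sum_a pi a * v2 a.

Let poisson_v2 : exists k, forall a, k a - kact P k a = v2 a - step_variance.
Proof.
apply: (poisson_equation P_ge0 P_sum1 pi_sum1 pi_stat de_gt0 minorization).
under eq_bigr do rewrite mulrBr.
by rewrite sumrB -mulr_suml pi_sum1 mul1r subrr.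
Qed.

Lemma iter_step_id n : iter n walk_step (fun _ x => x) = (fun _ x => x).
Proof.
elim: n => //= n ->; apply/funext => a; apply/funext => x.
rewrite /walk_step; under eq_bigr do rewrite mulrDr.
by rewrite big_split/= d_centered -mulr_suml P_sum1 mul1r addr0.
Qed.

(** If k solves the Poisson equation for the conditional variance, then the
    operator maps x^2 + k a to x^2 + k a + step_variance exactly. *)
Lemma iter_step_sqr : exists C, forall n a x,
  `|iter n walk_step (fun _ x => x ^+ 2) a x - (x ^+ 2 + n%:R * step_variance)| <= C.
Proof.
have [k kE] := poisson_v2.
have [K K0 kK] := fin_bound k.
exists (2 * K) => n a x.
have h : iter n walk_step (fun a x => x ^+ 2 + k a) = (fun a x => x ^+ 2 + k a + n%:R * step_variance).
  elim: n => [|n ih]; first by apply/funext => b; apply/funext => y; rewrite mul0r addr0.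
  rewrite iterS ih; apply/funext => b; apply/funext => y.
  have -> : k b = kact P k b + (v2 b - step_variance) by rewrite -kE addrC subrK.
  rewrite /walk_step /kact /v2 -(natr1 n).
  have -> : \sum_c P b c * ((y + d b c) ^+ 2 + k c + n%:R * step_variance) =
    \sum_c (P b c * (y ^+ 2 + n%:R * step_variance) + 2 * y * (P b c * d b c) + P b c * d b c ^+ 2 + P b c * k c).
    by apply: eq_bigr => c _; ring.
  rewrite !big_split/= -mulr_suml P_sum1 -mulr_sumr d_centered; ring.
have := congr2 (fun f g => f a x) h h.
rewrite iter_stepD (iter_step_kact n k) => hh.
have -> : iter n walk_step (fun _ x => x ^+ 2) a x - (x ^+ 2 + n%:R * step_variance) = k a - iter n (kact P) k a.
  by apply/eqP; rewrite subr_eq; apply/eqP; rewrite -(addrK (iter n (kact P) k a) (iter n walk_step _ a x)) hh; ring.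
apply: le_trans (ler_normB _ _) _; have -> : 2 * K = K + K by ring.
apply: lerD => //.
have := @norm_iter_step n (fun a _ => k a) (fun _ _ => K) (fun a _ => kK a) a 0.
by rewrite iter_step_cst iter_step_kact.
Qed.

Hypothesis pi_ge0 : forall a, 0 <= pi a.

Lemma step_variance_ge0 : 0 <= step_variance.
Proof.
by apply: sumr_ge0 => a _; rewrite mulr_ge0// sumr_ge0// => b _; rewrite mulr_ge0// sqr_ge0.
Qed.

Let D_ge0 : 0 <= D. Proof. exact: le_trans (normr_ge0 _) (d_le o o). Qed.

(** A plane wave with the second-order correction that makes it an approximate
    eigenfunction. *)
Definition wave (ka : T -> R) (eta c : R) (a : T) (x : R) :=
  cos (eta * x + c) * (1 + eta ^+ 2 * ka a).

(** Expand cos (y + eta d) to second order: the first-order term vanishes because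
    d is centred, and the second-order term - eta^2 v2 / 2, v2 being the
    conditional variance, is replaced by the constant - eta^2 step_variance / 2
    thanks to the Poisson equation satisfied by ka. *)
Lemma step_cos : exists (ka : T -> R) (C : R), 0 <= C /\ forall eta c a x,
  `|eta| <= 1 -> `|eta| * D <= 1 ->
  `|walk_step (wave ka eta c) a x - expR (- (eta ^+ 2 * step_variance / 2)) * wave ka eta c a x| <= C * `|eta| ^+ 3.
Proof.
have [k kE] := poisson_v2.
(* half of the corrector of the conditional variance, with the sign that
   cancels the fluctuation of - v2 / 2 *)
pose ka a := - (k a / 2).
have kaE a : kact P ka a = ka a + (v2 a - step_variance) / 2.
  have -> : ka = (fun b => - 2^-1 * k b) by apply/funext => b; rewrite /ka; field.
  by rewrite kactZ -kE; field.
have [K K0 kaK] := fin_bound ka.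
exists ka, (step_variance * K / 2 + (D ^+ 3 + K * D) + step_variance ^+ 2 / 4 * (1 + K)).
have s0 := step_variance_ge0.
split.
  have := exprn_ge0 2 s0; have := exprn_ge0 3 D_ge0; have : 0 <= K * D by rewrite mulr_ge0.
  have : 0 <= step_variance * K by rewrite mulr_ge0.
  move=> h1 h2 h3 h4; rewrite !addr_ge0// ?divr_ge0//.
  by rewrite mulr_ge0// ?divr_ge0// addr_ge0.
move=> eta c a x e1 eD; set w := wave ka eta c.
set y := eta * x + c.
pose A b := cos (y + eta * d a b) -
  (cos y - (eta * d a b) * sin y - (eta * d a b) ^+ 2 / 2 * cos y).
pose B b := cos (y + eta * d a b) - cos y.
have zle b : `|eta * d a b| <= `|eta| * D by rewrite normrM ler_wpM2l.
have hA b : `|A b| <= `|eta| ^+ 3 * D ^+ 3.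
  apply: (le_trans (cos_taylor2 _ (le_trans (zle b) eD))).
  by rewrite -exprMn lerXn2r// nnegrE mulr_ge0.
have hB b : `|B b| <= `|eta| * D by apply: le_trans (zle b); exact: cos_lip.
set q := eta ^+ 2 * step_variance / 2.
have q0 : 0 <= q by rewrite /q divr_ge0// mulr_ge0// sqr_ge0.
set E := expR (- q) - (1 - q).
have hE : `|E| <= q ^+ 2 by exact: expRN_taylor.
have key : walk_step w a x - expR (- q) * w a x =
   cos y * (q * eta ^+ 2 * ka a) + (\sum_b P a b * (A b + eta ^+ 2 * ka b * B b)
   - cos y * E * (1 + eta ^+ 2 * ka a)).
  have -> : walk_step w a x = \sum_b (P a b * (cos y) + (- (eta * sin y)) * (P a b * d a b) +
     (- (eta ^+ 2 / 2 * cos y)) * (P a b * d a b ^+ 2) + eta ^+ 2 * cos y * (P a b * ka b) +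
     P a b * (A b + eta ^+ 2 * ka b * B b)).
    apply: eq_bigr => b _; rewrite /w /wave /A /B.
    have -> : eta * (x + d a b) + c = y + eta * d a b by rewrite /y; ring.
    by field.
  rewrite !big_split/= -mulr_suml P_sum1 -!mulr_sumr d_centered -/(kact P ka a) kaE.
  rewrite -/(v2 a) /w /wave -/y /E /q.
  by field.
rewrite key.
set n := `|eta| in e1 eD zle hA hB *.
have n0 : 0 <= n by exact: normr_ge0.
have n2E : eta ^+ 2 = n ^+ 2 by rewrite /n real_normK// num_real.
have n31 : n ^+ 4 <= n ^+ 3 by apply: ler_wiXn2l.
have n21 : n ^+ 2 <= 1 by rewrite exprn_ile1.
apply: le_trans (ler_normD _ _) _; rewrite 2!mulrDl -addrA; apply: lerD.
  rewrite (normrM (cos y)).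
  have -> : `|q * eta ^+ 2 * ka a| = step_variance / 2 * n ^+ 4 * `|ka a|.
    rewrite normrM ger0_norm; last by rewrite mulr_ge0// sqr_ge0.
    by rewrite /q n2E; field.
  apply: (@le_trans _ _ (1 * (step_variance / 2 * n ^+ 4 * `|ka a|))).
    by rewrite ler_wpM2r// ?cos_max// !mulr_ge0// ?exprn_ge0// divr_ge0.
  rewrite mul1r; have -> : step_variance * K / 2 * n ^+ 3 = step_variance / 2 * n ^+ 3 * K by field.
  apply: ler_pM => //; first by rewrite mulr_ge0 ?exprn_ge0// divr_ge0.
  by rewrite ler_wpM2l// divr_ge0.
apply: le_trans (ler_normB _ _) _; apply: lerD.
  apply: le_trans (ler_norm_sum _ _ _) _.
  apply: (@le_trans _ _ (\sum_b P a b * ((D ^+ 3 + K * D) * n ^+ 3))); last first.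
    by rewrite -mulr_suml P_sum1 mul1r.
  apply: ler_sum => b _; rewrite normrM ger0_norm// ler_wpM2l//.
  apply: le_trans (ler_normD _ _) _; rewrite mulrDl; apply: lerD; first by rewrite mulrC.
  rewrite (normrM (eta ^+ 2 * ka b)) (normrM (eta ^+ 2)) n2E (ger0_norm (exprn_ge0 2 n0)).
  have -> : K * D * n ^+ 3 = n ^+ 2 * K * (n * D) by ring.
  apply: ler_pM => //; first by rewrite mulr_ge0// exprn_ge0.
  by rewrite ler_wpM2l// exprn_ge0.
rewrite (normrM (cos y * E)) (normrM (cos y)).
apply: (@le_trans _ _ (1 * q ^+ 2 * (1 + K))).
  apply: ler_pM; rewrite ?mulr_ge0//.
    by apply: ler_pM => //; exact: cos_max.
  apply: le_trans (ler_normD _ _) _; rewrite normr1 lerD2l (normrM (eta ^+ 2)) n2E (ger0_norm (exprn_ge0 2 n0)).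
  by rewrite -[leRHS]mul1r; apply: ler_pM => //; exact: exprn_ge0.
rewrite mul1r /q n2E.
have -> : (n ^+ 2 * step_variance / 2) ^+ 2 * (1 + K) = step_variance ^+ 2 / 4 * (1 + K) * n ^+ 4 by field.
by rewrite ler_wpM2l// mulr_ge0// ?divr_ge0 ?sqr_ge0// addr_ge0.
Qed.

(** The operator is a contraction for the sup norm and rho is at most 1, so the
    errors only add up. *)
Lemma iter_step_approx (w : T -> R -> R) (rho B : R) n : 0 <= rho <= 1 ->
  (forall a x, `|walk_step w a x - rho * w a x| <= B) ->
  forall a x, `|iter n walk_step w a x - rho ^+ n * w a x| <= n%:R * B.
Proof.
move=> /andP[r0 r1] h; elim: n => [|n ih] a x; first by rewrite expr0 mul1r subrr normr0 mul0r.
have -> : iter n.+1 walk_step w = iter n walk_step (fun a x => (walk_step w a x - rho * w a x) + rho * w a x).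
  by rewrite iterSr; congr iter; apply/funext => b; apply/funext => z; rewrite subrK.
rewrite (iter_stepD n (fun a x => walk_step w a x - rho * w a x)) iter_stepZ.
set e := iter n walk_step _ a x.
have he : `|e| <= B.
  have := norm_iter_step n h a x.
  by rewrite iter_step_cst.
have -> : e + rho * iter n walk_step w a x - rho ^+ n.+1 * w a x =
  e + rho * (iter n walk_step w a x - rho ^+ n * w a x) by rewrite exprS; ring.
apply: le_trans (ler_normD _ _) _; rewrite -natr1 mulrDl mul1r addrC; apply: lerD => //.
rewrite normrM (ger0_norm r0); apply: le_trans (ih a x).
by rewrite ler_piMl.
Qed.

Definition invsqrt (n : nat) : R := (Num.sqrt n%:R)^-1.

Lemma invsqrt_ge0 n : 0 <= invsqrt n.
Proof. by rewrite invr_ge0 sqrtr_ge0. Qed.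

Lemma sqr_invsqrt n : invsqrt n ^+ 2 = n%:R^-1.
Proof. by rewrite exprVn sqr_sqrtr. Qed.

Lemma mul_invsqrt n : (0 < n)%N -> n%:R * invsqrt n ^+ 2 = 1.
Proof. by move=> n0; rewrite sqr_invsqrt divff// pnatr_eq0 -lt0n. Qed.

Lemma cvg_invsqrt : invsqrt n @[n --> \oo] --> 0.
Proof.
apply/cvgrPdist_le => e e0; near=> n; rewrite sub0r normrN ger0_norm ?invsqrt_ge0//.
have n0 : (0 < n)%N by near: n; exact: nbhs_infty_gt.
rewrite -(@ler_pXn2r _ 2) ?nnegrE ?invsqrt_ge0 ?(ltW e0)// sqr_invsqrt.
have h : (e : R) ^- 2 <= n%:R by near: n; exact: nbhs_infty_ger.
by rewrite -[leLHS]mul1r ler_pdivrMr ?ltr0n// -ler_pdivrMl ?exprn_gt0// mulr1.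
Unshelve. all: end_near. Qed.

Lemma near_invsqrt (e : R) : 0 < e -> \forall n \near \oo, invsqrt n <= e.
Proof.
move=> e0; have /cvgrPdist_le/(_ e e0) := cvg_invsqrt.
by apply: filterS => n; rewrite sub0r normrN ger0_norm ?invsqrt_ge0.
Qed.

(** [step_cos] with eta = th / sqrt n: the accumulated error is
    n O(n^(-3/2)), and the n-th power of the eigenvalue is the limit. *)
Lemma cvg_iter_step_cos th c a :
  iter n walk_step (fun _ x => cos (th * (invsqrt n * x) + c)) a 0 @[n --> \oo] -->
  cos c * expR (- (th ^+ 2 * step_variance / 2)).
Proof.
have [ka [C [C0 h]]] := step_cos.
have [K K0 kaK] := fin_bound ka.
pose M := `|th| ^+ 3 * C + 2 * K * th ^+ 2.
have t3 : 0 <= `|th| ^+ 3 by rewrite exprn_ge0.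
have M0 : 0 <= M.
  by rewrite addr_ge0// mulr_ge0// ?sqr_ge0// mulr_ge0.
have p : 0 < `|th| + `|th| * D + 1 by rewrite ltr_wpDl// addr_ge0// mulr_ge0.
apply/cvgrPdist_le => e e0; near=> n.
have n0 : (0 < n)%N by near: n; exact: nbhs_infty_gt.
pose s := invsqrt n.
have s0 : 0 <= s by exact: invsqrt_ge0.
have s1 : s <= 1 by rewrite /s; near: n; apply: near_invsqrt.
have sA : s * (`|th| + `|th| * D + 1) <= 1.
  rewrite -ler_pdivlMr// mul1r.
  by rewrite /s; near: n; apply: near_invsqrt; rewrite invr_gt0.
have sM : s * (M + 1) <= e.
  rewrite -ler_pdivlMr; last by rewrite ltr_wpDl.
  by rewrite /s; near: n; apply: near_invsqrt; rewrite divr_gt0// ltr_wpDl.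
pose eta := th * s.
have etaE : `|eta| = `|th| * s by rewrite normrM (ger0_norm s0).
have sD : 0 <= s * (`|th| * D) by rewrite mulr_ge0// mulr_ge0.
have st : 0 <= s * `|th| by rewrite mulr_ge0.
have e1 : `|eta| <= 1 by rewrite etaE; lra.
have e2 : `|eta| * D <= 1 by rewrite etaE; lra.
pose w := wave ka eta c.
pose rho := expR (- (eta ^+ 2 * step_variance / 2)).
have rho01 : 0 <= rho <= 1.
  rewrite expR_ge0/= expR_le1 oppr_le0 divr_ge0// mulr_ge0 ?sqr_ge0//; exact: step_variance_ge0.
have ns : n%:R * s ^+ 2 = 1 by exact: mul_invsqrt.
have rhon : rho ^+ n = expR (- (th ^+ 2 * step_variance / 2)).
  rewrite -expRM_natl; congr expR.
  rewrite /eta.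
  have -> : n%:R * - ((th * s) ^+ 2 * step_variance / 2) = - (th ^+ 2 * (n%:R * s ^+ 2) * step_variance / 2) by field.
  by rewrite ns mulr1.
have hw := iter_step_approx n rho01 (fun a x => h eta c a x e1 e2) a 0.
rewrite -/w rhon in hw.
set G := expR _ in hw *.
have G01 : 0 <= G <= 1 by rewrite /G -rhon; case/andP: rho01 => r0 r1; rewrite exprn_ge0// exprn_ile1.
have -> : (fun (_ : T) x => cos (th * (s * x) + c)) =
    (fun a x => w a x + (-1) * (cos (eta * x + c) * (eta ^+ 2 * ka a))).
  by apply/funext => b; apply/funext => x; rewrite /w /wave /eta mulrA; ring.
rewrite iter_stepD iter_stepZ mulN1r.
set F := iter n walk_step (fun a x => cos (eta * x + c) * (eta ^+ 2 * ka a)) a 0.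
have hF : `|F| <= eta ^+ 2 * K.
  have := @norm_iter_step n (fun a x => cos (eta * x + c) * (eta ^+ 2 * ka a))
    (fun _ _ => eta ^+ 2 * K) _ a 0.
  rewrite iter_step_cst; apply => b x.
  rewrite normrM (normrM (eta ^+ 2)) (ger0_norm (sqr_ge0 eta)) -[leRHS]mul1r.
  apply: ler_pM; [by []|by rewrite mulr_ge0// sqr_ge0|exact: cos_max|].
  by rewrite ler_wpM2l// sqr_ge0.
set W := iter n walk_step w a 0 in hw *.
have -> : cos c * G - (W - F) = F - (W - G * w a 0) - G * cos c * (eta ^+ 2 * ka a).
  by rewrite /w /wave mulr0 add0r; ring.
apply: le_trans (ler_normB _ _) _; apply: (le_trans (lerD (ler_normB _ _) (lexx _))).
have h3 : `|G * cos c * (eta ^+ 2 * ka a)| <= eta ^+ 2 * K.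
  rewrite normrM (normrM G) (normrM (eta ^+ 2)) (ger0_norm (sqr_ge0 eta)) -[leRHS]mul1r.
  apply: ler_pM; [by rewrite mulr_ge0|by rewrite mulr_ge0// sqr_ge0| |].
    rewrite -[leRHS]mul1r; apply: ler_pM => //; last exact: cos_max.
    by case/andP: G01 => g0 g1; rewrite ger0_norm.
  by rewrite ler_wpM2l// sqr_ge0.
have h4 : n%:R * (C * `|eta| ^+ 3) = s * (`|th| ^+ 3 * C).
  rewrite etaE.
  have -> : n%:R * (C * (`|th| * s) ^+ 3) = (n%:R * s ^+ 2) * (s * (`|th| ^+ 3 * C)) by ring.
  by rewrite ns mul1r.
have h5 : eta ^+ 2 * K <= s * (K * th ^+ 2).
  rewrite /eta; have -> : (th * s) ^+ 2 * K = s * (s * (K * th ^+ 2)) by ring.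
  rewrite ler_wpM2l// ler_piMl// mulr_ge0// sqr_ge0//.
rewrite h4 in hw.
have sM' : s * M <= e by apply: le_trans sM; rewrite ler_wpM2l// lerDl.
rewrite /M in sM'; lra.
Unshelve. all: end_near. Qed.

(** For r of stationary mean 0, run the chain n - m steps and then m more.  The
    last m steps change S_n / sqrt n by O(m / sqrt n) only, while they bring the
    mean of r close to 0; the second moment bounds what remains.  This is what
    allows one to condition on the endpoint. *)
Lemma cvg_iter_step_cond (U : R -> R) (K : R) (r : T -> R) a : 0 <= K ->
  (forall y, `|U y| <= K * (1 + y ^+ 2)) ->
  (forall y z, `|z| <= 1 -> `|U (y + z) - U y| <= K * `|z| * (1 + y ^+ 2)) ->
  \sum_a pi a * r a = 0 ->
  iter n walk_step (fun b x => U (invsqrt n * x) * r b) a 0 @[n --> \oo] --> 0.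
Proof.
move=> K0 U1 U2 pir.
have [C hC] := iter_step_sqr.
have [Rr R0 rR] := fin_bound r.
pose Q := 1 + (`|C| + step_variance).
have Q0 : 0 < Q by rewrite ltr_wpDr// addr_ge0// step_variance_ge0.
apply/cvgrPdist_le => e e0.
pose e1 := e / (2 * (K + 1) * Q).
have e10 : 0 < e1 by rewrite divr_gt0// !mulr_gt0// ltr_wpDl.
have [m hm] := mixing P_ge0 P_sum1 pi_sum1 pi_stat de_gt0 minorization pir e10.
have mD : 0 <= m%:R * D by rewrite mulr_ge0.
have p : 0 < m%:R * D * Rr + 1 by rewrite ltr_wpDl// mulr_ge0.
near=> n.
have n0 : (0 < n)%N by near: n; exact: nbhs_infty_gt.
have mn : (m <= n)%N by near: n; exact: nbhs_infty_ge.
pose s := invsqrt n.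
have s0 : 0 <= s by exact: invsqrt_ge0.
have sm : s * (m%:R * D + 1) <= 1.
  rewrite -ler_pdivlMr ?mul1r; last by rewrite ltr_wpDl.
  by rewrite /s; near: n; apply: near_invsqrt; rewrite invr_gt0 ltr_wpDl.
have sm2 : s * (m%:R * D * Rr + 1) <= e1.
  rewrite -ler_pdivlMr//.
  by rewrite /s; near: n; apply: near_invsqrt; rewrite divr_gt0.
have smD : s * (m%:R * D) <= 1 by apply: le_trans sm; rewrite ler_wpM2l// lerDl.
have smDR : s * (m%:R * D * Rr) <= e1 by apply: le_trans sm2; rewrite ler_wpM2l// lerDl.
have hmid b x : `|iter m walk_step (fun b x => U (s * x) * r b) b x| <= K * (2 * e1) * (1 + s ^+ 2 * x ^+ 2).
  have -> : (fun b y => U (s * y) * r b) =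
     (fun b y => (U (s * y) - U (s * x)) * r b + U (s * x) * r b).
    by apply/funext => c; apply/funext => y; rewrite -mulrDl subrK.
  rewrite (iter_stepD m (fun b y => (U (s * y) - U (s * x)) * r b)).
  rewrite (iter_step_kact m (fun b => U (s * x) * r b)) iter_kactZ.
  apply: le_trans (ler_normD _ _) _.
  have g0 : 0 <= 1 + s ^+ 2 * x ^+ 2 by rewrite addr_ge0// mulr_ge0 ?sqr_ge0.
  have -> : K * (2 * e1) * (1 + s ^+ 2 * x ^+ 2) =
     K * (1 + s ^+ 2 * x ^+ 2) * e1 + K * (1 + s ^+ 2 * x ^+ 2) * e1 by ring.
  apply: lerD; last first.
    by rewrite normrM; apply: ler_pM => //; have := U1 (s * x); rewrite exprMn.
  apply: iter_step_local => c y hy.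
  rewrite normrM.
  have hz : `|s * (y - x)| <= s * (m%:R * D) by rewrite normrM (ger0_norm s0) ler_wpM2l.
  have := U2 (s * x) (s * (y - x)) (le_trans hz smD).
  rewrite -mulrDr (addrC x) subrK exprMn => h.
  apply: (@le_trans _ _ (K * `|s * (y - x)| * (1 + s ^+ 2 * x ^+ 2) * Rr)).
    by apply: ler_pM.
  have -> : K * `|s * (y - x)| * (1 + s ^+ 2 * x ^+ 2) * Rr =
    K * (1 + s ^+ 2 * x ^+ 2) * (`|s * (y - x)| * Rr) by ring.
  rewrite ler_wpM2l ?mulr_ge0//; apply: le_trans smDR.
  by rewrite (mulrA s) ler_wpM2r.
rewrite sub0r normrN.
rewrite -(subnK mn) iterD.
have := norm_iter_step (n - m) hmid a 0.
rewrite (iter_stepZ (n - m) (K * (2 * e1)) (fun _ x => 1 + s ^+ 2 * x ^+ 2)).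
rewrite (iter_stepD (n - m) (fun _ _ => 1) (fun _ x => s ^+ 2 * x ^+ 2)) iter_step_cst.
rewrite (iter_stepZ (n - m) (s ^+ 2) (fun _ x => x ^+ 2)).
rewrite subnK// -/s => /le_trans; apply.
have hq : 1 + s ^+ 2 * iter (n - m) walk_step (fun _ x => x ^+ 2) a 0 <= Q.
  rewrite lerD2l.
  have := hC (n - m)%N a 0; rewrite expr0n/= add0r ler_norml => /andP[_].
  rewrite lerBlDr => h.
  have s21 : s ^+ 2 <= 1.
    by rewrite /s sqr_invsqrt invf_le1 ?ltr0n// ler1n.
  apply: (@le_trans _ _ (s ^+ 2 * (`|C| + n%:R * step_variance))).
    rewrite ler_wpM2l ?sqr_ge0//; apply: (le_trans h); apply: lerD; first exact: ler_norm.
    by rewrite ler_wpM2r ?step_variance_ge0// ler_nat leq_subr.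
  rewrite mulrDr; apply: lerD; first by rewrite ler_piMl.
  by rewrite mulrA (mulrC _ n%:R) mul_invsqrt// mul1r.
apply: (@le_trans _ _ (K * (2 * e1) * Q)).
  by apply: ler_wpM2l => //; apply: mulr_ge0 => //; apply: mulr_ge0 => //; exact: ltW.
rewrite /e1.
have -> : K * (2 * (e / (2 * (K + 1) * Q))) * Q = K / (K + 1) * e.
  have K1 : K + 1 != 0 by rewrite gt_eqF// ltr_wpDl.
  have Qn : Q != 0 by rewrite gt_eqF.
  by field; rewrite Qn K1.
apply: ler_piMl; first exact: ltW.
by rewrite ler_pdivrMr ?ltr_wpDl// mul1r lerDl.
Unshelve. all: end_near. Qed.

End AdditiveFunctional.

(** * Perron eigenvectors *)

Lemma sum_continuous (R : realType) (X : topologicalType) (T : finType) (F : T -> X -> R) :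
  (forall a, continuous (F a)) -> continuous (fun f => \sum_a F a f).
Proof.
move=> Fc; suff h r : continuous (fun f => \sum_(a <- r) F a f) by exact: h.
elim: r => [|a r ih] f.
  rewrite (_ : (fun f => _) = cst 0); first exact: cvg_cst.
  by apply/funext => g; rewrite big_nil.
rewrite (_ : (fun f => _) = (fun f => F a f + \sum_(b <- r) F b f)).
  by apply: cvgD; [exact: Fc|exact: ih].
by apply/funext => g; rewrite big_cons.
Qed.

Lemma continuousMB (R : realType) (X : topologicalType) (u v w : X -> R) :
  continuous u -> continuous v -> continuous w -> continuous (fun f => u f * v f - w f).
Proof. by move=> uc vc wc f; apply: cvgB; [apply: cvgM; [exact: uc|exact: vc]|exact: wc]. Qed.

Lemma continuousZ (R : realType) (X : topologicalType) (c : R) (u : X -> R) :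
  continuous u -> continuous (fun f => c * u f).
Proof. by move=> uc f; apply: cvgM; [exact: cvg_cst|exact: uc]. Qed.

Section Perron.
Variables (R : realType) (T : finType) (A : T -> T -> R).
Hypothesis A_ge0 : forall a b, 0 <= A a b.
Variables (o : T) (N : nat).
Hypothesis A_o : 0 < A o o.
Hypothesis A_prim : forall x : T -> R, (forall a, 0 <= x a) -> (exists a, 0 < x a) ->
  forall a, 0 < iter N (kact A) x a.

(** Pairs of a scalar rho, at the index None, and a probability vector x, at the
    indices Some a, such that rho x <= A x.  One function space for both makes
    Tychonoff's theorem directly applicable. *)
Let simplex : set (prod_topology (fun _ : option T => R)) :=
  [set f | forall i, (if i is Some _ then `[0, 1] else `[0, \sum_a \sum_b A a b])%classic (f i)]
  `&` [set f | \sum_a f (Some a) = 1]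
  `&` [set f | forall a, f None * f (Some a) - \sum_b A a b * f (Some b) <= 0].

Let coord_continuous i : continuous (fun f : prod_topology (fun _ : option T => R) => f i).
Proof. exact: (@proj_continuous _ (fun _ : option T => R) i). Qed.

Let simplex_compact : compact simplex.
Proof.
apply: compact_closedI; first apply: compact_closedI.
- apply: (@tychonoff _ (fun=> R) (fun i => if i is Some _ then `[0, 1] else
    `[0, \sum_a \sum_b A a b])%classic).
  by case=> [a|]; exact: segment_compact.
- have -> : [set f : prod_topology (fun _ : option T => R) | \sum_a f (Some a) = 1] =
      (fun f : prod_topology (fun _ : option T => R) => \sum_a f (Some a)) @^-1` [set 1] by [].
  apply: closed_comp; last exact: closed_eq.
  by move=> f _; apply: sum_continuous => a; exact: coord_continuous.
- have -> : [set f : prod_topology (fun _ : option T => R) |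
      forall a, f None * f (Some a) - \sum_b A a b * f (Some b) <= 0] =
     \bigcap_(a in setT) ((fun f : prod_topology (fun _ : option T => R) =>
       f None * f (Some a) - \sum_b A a b * f (Some b)) @^-1` [set x | x <= 0]).
    by apply/seteqP; split => [f h a _|f h a]; [exact: h|exact: (h a I)].
  apply: closed_bigI => a _; apply: closed_comp; last exact: closed_le.
  move=> f _; apply: (@continuousMB R (prod_topology (fun _ : option T => R))
    (fun f => f None) (fun f => f (Some a)) (fun f => \sum_b A a b * f (Some b))).
  - exact: coord_continuous.
  - exact: coord_continuous.
  - apply: (@sum_continuous R (prod_topology (fun _ : option T => R)) T
      (fun b f => A a b * f (Some b))) => b.
    apply: (@continuousZ R (prod_topology (fun _ : option T => R)) _ (fun f => f (Some b))).
    exact: coord_continuous.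
Qed.

Let subeigen_simplex (y : T -> R) (rho : R) : 0 <= rho -> (forall a, 0 <= y a) ->
  (exists a, 0 < y a) ->
  (forall a, rho * y a <= kact A y a) ->
  simplex (fun i => if i is Some a then y a / \sum_b y b else rho).
Proof.
move=> rho0 y0 [a0 ya0] ry.
have S0 : 0 < \sum_b y b by rewrite (bigD1 a0)//= ltr_wpDr// sumr_ge0.
have ySum : \sum_a y a / \sum_b y b = 1 by rewrite -mulr_suml divff// gt_eqF.
have yS a : 0 <= y a / \sum_b y b <= 1.
  apply/andP; split; first by apply: divr_ge0 => //; exact: ltW.
  by rewrite ler_pdivrMr// mul1r (bigD1 a)//= lerDl sumr_ge0.
have ryS a : rho * (y a / \sum_b y b) <= \sum_b A a b * (y b / \sum_c y c).
  have -> : \sum_b A a b * (y b / \sum_c y c) = kact A y a / \sum_c y c.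
    by rewrite /kact mulr_suml; apply: eq_bigr => b _; rewrite mulrA.
  rewrite mulrA.
  by apply: ler_wpM2r; [rewrite invr_ge0; exact: ltW|exact: ry].
split; first split.
- case=> [a|] /=; first by rewrite in_itv/= yS.
  rewrite in_itv/= rho0/=.
  rewrite -[leLHS]mulr1 -ySum mulr_sumr; apply: ler_sum => a _.
  apply: le_trans (ryS a) _; apply: ler_sum => b _.
  by rewrite ler_piMr//; case/andP: (yS b).
- exact: ySum.
- by move=> a /=; rewrite subr_le0 ryS.
Qed.

(** Collatz and Wielandt: maximize rho over the compact set of the pairs above.
    If A x - rho x is not zero, then applying the N-th power of A makes it
    positive everywhere, and rho can be increased for the vector A^N x. *)
Lemma perron : exists (la : R) (h : T -> R), [/\ 0 < la, forall a, 0 < h a &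
  forall a, kact A h a = la * h a].
Proof.
have [] := @compact_EVT_max (prod_topology (fun _ : option T => R)) R
  (fun f => f None) simplex.
- exists (fun i => if i is Some a then 1 / \sum_(b : T) 1 else 0).
  apply: (subeigen_simplex (lexx 0) (fun=> ler01) (ex_intro _ o ltr01)) => a.
  by rewrite mul0r; apply: sumr_ge0 => b _; rewrite mulr_ge0.
- exact: simplex_compact.
- by apply: continuous_subspaceT; exact: coord_continuous.
move=> f; rewrite inE => -[[fbox fsum] fsub] fmax.
pose la := f None; pose x a := f (Some a).
have la0 : 0 <= la by have := fbox None; rewrite /= in_itv/= => /andP[].
have x0 a : 0 <= x a by have := fbox (Some a); rewrite /= in_itv/= => /andP[].
have xpos : exists a, 0 < x a.
  apply: contrapT => /forallNP hx.
  have : \sum_a x a = 0 by rewrite big1// => a _; apply/eqP; rewrite eq_le x0 andbT leNgt; exact/negP.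
  by rewrite fsum => /eqP; rewrite oner_eq0.
pose z a := kact A x a + (- la) * x a.
have z0 a : 0 <= z a by have := fsub a; rewrite subr_le0 /z mulNr subr_ge0.
have [zpos|/forallNP zN] := pselect (exists a, 0 < z a).
(* the excess z is not zero: rho can be increased *)
- have Bz := A_prim z0 zpos; have Bx := A_prim x0 xpos.
  set y := iter N (kact A) x in Bx.
  have BzE a : iter N (kact A) z a = kact A y a + (- la) * y a.
    by rewrite /z iter_kactD iter_kactZ -iterSr iterS.
  have [ep ep0 hep] : exists2 ep, 0 < ep & forall a, ep * y a <= iter N (kact A) z a.
    exists (\big[Order.min/1]_a (iter N (kact A) z a / y a)).
      by rewrite lt_bigmin// => a _; rewrite divr_gt0.
    by move=> a; rewrite -ler_pdivlMr// bigmin_le_cond.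
  have : simplex (fun i => if i is Some a then y a / \sum_b y b else la + ep).
    apply: subeigen_simplex.
    + by rewrite addr_ge0// ltW.
    + by move=> a; rewrite ltW.
    + by exists o.
    + by move=> a; have := hep a; rewrite BzE mulrDl mulNr; lra.
  move=> hs; have := fmax (fun i => if i is Some a then y a / \sum_b y b else la + ep).
  rewrite inE => /(_ hs) /=; rewrite -/la; lra.
- have hz a : kact A x a = la * x a.
    apply/eqP; rewrite -subr_eq0 -mulNr -/(z a) eq_le z0 andbT leNgt; exact/negP.
  have hB n : iter n (kact A) x = (fun a => la ^+ n * x a).
    elim: n => [|n ih]; first by apply/funext => a; rewrite expr0 mul1r.
    by rewrite iterS ih kactZ; apply/funext => a; rewrite hz exprS mulrCA mulrA.
  have xp a : 0 < x a.
    have := A_prim x0 xpos a; rewrite hB => h.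
    have := x0 a; rewrite le_eqVlt => /orP[/eqP e|//].
    by move: h; rewrite -e mulr0 ltxx.
  exists la, x; split => //.
  rewrite -(@pmulr_lgt0 _ (x o)) ?xp// -hz /kact (bigD1 o)//= ltr_wpDr//.
    by apply: sumr_ge0 => b _; rewrite mulr_ge0.
  by rewrite mulr_gt0.
Qed.

End Perron.

(** * Central limit theorem for closed walks *)

Section Walks.
Variables (R : realType) (T : finType) (A f : T -> T -> R) (o : T).
Hypothesis A_ge0 : forall a b, 0 <= A a b.
Hypothesis A_o : 0 < A o o.
Implicit Types (a b c : T) (g U : R -> R).

Definition indic_pt b : T -> R := fun c => (c == b)%:R.

Hypothesis A_conn : forall a b, exists n, 0 < iter n (kact A) (indic_pt b) a.

(** The sum of g (x + weight of w) over the walks w of length n from a to o, each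
    walk being counted with the product of the entries of A. *)
Definition walk_sum n g := iter n (walk_step A f) (fun b y => indic_pt o b * g y).

Let iter_kact_ge0 (B : T -> T -> R) n (x : T -> R) : (forall a b, 0 <= B a b) ->
  (forall a, 0 <= x a) -> forall a, 0 <= iter n (kact B) x a.
Proof.
move=> B0 x0; elim: n => //= n ih a.
by apply: sumr_ge0 => b _; rewrite mulr_ge0.
Qed.

Let indic_pt_ge0 b c : 0 <= indic_pt b c. Proof. exact: ler0n. Qed.

Let iter_kact_pt n (x : T -> R) b a : (forall c, 0 <= x c) ->
  x b * iter n (kact A) (indic_pt b) a <= iter n (kact A) x a.
Proof.
move=> x0; rewrite -(congr1 (@^~ a) (iter_kactZ A n (x b) (indic_pt b))).
apply: le_iter_kact => // c; rewrite /indic_pt; case: eqP => [->|_]; first by rewrite mulr1.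
by rewrite mulr0.
Qed.

Let iter_kact_trans p q a b c : 0 < iter p (kact A) (indic_pt b) a -> 0 < iter q (kact A) (indic_pt c) b ->
  0 < iter (p + q) (kact A) (indic_pt c) a.
Proof.
move=> h1 h2; rewrite iterD; apply: lt_le_trans (iter_kact_pt p b a _).
  by rewrite mulr_gt0.
by move=> e; apply: iter_kact_ge0.
Qed.

Let loop k : 0 < iter k (kact A) (indic_pt o) o.
Proof.
elim: k => [|k ih]; first by rewrite /= /indic_pt eqxx.
apply: (@iter_kact_trans 1 k o o o) => //=.
rewrite /kact (bigD1 o)//= /indic_pt eqxx mulr1 ltr_wpDr//.
by apply: sumr_ge0 => b _; rewrite mulr_ge0.
Qed.

(** The loop at o makes the lengths of the walks through o adjustable, so that
    one length suits all pairs of points. *)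
Let A_prim : exists N, forall a b, 0 < iter N (kact A) (indic_pt b) a.
Proof.
have [n hn] := choice (fun ab : T * T => A_conn ab.1 ab.2).
pose N := (\sum_ab n ab)%N.
have nN ab : (n ab <= N)%N by rewrite /N (bigD1 ab)//= leq_addr.
exists (N + N)%N => a b.
have h1 := hn (a, o); have h2 := hn (o, b); rewrite /= in h1 h2.
have -> : (N + N = n (a, o) + (((N - n (a, o)) + (N - n (o, b))) + n (o, b)))%N.
  by have := nN (a, o); have := nN (o, b); lia.
apply: iter_kact_trans h1 _; exact: iter_kact_trans (loop _) h2.
Qed.

Let A' a b := A b a.

Let kact_tr (x y : T -> R) : \sum_a x a * kact A y a = \sum_a kact A' x a * y a.
Proof.
rewrite /kact; under eq_bigr do rewrite mulr_sumr.
rewrite exchange_big/=; apply: eq_bigr => c _; rewrite mulr_suml; apply: eq_bigr => e _.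
by rewrite /A'; ring.
Qed.

Let iter_kact_tr n a b : iter n (kact A') (indic_pt b) a = iter n (kact A) (indic_pt a) b.
Proof.
have duality (x y : T -> R) : \sum_a x a * iter n (kact A) y a = \sum_a iter n (kact A') x a * y a.
  by elim: n x y => // n ih x y; rewrite iterSr ih kact_tr.
have := duality (indic_pt b) (indic_pt a).
rewrite (bigD1 b)//= [X in _ + X]big1 => [|c /negPf cb]; last by rewrite /indic_pt cb mul0r.
rewrite [RHS](bigD1 a)//= [X in _ = _ + X]big1 => [|c /negPf ca]; last by rewrite /indic_pt ca mulr0.
by rewrite {1}/indic_pt eqxx mul1r !addr0 /indic_pt eqxx mulr1 => <-.
Qed.

Let prim_pos (B : T -> T -> R) N : (forall a b, 0 <= B a b) ->
  (forall a b, 0 < iter N (kact B) (indic_pt b) a) ->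
  forall x : T -> R, (forall a, 0 <= x a) -> (exists a, 0 < x a) ->
  forall a, 0 < iter N (kact B) x a.
Proof.
move=> B0 hN x x0 [b xb] a.
apply: (@lt_le_trans _ _ (x b * iter N (kact B) (indic_pt b) a)); first by rewrite mulr_gt0.
rewrite -(congr1 (@^~ a) (iter_kactZ B N (x b) (indic_pt b))).
apply: le_iter_kact => // c; rewrite /indic_pt; case: eqP => [->|_]; first by rewrite mulr1.
by rewrite mulr0.
Qed.

(** With h and l the right and left Perron eigenvectors for the common
    eigenvalue la, the kernel A a b h b / (la h a) is stochastic with stationary
    law proportional to l h. *)
Theorem doob_transform : exists (la : R) (h pi : T -> R) (N : nat) (de : R),
  let P a b := A a b * h b / (la * h a) in
  [/\ 0 < la, forall a, 0 < h a, forall a, \sum_b P a b = 1 & forall a, 0 < pi a] /\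
  [/\ \sum_a pi a = 1, forall b, \sum_a pi a * P a b = pi b, 0 < de &
    forall a, de <= iter N (kact P) (indic_pt o) a].
Proof.
have [N hN] := A_prim.
have [la [h [la0 h0 hE]]] := perron A_ge0 A_o (prim_pos A_ge0 hN).
have A'_ge0 a b : 0 <= A' a b by exact: A_ge0.
have hN' a b : 0 < iter N (kact A') (indic_pt b) a by rewrite iter_kact_tr; exact: hN.
have [la' [l [la'0 l0 lE]]] := perron A'_ge0 A_o (prim_pos A'_ge0 hN').
have S0 : 0 < \sum_a l a * h a.
  rewrite (bigD1 o)//= ltr_wpDr ?mulr_gt0// sumr_ge0// => a _.
  by rewrite mulr_ge0// ltW.
(* pairing the two eigenvectors identifies the two eigenvalues *)
have laE : la' = la.
  have := kact_tr l h.
  under eq_bigr do rewrite hE mulrCA; rewrite -mulr_sumr.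
  under [RHS]eq_bigr do rewrite lE -mulrA; rewrite -mulr_sumr.
  by move=> /(mulIf (lt0r_neq0 S0)).
subst la'.
pose P a b := A a b * h b / (la * h a).
pose pi a := l a * h a / \sum_a l a * h a.
have h1 a : h a != 0 by rewrite gt_eqF.
have la1 : la != 0 by rewrite gt_eqF.
have S1 : \sum_a l a * h a != 0 by rewrite gt_eqF.
have P0 a b : 0 <= P a b by rewrite /P divr_ge0 ?mulr_ge0// ltW.
have PE (x : T -> R) a : kact P x a = (la * h a)^-1 * kact A (fun b => h b * x b) a.
  by rewrite /kact mulr_sumr; apply: eq_bigr => b _; rewrite /P; ring.
have hN1 a : 0 < iter N (kact P) (indic_pt o) a.
  have hP n (x : T -> R) : iter n (kact A) (fun b => h b * x b) = fun b => la ^+ n * (h b * iter n (kact P) x b).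
    elim: n => [|n ih]; first by apply/funext => b; rewrite expr0 mul1r.
    rewrite iterS ih kactZ; apply/funext => b; rewrite iterS PE exprS; field.
    by rewrite la1 h1.
  have := prim_pos A_ge0 hN (x := fun b => h b * indic_pt o b).
  rewrite hP => /(_ _ _ a) H.
  have : 0 < la ^+ N * (h a * iter N (kact P) (indic_pt o) a).
    apply: H; first by move=> b; rewrite mulr_ge0// ltW.
    by exists o; rewrite /indic_pt eqxx mulr1.
  by rewrite pmulr_rgt0 ?exprn_gt0// pmulr_rgt0.
exists la, h, pi, N, (\big[Order.min/1]_a iter N (kact P) (indic_pt o) a).
split; split => //.
- by move=> a; rewrite -mulr_suml -/(kact A h a) hE divff// mulf_neq0.
- by move=> a; rewrite /pi divr_gt0// mulr_gt0.
- by rewrite /pi -mulr_suml divff.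
- move=> b; rewrite /pi.
  transitivity ((la * \sum_a l a * h a)^-1 * h b * kact A' l b).
    rewrite /kact [RHS]mulr_sumr; apply: eq_bigr => a _; rewrite /A'; field.
    by rewrite la1 h1 S1.
  by rewrite lE; field; rewrite la1 S1.
- by rewrite lt_bigmin.
- by move=> a; exact: bigmin_le_cond.
Qed.

Lemma walk_sum1 n x : walk_sum n (fun=> 1) o x = iter n (kact A) (indic_pt o) o.
Proof.
rewrite /walk_sum (_ : (fun _ _ => _) = (fun b (_ : R) => indic_pt o b)).
  by rewrite iter_step_kact.
by apply/funext => b; apply/funext => y; rewrite mulr1.
Qed.

Let iter_step_shift (B e : T -> T -> R) n (u : T -> R -> R) z :
  iter n (walk_step B e) (fun b y => u b (y + z)) = fun a x => iter n (walk_step B e) u a (x + z).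
Proof.
elim: n => //= n ->; apply/funext => a; apply/funext => x.
by apply: eq_bigr => b _; rewrite addrAC.
Qed.

(** The weights f are replaced by d a b = f a b - m + ka b - ka a, which is
    centred for the Doob transform; the coboundary cancels along closed walks at
    o.  The end condition becomes the factor phi = indic_pt o / h, which is its
    mean L plus a function r of mean 0, and [cvg_iter_step_cond] removes r. *)
Theorem walk_clt : exists m s2 : R, 0 <= s2 /\
  let EW n U := walk_sum n (fun y => U (invsqrt R n * (y - n%:R * m))) o 0 /
                walk_sum n (fun=> 1) o 0 in
  [/\ EW n id @[n --> \oo] --> 0, EW n (fun y => y ^+ 2) @[n --> \oo] --> s2,
    forall th c : R, EW n (fun y => cos (th * y + c)) @[n --> \oo] -->
      cos c * expR (- (th ^+ 2 * s2 / 2)) &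
    s2 = 0 -> forall n g, walk_sum n g o 0 = g (n%:R * m) * walk_sum n (fun=> 1) o 0].
Proof.
have [la [h [pi [N [de]]]]] := doob_transform.
set P := fun a b => A a b * h b / (la * h a).
move=> [[la0 h0 P1 pi0] [pi1 pist de0 minorization]].
have h1 a : h a != 0 by rewrite gt_eqF.
have la1 : la != 0 by rewrite gt_eqF.
have P0 a b : 0 <= P a b by rewrite /P divr_ge0 ?mulr_ge0// ltW.
have pige0 a : 0 <= pi a by rewrite ltW.
have PE a b : P a b = A a b * h b / (la * h a) by [].
clearbody P.
pose fbar a := \sum_b P a b * f a b.
pose m := \sum_a pi a * fbar a.
have [k0 k0E] : exists k, forall a, k a - kact P k a = fbar a - m.
  apply: (poisson_equation P0 P1 pi1 pist de0 minorization).
  under eq_bigr do rewrite mulrBr.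
  by rewrite sumrB -mulr_suml pi1 mul1r subrr.
(* normalized at o, so that the coboundary does not shift the starting point *)
pose ka a := k0 a - k0 o.
have kaE a : ka a - kact P ka a = fbar a - m.
  rewrite -k0E /ka kactD (kact_cst P1); ring.
pose d a b := f a b - m + ka b - ka a.
have dc a : \sum_b P a b * d a b = 0.
  rewrite /d; under eq_bigr do rewrite mulrBr mulrDr mulrBr.
  rewrite sumrB big_split/= sumrB -!mulr_suml P1 -/(fbar a) -/(kact P ka a) !mul1r.
  by rewrite -kaE; ring.
have [D dD] : exists D, forall a b, `|d a b| <= D.
  have [D D0 hD] := fin_bound (fun ab : T * T => d ab.1 ab.2).
  by exists D => a b; exact: (hD (a, b)).
pose s2 := step_variance P d pi.
have s20 : 0 <= s2 by exact: step_variance_ge0.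
have gauge n (u : T -> R -> R) :
  iter n (walk_step A f) (fun b y => u b (y - n%:R * m + ka b)) =
  fun a x => iter n (walk_step A d) u a (x + ka a).
  elim: n u => [|n ih] u.
    by apply/funext => a; apply/funext => x; rewrite /= mul0r subr0.
  rewrite iterS.
  have -> : (fun b y => u b (y - n.+1%:R * m + ka b)) =
      (fun b y => u b (y + - m - n%:R * m + ka b)).
    by apply/funext => b; apply/funext => y; congr u; rewrite -natr1; ring.
  rewrite (iter_step_shift A f n (fun b y => u b (y - n%:R * m + ka b))) ih.
  apply/funext => a; apply/funext => x; rewrite iterS /walk_step.
  by apply: eq_bigr => b _; congr (_ * iter n _ u b _); rewrite /d; ring.
have ka_o : ka o = 0 by rewrite /ka subrr.
(* the end condition, after the Doob transform *)
pose phi b := indic_pt o b / h b.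
have forced_weight n (v : T -> R -> R) : iter n (walk_step A d) (fun b y => h b * v b y) =
    fun a x => la ^+ n * (h a * iter n (walk_step P d) v a x).
  elim: n => [|n ih]; first by apply/funext => a; apply/funext => x; rewrite expr0 mul1r.
  rewrite iterS ih; apply/funext => a; apply/funext => x; rewrite iterS /walk_step !mulr_sumr.
  by apply: eq_bigr => b _; rewrite PE exprS; field; rewrite la1 h1.
have walkA n g : walk_sum n (fun y => g (y - n%:R * m)) o 0 =
    iter n (walk_step A d) (fun b y => indic_pt o b * g y) o 0.
  rewrite /walk_sum.
  rewrite (_ : (fun b y => indic_pt o b * g (y - n%:R * m)) =
     (fun b y => indic_pt o b * g (y - n%:R * m + ka b))).
    by rewrite (gauge n (fun b y => indic_pt o b * g y)) ka_o addr0.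
  apply/funext => b; apply/funext => y; rewrite /indic_pt.
  by case: eqP => [->|_]; rewrite ?mul0r// ka_o addr0.
have walkE n g : walk_sum n (fun y => g (y - n%:R * m)) o 0 =
    la ^+ n * (h o * iter n (walk_step P d) (fun b y => g y * phi b) o 0).
  rewrite walkA -(congr1 (fun F => F o 0) (forced_weight n (fun b y => g y * phi b))).
  congr (iter n (walk_step A d) _ o 0); apply/funext => b; apply/funext => y.
  by rewrite /phi; field.
have Z n : walk_sum n (fun=> 1) o 0 = la ^+ n * (h o * iter n (kact P) phi o).
  rewrite (walkE n (fun=> 1)) -(congr1 (fun F => F o 0) (iter_step_kact P d n phi)).
  by under eq_fun do under eq_fun do rewrite mul1r.
pose L := \sum_a pi a * phi a.
have L0 : L != 0.
  rewrite /L (bigD1 o)//= big1 => [|a /negPf ao]; last by rewrite /phi /indic_pt ao mul0r mulr0.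
  by rewrite addr0 /phi /indic_pt eqxx div1r mulf_neq0 ?invr_eq0 ?h1// gt_eqF.
pose r b := phi b - L.
have pir : \sum_a pi a * r a = 0.
  rewrite /r; under eq_bigr do rewrite mulrBr.
  by rewrite sumrB -mulr_suml pi1 mul1r subrr.
have num U (K l : R) : 0 <= K -> (forall y, `|U y| <= K * (1 + y ^+ 2)) ->
    (forall y z, `|z| <= 1 -> `|U (y + z) - U y| <= K * `|z| * (1 + y ^+ 2)) ->
    iter n (walk_step P d) (fun _ y => U (invsqrt R n * y)) o 0 @[n --> \oo] --> l ->
    iter n (walk_step P d) (fun b y => U (invsqrt R n * y) * phi b) o 0 @[n --> \oo] --> L * l.
  move=> K0 U1 U2 Ul.
  have := cvg_iter_step_cond P0 P1 dD pi1 pist de0 minorization dc pige0 o K0 U1 U2 pir.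
  move=> h2; have : L * iter n (walk_step P d) (fun _ y => U (invsqrt R n * y)) o 0 +
     iter n (walk_step P d) (fun b y => U (invsqrt R n * y) * r b) o 0 @[n --> \oo] --> L * l + 0.
    by apply: cvgD h2; apply: cvgM Ul; exact: cvg_cst.
  rewrite addr0; apply: cvg_trans; apply: near_eq_cvg; apply: nearW => n.
  rewrite -(congr1 (fun F => F o 0) (iter_stepZ P d n L (fun _ y => U (invsqrt R n * y)))).
  rewrite -[LHS]/((fun a x => iter n (walk_step P d) _ a x + iter n (walk_step P d) _ a x) o 0).
  rewrite -iter_stepD; congr (iter n (walk_step P d) _ o 0).
  by apply/funext => b; apply/funext => y; rewrite /r; ring.
have den : iter n (kact P) phi o @[n --> \oo] --> L.
  rewrite -[X in _ --> X]mulr1.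
  rewrite (_ : (fun n => _) = (fun n => iter n (walk_step P d) (fun b _ => 1 * phi b) o 0)); last first.
    apply/funext => n; rewrite -(congr1 (fun F => F o 0) (iter_step_kact P d n phi)).
    by congr (iter n (walk_step P d) _ o 0); apply/funext => b; apply/funext => y; rewrite mul1r.
  apply: (num (fun=> 1) 1 1 ler01).
  - by move=> y; rewrite normr1 mul1r lerDl sqr_ge0.
  - by move=> y z _; rewrite subrr normr0 mul1r mulr_ge0// addr_ge0// sqr_ge0.
  - by under eq_fun do rewrite iter_step_cst//; exact: cvg_cst.
have EWE n U : walk_sum n (fun y => U (invsqrt R n * (y - n%:R * m))) o 0 /
                walk_sum n (fun=> 1) o 0 =
   iter n (walk_step P d) (fun b y => U (invsqrt R n * y) * phi b) o 0 / iter n (kact P) phi o.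
  rewrite (walkE n (fun y => U (invsqrt R n * y))) Z.
  rewrite -mulf_div divff ?expf_neq0// mul1r -mulf_div divff// mul1r//.
have lim U (K l : R) : 0 <= K -> (forall y, `|U y| <= K * (1 + y ^+ 2)) ->
    (forall y z, `|z| <= 1 -> `|U (y + z) - U y| <= K * `|z| * (1 + y ^+ 2)) ->
    iter n (walk_step P d) (fun _ y => U (invsqrt R n * y)) o 0 @[n --> \oo] --> l ->
    walk_sum n (fun y => U (invsqrt R n * (y - n%:R * m))) o 0 /
                walk_sum n (fun=> 1) o 0 @[n --> \oo] --> l.
  move=> K0 U1 U2 Ul; under eq_fun do rewrite EWE.
  have -> : l = (L * l) / L by field.
  by apply: cvgM; [exact: (num U K)|exact: cvgV].
exists m, s2; split => // EW; split.
- apply: (lim id 1) => //.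
  + by move=> y; rewrite mul1r -(real_normK (num_real y)); have := sqr_ge0 (`|y| - 1); nra.
  + move=> y z _; have -> : id (y + z) - id y = z by rewrite /=; ring.
    by rewrite mul1r ler_peMr// lerDl sqr_ge0.
  + have -> : (fun n => iter n (walk_step P d) (fun _ y => id (invsqrt R n * y)) o 0) = (fun=> 0).
      by apply/funext => n; rewrite iter_stepZ (iter_step_id P1 dc) mulr0.
    exact: cvg_cst.
- apply: (lim (fun y => y ^+ 2) 2) => //.
  + by move=> y; rewrite ger0_norm ?sqr_ge0//; have := sqr_ge0 y; lra.
  + move=> y z z1.
    have -> : (y + z) ^+ 2 - y ^+ 2 = z * (2 * y + z) by ring.
    rewrite normrM (mulrC 2 `|z|) -mulrA ler_wpM2l//.
    apply: le_trans (ler_normD _ _) _; rewrite normrM (ger0_norm (ler0n _ 2)).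
    rewrite -(real_normK (num_real y)); have := sqr_ge0 (`|y| - 1).
    by move: z1; have := sqr_ge0 `|y|; rewrite !expr2; lra.
  + have [C hC] := iter_step_sqr P0 P1 pi1 pist de0 minorization dc.
    rewrite -[X in _ --> X]add0r.
    have -> : (fun n => iter n (walk_step P d) (fun _ y => (invsqrt R n * y) ^+ 2) o 0) =
      (fun n => invsqrt R n ^+ 2 * (iter n (walk_step P d) (fun _ y => y ^+ 2) o 0 - n%:R * s2) +
         (n%:R * invsqrt R n ^+ 2) * s2).
      apply/funext => n; under eq_fun do under eq_fun do rewrite exprMn.
      by rewrite iter_stepZ; ring.
    apply: cvgD; last first.
      apply: cvg_near_cst; near=> n; rewrite mul_invsqrt ?mul1r//.
      by near: n; exact: nbhs_infty_gt.
    have h2 : invsqrt R n * C @[n --> \oo] --> 0.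
      by rewrite -(mul0r C); apply: cvgM; [exact: cvg_invsqrt|exact: cvg_cst].
    apply: norm_cvg0; apply: (squeeze_cvgr _ (cvg_cst 0) h2).
    near=> n; rewrite normr_ge0/= normrM (ger0_norm (sqr_ge0 _)).
    have := hC n o 0; rewrite expr0n/= add0r => hn.
    apply: ler_pM => //; first exact: sqr_ge0.
    rewrite expr2 ler_piMl ?invsqrt_ge0//.
    by near: n; apply: near_invsqrt.
- move=> th c; apply: (lim (fun y => cos (th * y + c)) (1 + `|th|)) => //.
  + move=> y; apply: le_trans (cos_max _) _.
    by have := mulr_ge0 (normr_ge0 th) (sqr_ge0 y); have := normr_ge0 th; have := sqr_ge0 y; lra.
  + move=> y z _.
    have -> : th * (y + z) + c = (th * y + c) + th * z by ring.
    apply: le_trans (cos_lip _ _) _; rewrite normrM.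
    have := mulr_ge0 (mulr_ge0 (normr_ge0 th) (normr_ge0 z)) (sqr_ge0 y).
    have := mulr_ge0 (normr_ge0 z) (sqr_ge0 y); have := normr_ge0 z.
    lra.
  + have H := @cvg_iter_step_cos R T P d P0 P1 D dD pi pi1 pist o N de de0 minorization dc pige0 th c o.
    exact: H.
(* all increments of positive probability vanish *)
- move=> s2E n g.
  have d0 a b : A a b * d a b = 0.
    have v0 : \sum_b P a b * d a b ^+ 2 = 0.
      have t0 c : 0 <= \sum_b P c b * d c b ^+ 2.
        by apply: sumr_ge0 => e _; rewrite mulr_ge0// sqr_ge0.
      have := s2E; rewrite /s2 /step_variance => /psumr_eq0P.
      move=> /(_ (fun c _ => mulr_ge0 (pige0 c) (t0 c)) a isT) /eqP.
      by rewrite mulf_eq0 gt_eqF//= => /eqP.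
    have /(_ b isT)/eqP := psumr_eq0P (fun e _ => mulr_ge0 (P0 a e) (sqr_ge0 (d a e))) v0.
    rewrite mulf_eq0 expf_eq0/= => /orP[|/eqP->]; last by rewrite mulr0.
    rewrite PE mulf_eq0 invr_eq0 !mulf_eq0 (negPf la1) !(negPf (h1 _)) !orbF => /eqP->.
    by rewrite mul0r.
  have stA (u : T -> R -> R) : iter n (walk_step A d) u = fun a x => iter n (kact A) (u ^~ x) a.
    elim: n => // j ih; rewrite iterS ih; apply/funext => a; apply/funext => x.
    rewrite iterS /walk_step /kact; apply: eq_bigr => b _.
    have /eqP := d0 a b; rewrite mulf_eq0 => /orP[/eqP->|/eqP->]; first by rewrite !mul0r.
    by rewrite addr0.
  have -> : walk_sum n g o 0 = walk_sum n (fun y => g (y - n%:R * m + n%:R * m)) o 0.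
    by under [in RHS]eq_fun do rewrite subrK.
  rewrite (walkA n (fun y => g (y + n%:R * m))) stA add0r walk_sum1.
  rewrite -(congr1 (@^~ o) (iter_kactZ A n (g (n%:R * m)) (indic_pt o))).
  by congr (iter n (kact A) _ o); apply/funext => b; rewrite mulrC.
Unshelve. all: end_near. Qed.

End Walks.

(** * Transfer matrix of the band matchings *)

Section TransferMatrix.
Local Open Scope nat_scope.
Local Open Scope set_scope.
Variables (R : realType) (s t : nat).
Hypotheses (hs : 0 < s) (ht : 0 < t).
Local Notation window := (window s t).
Local Notation start := (start s t).
Local Notation letter := 'I_(s + t).+1.
Implicit Types (u v : window) (g : R -> R).

Definition edge : rel window := fun u v => [exists c : letter, legal u c && (shift_window u c == v)].

(** Only these states lie on closed walks at the initial state, and they form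
    a strongly connected set by definition. *)
Definition live u := connect edge start u && connect edge u start.

Definition state := {u : window | live u}.
Implicit Types (a b : state).

(** Parallel edges are allowed: the entry counts letters. *)
Definition transfer a b : R :=
  (#|[set c : letter | legal (val a) c && (shift_window (val a) c == val b)]|%:R)%R.

(** A legal letter is 0 exactly when the oldest column of the window is vacant,
    so the weight of a transition depends on its origin only. *)
Definition forced_weight a b : R := ((vacant (val a) 0)%:R)%R.

Lemma live_start : live start. Proof. by rewrite /live connect0. Qed.

Definition start_state : state := exist _ start live_start.
Local Notation o := start_state.

Lemma transfer_ge0 a b : (0 <= transfer a b)%R.
Proof. exact: ler0n. Qed.

Lemma transfer_gt0 a b : edge (val a) (val b) -> (0 < transfer a b)%R.
Proof.
by move=> /existsP[c hc]; rewrite ltr0n card_gt0; apply/set0Pn; exists c; rewrite inE.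
Qed.

Lemma transfer_start : (0 < transfer o o)%R.
Proof.
apply: transfer_gt0; apply/existsP.
have sst : s < (s + t).+1 by rewrite ltnS leq_addr.
exists (Ordinal sst); rewrite /legal !vacant_start /= leq_addr leqnn leqNgt hs/=.
apply/eqP/vacant_inj => c; rewrite vacant_shift ?leq_addr// !vacant_start.
by apply/idP/idP; lia.
Qed.

Lemma accepts_connect u w : accepts u w -> connect edge u start.
Proof.
elim: w u => [|c w ih] u /=; first by move=> /eqP->.
move=> /andP[uc /ih h]; apply: connect_trans h; apply: connect1.
have cst : c < (s + t).+1 by case/and3P: uc.
by apply/existsP; exists (Ordinal cst); rewrite uc eqxx.
Qed.

(** All vertices of a path between live states are live. *)
Lemma transfer_connected a b : exists n, (0 < iter n (kact transfer) (indic_pt R b) a)%R.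
Proof.
have : connect edge (val a) (val b).
  by case/andP: (valP a) => _ /connect_trans; apply; case/andP: (valP b).
move=> /connectP[p]; elim: p a => [|v p ih] a /=.
  by move=> _ /val_inj ->; exists 0; rewrite /indic_pt/= eqxx.
move=> /andP[av vp] bE.
have lv : live v.
  apply/andP; split.
    by case/andP: (valP a) => h _; apply: connect_trans h _; exact: connect1.
  case/andP: (valP b) => _; apply: connect_trans.
  by apply/connectP; exists p.
have [n hn] := ih (exist _ v lv) vp bE.
have nn (c : state) : (0 <= iter n (kact transfer) (indic_pt R b) c)%R.
  elim: n {hn} c => [|n ihn] c; first exact: ler0n.
  by apply: sumr_ge0 => e _; apply: mulr_ge0; [exact: transfer_ge0|exact: ihn].
exists n.+1; rewrite iterS /kact (bigD1 (exist _ v lv))//= ltr_wpDr//.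
  by apply: sumr_ge0 => e _; apply: mulr_ge0; [exact: transfer_ge0|exact: nn].
by apply: mulr_gt0 => //; exact: transfer_gt0.
Qed.

Definition word_sum n u g (x : R) : R :=
  (\sum_(w <- words s t n | accepts u w) g (x + (count_mem 0 w)%:R))%R.

Lemma word_sumS n u g x :
  word_sum n.+1 u g x =
  (\sum_(c : letter | legal u c) word_sum n (shift_window u c) g (x + (vacant u 0)%:R))%R.
Proof.
have -> : word_sum n.+1 u g x = (\sum_(0 <= c < (s + t).+1) \sum_(w <- words s t n)
    if accepts u (c :: w) then g (x + (count_mem 0%N (c :: w))%:R) else 0)%R.
  by rewrite /word_sum big_mkcond [LHS](@big_allpairs_dep _ _ _ _ _ _ (fun c w => c :: w) (iota 0 (s + t).+1)).
rewrite big_mkord [RHS]big_mkcond; apply: eq_bigr => c _ /=.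
case: ifP => uc /=; last by rewrite big1.
rewrite /word_sum [RHS]big_mkcond; apply: eq_bigr => w _.
have -> : vacant u 0 = (c == 0 :> nat).
  case/and3P: uc => _ cf /implyP h; apply/idP/idP => [/h //|/eqP c0].
  by move: cf; rewrite c0.
by rewrite natrD addrA.
Qed.

(** The sum over all states reduces to the live ones, as no word is accepted
    from a state that is not live. *)
Lemma walk_sum_words n a g x : walk_sum transfer forced_weight o n g a x = word_sum n (val a) g x.
Proof.
elim: n a x => [|n ih] a x.
  rewrite /word_sum big_mkcond /= big_seq1 /= addr0 /walk_sum /= /indic_pt.
  by rewrite -val_eqE /=; case: ifP => _; rewrite ?mul1r ?mul0r.
rewrite word_sumS /walk_sum iterS /walk_step.
transitivity (\sum_(b : state) \sum_(c : letter | legal (val a) c && (shift_window (val a) c == val b))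
    word_sum n (val b) g (x + (vacant (val a) 0)%:R))%R.
  apply: eq_bigr => b _; rewrite [RHS]sumr_const -[RHS]mulr_natl /transfer cardsE; congr (_ * _)%R.
  exact: ih.
rewrite (exchange_big_dep (fun c : letter => legal (val a) c)) /=; last by move=> b c _ /andP[].
apply: eq_bigr => c ac; rewrite ac /=.
have av : edge (val a) (shift_window (val a) c) by apply/existsP; exists c; rewrite ac eqxx.
have [cv|cv] := boolP (connect edge (shift_window (val a) c) start).
  have lv : live (shift_window (val a) c).
    rewrite /live cv andbT; case/andP: (valP a) => h _; apply: connect_trans h _; exact: connect1.
  rewrite (big_pred1 (exist (fun u => live u) _ lv : state)) => // b; rewrite eq_sym -val_eqE//.
rewrite big_pred0 => [|b]; last first.
  by apply: contraNF cv => /eqP->; case/andP: (valP b).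
rewrite /word_sum big_pred0// => w.
by apply: contraNF cv; exact: accepts_connect.
Qed.

Lemma sum_matchings_walk n g :
  (\sum_(p in perfect_matchings (type_graph n s t)) g (forced_steps s p)%:R =
   walk_sum transfer forced_weight o n g o 0)%R.
Proof.
rewrite (sum_matchings s t n (fun k => g (k%:R)%R)) walk_sum_words /word_sum.
by apply: eq_bigr => w _; rewrite add0r.
Qed.

End TransferMatrix.

(** * Step functions and trigonometric polynomials *)

Section TrigPolynomials.
Variable R : realType.
Implicit Types (f g : R -> R) (c th a x : R).

(** The phases make sines superfluous, and no common period is required. *)
Inductive trig_poly : (R -> R) -> Prop :=
| trig_poly_cos c th a : trig_poly (fun x => c * cos (th * x + a))
| trig_poly_add f g : trig_poly f -> trig_poly g -> trig_poly (fun x => f x + g x).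

Lemma trig_poly_cst c : trig_poly (cst c).
Proof.
have -> : cst c = (fun x => c * cos (0 * x + 0)).
  by apply/funext => x; rewrite mul0r addr0 cos0 mulr1.
exact: trig_poly_cos.
Qed.

(** The product formula for cosines. *)
Lemma trig_polyM f g : trig_poly f -> trig_poly g ->
  trig_poly (fun x => f x * g x).
Proof.
move=> tf tg; elim: tf => [c th a|f1 f2 _ ih1 _ ih2]; last first.
  under eq_fun do rewrite mulrDl; exact: trig_poly_add.
elim: tg => [c' th' a'|g1 g2 _ ih1 _ ih2]; last first.
  under eq_fun do rewrite mulrDr; exact: trig_poly_add.
have -> : (fun x => c * cos (th * x + a) * (c' * cos (th' * x + a'))) =
    (fun x => (c * c' / 2) * cos ((th + th') * x + (a + a')) +
              (c * c' / 2) * cos ((th - th') * x + (a - a'))).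
  apply/funext => x.
  have -> : (th + th') * x + (a + a') = (th * x + a) + (th' * x + a') by ring.
  have -> : (th - th') * x + (a - a') = (th * x + a) - (th' * x + a') by ring.
  by rewrite (cosD (th * x + a)) cosB; field.
by apply: trig_poly_add; exact: trig_poly_cos.
Qed.

Lemma trig_polyX f n : trig_poly f -> trig_poly (fun x => f x ^+ n).
Proof.
move=> tf; elim: n => [|n ih]; first exact: trig_poly_cst.
under eq_fun do rewrite exprS; exact: trig_polyM.
Qed.

Lemma trig_polyZD f c c' : trig_poly f -> trig_poly (fun x => c + c' * f x).
Proof.
move=> tf; apply: trig_poly_add; first exact: trig_poly_cst.
by apply: trig_polyM => //; exact: trig_poly_cst.
Qed.

Lemma bernoulli_le (v : R) n : 0 <= v <= 1 -> 1 - n%:R * v <= (1 - v) ^+ n.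
Proof.
move=> /andP[v0 v1]; elim: n => [|n ih]; first by rewrite mul0r subr0 expr0.
have h : (1 - n%:R * v) * (1 - v) <= (1 - v) ^+ n.+1.
  by rewrite exprSr ler_wpM2r// subr_ge0.
apply: le_trans h; rewrite -natr1.
have : 0 <= n%:R * (v * v) by rewrite mulr_ge0// mulr_ge0.
by nra.
Qed.

Lemma bernoulli_ge (v : R) n : 0 <= v <= 1 -> (1 - v) ^+ n * (1 + n%:R * v) <= 1.
Proof.
move=> /andP[v0 v1].
have h : 1 + n%:R * v <= (1 + v) ^+ n.
  elim: n => [|n ih]; first by rewrite mul0r addr0 expr0.
  have h : (1 + n%:R * v) * (1 + v) <= (1 + v) ^+ n.+1.
    by rewrite exprSr ler_wpM2r// addr_ge0.
  apply: le_trans h; rewrite -natr1.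
  have : 0 <= n%:R * (v * v) by rewrite mulr_ge0// mulr_ge0.
  by nra.
apply: (@le_trans _ _ ((1 - v) ^+ n * (1 + v) ^+ n)).
  by rewrite ler_wpM2l// exprn_ge0// subr_ge0.
by rewrite -exprMn exprn_ile1//; nra.
Qed.

Lemma small_power (q e : R) : 0 <= q < 1 -> 0 < e -> exists2 n, (0 < n)%N & q ^+ n <= e.
Proof.
move=> /andP[q0 q1] e0.
have /cvgrPdist_le/(_ e e0)[N _ /(_ N.+1 (leqnSn _))] : q ^+ n @[n --> \oo] --> 0.
  by apply: cvg_expr; rewrite ger0_norm.
by rewrite sub0r normrN ger0_norm ?exprn_ge0// => h; exists N.+1.
Qed.

(** As n grows, (1 - u^n)^(4^n) tends to 1 for u < 1/4 and to 0 for u > 1/4, by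
    Bernoulli's inequality. *)
Lemma switch_lo (u q : R) n : 0 <= u <= 1 -> 4 * u <= q -> 1 - q ^+ n <= (1 - u ^+ n) ^+ (4 ^ n).
Proof.
move=> /andP[u0 u1] uq.
apply: le_trans (bernoulli_le _ _); last by rewrite exprn_ge0// exprn_ile1.
by rewrite natrX -exprMn lerD2l lerN2 lerXn2r ?nnegrE//; nra.
Qed.

Lemma switch_hi (u q : R) n : 0 <= u <= 1 -> 0 <= q -> 1 <= q * (4 * u) ->
  (1 - u ^+ n) ^+ (4 ^ n) <= q ^+ n.
Proof.
move=> /andP[u0 u1] q0 uq.
have un : 0 <= u ^+ n <= 1 by rewrite exprn_ge0// exprn_ile1.
have := bernoulli_ge (4 ^ n) un; rewrite natrX -exprMn.
set A := (1 - _) ^+ _ => h.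
have A0 : 0 <= A by rewrite exprn_ge0// subr_ge0; case/andP: un.
have h1 : A * (4 * u) ^+ n <= 1.
  by apply: le_trans h; rewrite ler_wpM2l// lerDr.
have h2 : 1 <= (4 * u) ^+ n * q ^+ n by rewrite -exprMn exprn_ege1// mulrC.
have qn := exprn_ge0 n q0.
have : A * 1 <= A * ((4 * u) ^+ n * q ^+ n) by rewrite ler_wpM2l.
rewrite mulr1 => /le_trans; apply.
by rewrite mulrA ler_piMl.
Qed.

Lemma cos_le_decr (u v : R) : 0 <= u -> u <= v -> v <= pi -> cos v <= cos u.
Proof.
rewrite le_eqVlt => /orP u0; rewrite le_eqVlt => /orP[/eqP->//|uv vpi].
have {}u0 : 0 <= u by case: u0 => [/eqP<-|/ltW].
by rewrite ltW// ltr_cos// in_itv/=; apply/andP; split => //; lra.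
Qed.

Lemma cos_lt_decr (u v : R) : 0 <= u -> u < v -> v <= pi -> cos v < cos u.
Proof.
by move=> u0 uv vpi; rewrite ltr_cos// in_itv/=; apply/andP; split => //; lra.
Qed.

(** Substitute u = (1 - cos y) / 2 in (1 - u^n)^(4^n), where y = (z - a) / k.
    On a period, u < 1/4 means |y| < y0 with cos y0 = 1/2; the scale k is so large
    that the window [- M, M] is within one period, and the centre a is such that
    its right edge falls between x and x + de. *)
Lemma trig_step x (de e M : R) : 0 < de -> 0 < e ->
  exists f, [/\ trig_poly f, (forall z, 0 <= f z <= 1),
    (forall z, - M <= z -> z <= x -> 1 - e <= f z) &
    (forall z, x + de <= z -> z <= M -> f z <= e)].
Proof.
move=> de0 e0.
have half : -1 <= (2^-1 : R) < 1 by apply/andP; split; lra.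
have half' : -1 < (2^-1 : R) <= 1 by apply/andP; split; lra.
have half'' : -1 <= (2^-1 : R) <= 1 by apply/andP; split; lra.
pose y0 := acos (2^-1 : R).
have y00 : 0 < y0 by exact: acos_gt0.
have y0pi : y0 < pi by exact: acos_ltpi.
have cy0 : cos y0 = 2^-1 by rewrite /y0 acosK//= in_itv/=.
have [k k0 [k1 k2 k3]] : exists2 k : R, 0 < k & [/\ M + x + de <= 2 * y0 * k,
    M - x <= (pi - y0) * k & de <= y0 * k].
  have py : 0 < pi - y0 by rewrite subr_gt0.
  exists ((`|M| + `|x| + de) / y0 + (`|M| + `|x|) / (pi - y0)).
    apply: ltr_wpDr; first by apply: divr_ge0; [exact: addr_ge0|exact: ltW].
    by apply: divr_gt0 => //; apply: ltr_wpDl.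
  have a1 : y0 * ((`|M| + `|x| + de) / y0) = `|M| + `|x| + de.
    by rewrite mulrCA divff ?mulr1// gt_eqF.
  have a2 : (pi - y0) * ((`|M| + `|x|) / (pi - y0)) = `|M| + `|x|.
    by rewrite mulrCA divff ?mulr1// gt_eqF.
  have b1 : 0 <= (`|M| + `|x| + de) / y0.
    by apply: divr_ge0; [apply: addr_ge0; [exact: addr_ge0|]|]; exact: ltW.
  have b2 : 0 <= (`|M| + `|x|) / (pi - y0).
    by apply: divr_ge0; [exact: addr_ge0|exact: ltW].
  have c1 := ler_norm M; have c2 := ler_norm x; have c3 := ler_norm (- x).
  rewrite normrN in c3.
  have b3 : 0 <= y0 * ((`|M| + `|x|) / (pi - y0)) by apply: mulr_ge0 => //; exact: ltW.
  have b4 : 0 <= (pi - y0) * ((`|M| + `|x| + de) / y0) by apply: mulr_ge0 => //; exact: ltW.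
  have n1 := normr_ge0 M; have n2 := normr_ge0 x.
  split; lra.
pose y1 := y0 - de / (2 * k); pose y2 := y0 + de / (2 * k).
have dk : 0 < de / (2 * k) by rewrite divr_gt0// mulr_gt0.
have dkE : de / (2 * k) * k = de / 2 by field; rewrite gt_eqF.
have y10 : 0 <= y1.
  rewrite -(pmulr_lge0 _ k0) mulrBl dkE; lra.
have cy1 : 2^-1 < cos y1.
  by rewrite -cy0; apply: cos_lt_decr => //; [rewrite /y1; lra|exact: ltW].
pose a := x + de / 2 - k * y0.
pose u z := (1 - cos ((z - a) / k)) / 2.
have u01 z : 0 <= u z <= 1.
  have := cos_le1 ((z - a) / k); have := cos_geN1 ((z - a) / k); rewrite /u => *.
  by apply/andP; split; lra.
have tu n : trig_poly (fun z => (1 - u z ^+ n) ^+ (4 ^ n)).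
  apply: trig_polyX.
  have -> : (fun z => 1 - u z ^+ n) = (fun z => 1 + (-1) * u z ^+ n).
    by apply/funext => z; rewrite mulN1r.
  apply: trig_polyZD; apply: trig_polyX.
  have -> : u = fun z => 2^-1 + (- 2^-1) * (1 * cos (k^-1 * z + - (a / k))).
    apply/funext => z; rewrite /u.
    have -> : k^-1 * z + - (a / k) = (z - a) / k by field; rewrite gt_eqF.
    by field.
  by apply: trig_polyZD; exact: trig_poly_cos.
have lo z : - M <= z -> z <= x -> 4 * u z <= 2 * (1 - cos y1).
  move=> z1 z2.
  have : cos y1 <= cos ((z - a) / k).
    rewrite -(cos_norm ((z - a) / k)).
    have hy : `|(z - a) / k| <= y1.
      rewrite ler_norml; apply/andP; split.
        rewrite -(ler_pM2r k0) divfK ?gt_eqF// mulNr /y1 mulrBl dkE /a; lra.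
      rewrite -(ler_pM2r k0) divfK ?gt_eqF// /y1 mulrBl dkE /a; lra.
    by apply: cos_le_decr => //; rewrite /y1; lra.
  by rewrite /u; lra.
have q1 : 0 <= 2 * (1 - cos y1) < 1.
  by have := cos_le1 y1 => h; apply/andP; split; lra.
have mono (q q' : R) n m : 0 <= q < 1 -> (m <= n)%N -> q ^+ m <= e -> q ^+ n <= e.
  move=> /andP[q0 ql] mn; apply: le_trans; apply: ler_wiXn2l => //; exact: ltW.
have [n1 n10 hn1] := small_power q1 e0.
have f01 n z : (0 < n)%N -> 0 <= (1 - u z ^+ n) ^+ (4 ^ n) <= 1.
  move=> n0; have /andP[uu0 uu1] := u01 z.
  have un0 : 0 <= u z ^+ n by rewrite exprn_ge0.
  have un1 : u z ^+ n <= 1 by rewrite exprn_ile1.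
  by rewrite exprn_ge0 ?subr_ge0// exprn_ile1// ?subr_ge0// lerBlDr lerDl.
(* if y2 exceeds pi then no z satisfies x + de <= z <= M *)
have [y2pi|y2pi] := leP y2 pi.
- have cy2 : cos y2 < 2^-1.
    by rewrite -cy0; apply: cos_lt_decr => //; [exact: ltW|rewrite /y2; lra].
  have hi z : x + de <= z -> z <= M -> 1 <= (2 * (1 - cos y2))^-1 * (4 * u z).
    move=> z1 z2.
    have : cos ((z - a) / k) <= cos y2.
      have h1 : y2 <= (z - a) / k.
        rewrite -(ler_pM2r k0) divfK ?gt_eqF// /y2 mulrDl dkE /a; lra.
      have h2 : (z - a) / k <= pi.
        rewrite -(ler_pM2r k0) divfK ?gt_eqF// /a; lra.
      by apply: cos_le_decr => //; rewrite /y2; lra.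
    move=> h; rewrite mulrC ler_pdivlMr; last lra.
    by rewrite /u; lra.
  have q2 : 0 <= (2 * (1 - cos y2))^-1 < 1.
    rewrite invr_ge0 invf_lt1; last lra.
    by apply/andP; split; lra.
  have [n2 n20 hn2] := small_power q2 e0.
  exists (fun z => (1 - u z ^+ (n1 + n2)) ^+ (4 ^ (n1 + n2))); split => //.
  + by move=> z; apply: f01; rewrite addn_gt0 n10.
  + move=> z z1 z2; apply: le_trans (switch_lo _ (u01 z) (lo z z1 z2)).
    by rewrite lerD2l lerN2 (mono _ _ _ n1)// leq_addr.
  + move=> z z1 z2; apply: le_trans (switch_hi _ (u01 z) _ (hi z z1 z2)) _.
      by case/andP: q2.
    by rewrite (mono _ _ _ n2)// leq_addl.
- exists (fun z => (1 - u z ^+ n1) ^+ (4 ^ n1)); split => //.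
  + by move=> z; apply: f01.
  + move=> z z1 z2; apply: le_trans (switch_lo _ (u01 z) (lo z z1 z2)).
    by rewrite lerD2l lerN2.
  + move=> z z1 z2; exfalso.
    have h1 : y2 <= (z - a) / k.
      rewrite -(ler_pM2r k0) divfK ?gt_eqF// /y2 mulrDl dkE /a; lra.
    have h2 : (z - a) / k <= pi.
      rewrite -(ler_pM2r k0) divfK ?gt_eqF// /a; lra.
    lra.
Qed.

End TrigPolynomials.

(** * Characteristic function of the normal law *)

Section GaussianCharacteristic.
Variable R : realType.
Let mu : {measure set _ -> \bar R} := @lebesgue_measure R.
Let phi : R -> R := normal_pdf 0 1.
Let wide : R -> R := normal_pdf 0 (Num.sqrt 2).
Implicit Types (x th c : R).

Let phiE x : phi x = normal_peak 1 * expR (- (x ^+ 2 / 2)).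
Proof.
rewrite /phi normal_pdfE ?oner_eq0// /normal_fun subr0 expr1n.
by congr (_ * expR _); rewrite mulNr; congr (- (_ / _)); rewrite mulr2n.
Qed.

Let sqrt2_neq0 : Num.sqrt 2 != 0 :> R.
Proof. by rewrite gt_eqF// sqrtr_gt0. Qed.

Let wideE x : wide x = normal_peak (Num.sqrt 2) * expR (- (x ^+ 2 / 4)).
Proof.
rewrite /wide normal_pdfE// /normal_fun subr0 sqr_sqrtr//.
by congr (_ * expR _); rewrite mulNr; congr (- (_ / _)); rewrite mulr2n; lra.
Qed.

(** Writing exp (- x^2 / 2) as the square of exp (- x^2 / 4), one factor absorbs
    the polynomial, and the other is the density of variance 2, whose
    integrability is known. *)
Let dominated : {K : R | forall x, (1 + x ^+ 2) * phi x <= K * wide x}.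
Proof.
exists (4 * normal_peak 1 / normal_peak (Num.sqrt 2)) => x.
have p0 : normal_peak (Num.sqrt 2 : R) != 0 by rewrite gt_eqF// normal_peak_gt0.
have -> : 4 * normal_peak 1 / normal_peak (Num.sqrt 2) * wide x =
    normal_peak 1 * (4 * expR (- (x ^+ 2 / 4))) by rewrite wideE; field.
rewrite phiE mulrCA ler_wpM2l ?normal_peak_ge0//.
have -> : - (x ^+ 2 / 2) = - (x ^+ 2 / 4) + - (x ^+ 2 / 4) by field.
rewrite expRD mulrA ler_wpM2r ?expR_ge0//.
rewrite expRN ler_pdivrMr ?expR_gt0//.
have := expR_ge1Dx (x ^+ 2 / 4); have := sqr_ge0 x; lra.
Qed.

Lemma integrable_gauss_dom (f : R -> R) (K : R) : measurable_fun setT f ->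
  (forall x, `|f x| <= K * ((1 + x ^+ 2) * phi x)) -> mu.-integrable setT (EFin \o f).
Proof.
move=> mf fK; case: dominated => K' K'P.
apply: (@le_integrable _ _ _ mu setT measurableT _ (fun x => (`|K| * K')%:E * (wide x)%:E)%E).
- exact/measurable_EFinP.
- move=> x _; rewrite lee_fin.
  apply: le_trans (ler_norm _).
  apply: le_trans (fK x) _; rewrite -mulrA.
  have h0 : 0 <= (1 + x ^+ 2) * phi x.
    by rewrite mulr_ge0 ?normal_pdf_ge0// addr_ge0// sqr_ge0.
  apply: (@le_trans _ _ (`|K| * ((1 + x ^+ 2) * phi x))).
    by rewrite ler_wpM2r// ler_norm.
  by rewrite ler_wpM2l.
- apply: integrableZl => //; exact: integrable_normal_pdf.
Qed.

Let measurable_phi : measurable_fun setT phi.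
Proof. exact: measurable_normal_pdf. Qed.

Let phi_ge0 x : 0 <= phi x. Proof. exact: normal_pdf_ge0. Qed.

Let le_dom1 x : phi x <= (1 + x ^+ 2) * phi x.
Proof. by rewrite ler_peMl// lerDl sqr_ge0. Qed.

Let le_domx x : `|x| * phi x <= (1 + x ^+ 2) * phi x.
Proof.
apply: ler_wpM2r => //; rewrite -(real_normK (num_real x)); have := normr_ge0 x; nra.
Qed.

Lemma integrable_gauss_bounded (f : R -> R) (K : R) : measurable_fun setT f ->
  (forall x, `|f x| <= K) -> mu.-integrable setT (EFin \o (fun x => f x * phi x)).
Proof.
move=> mf fK; apply: (@integrable_gauss_dom _ K); first exact: measurable_funM.
move=> x; rewrite normrM (ger0_norm (phi_ge0 x)).
have K0 : 0 <= K by apply: le_trans (fK 0).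
by apply: ler_pM => //.
Qed.

Lemma integrable_gauss_sqr : mu.-integrable setT (EFin \o (fun x => x ^+ 2 * phi x)).
Proof.
apply: (@integrable_gauss_dom _ 1); first exact: measurable_funM.
move=> x; rewrite mul1r ger0_norm; last by apply: mulr_ge0 => //; exact: sqr_ge0.
by apply: ler_wpM2r => //; rewrite lerDr.
Qed.

Let is_derive_phi x : is_derive x 1 phi (- x * phi x).
Proof.
have -> : phi = (fun x => normal_peak 1 * expR (- (x ^+ 2 / 2))) by apply/funext.
apply: is_derive_eq.
by rewrite /GRing.scale/= mulr0 mulr0 add0r; field.
Qed.

Let cosint th c := \int[mu]_x (cos (th * x + c) * phi x).
(** The derivative of phi x sin (th x + c), whose integral vanishes; this is the
    integration by parts that relates the two integrals. *)
Let D th c x := th * (cos (th * x + c) * phi x) - x * sin (th * x + c) * phi x.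

Let measurable_cosl th c : measurable_fun setT (fun x : R => cos (th * x + c)).
Proof.
apply: continuous_measurable_fun => x.
apply: (@continuous_comp _ _ _ (fun x => th * x + c) cos); last exact: continuous_cos.
by apply: cvgD; [apply: cvgM; [exact: cvg_cst|exact: cvg_id]|exact: cvg_cst].
Qed.

Let measurable_sinl th c : measurable_fun setT (fun x : R => sin (th * x + c)).
Proof.
apply: continuous_measurable_fun => x.
apply: (@continuous_comp _ _ _ (fun x => th * x + c) sin); last exact: continuous_sin.
by apply: cvgD; [apply: cvgM; [exact: cvg_cst|exact: cvg_id]|exact: cvg_cst].
Qed.

Let is_derive_D th c x : is_derive x 1 (fun x => phi x * sin (th * x + c)) (D th c x).
Proof.
have dphi := is_derive_phi x.
have dl : is_derive x 1 (fun x : R => th * x + c) th.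
  by apply: is_derive_eq; rewrite /GRing.scale/=; ring.
have ds : is_derive x 1 (fun x => sin (th * x + c)) (th * cos (th * x + c)).
  have h := @is_derive1_comp R sin (fun x => th * x + c) x _ _ (is_derive_sin _) dl.
  by rewrite mulrC; exact: h.
apply: is_derive_eq.
by rewrite /D /GRing.scale/=; ring.
Qed.

Let norm_D th c x : `|D th c x| <= (`|th| + 1) * ((1 + x ^+ 2) * phi x).
Proof.
apply: le_trans (ler_normB _ _) _; rewrite mulrDl mul1r; apply: lerD.
  rewrite !normrM (ger0_norm (phi_ge0 x)) ler_wpM2l//.
  by apply: ler_pM => //; apply: le_trans (cos_max _) _; rewrite lerDl sqr_ge0.
rewrite !normrM (ger0_norm (phi_ge0 x)); apply: le_trans (le_domx x).
by apply: ler_wpM2r => //; rewrite ler_piMr// sin_max.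
Qed.

Let measurable_D th c : measurable_fun setT (D th c).
Proof.
apply: measurable_funB.
  by apply: measurable_funM => //; exact: measurable_funM.
by apply: measurable_funM => //; exact: measurable_funM.
Qed.

Let integrable_D th c : mu.-integrable setT (EFin \o D th c).
Proof. exact: integrable_gauss_dom (norm_D th c). Qed.

Let continuous_D th c : continuous (D th c).
Proof.
move=> x; apply: cvgB; apply: cvgM.
- exact: cvg_cst.
- apply: cvgM; last exact: continuous_normal_pdf.
  apply: (@continuous_comp _ _ _ (fun x => th * x + c) cos); last exact: continuous_cos.
  by apply: cvgD; [apply: cvgM; [exact: cvg_cst|exact: cvg_id]|exact: cvg_cst].
- apply: cvgM; first exact: cvg_id.
  apply: (@continuous_comp _ _ _ (fun x => th * x + c) sin); last exact: continuous_sin.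
  by apply: cvgD; [apply: cvgM; [exact: cvg_cst|exact: cvg_id]|exact: cvg_cst].
- exact: continuous_normal_pdf.
Qed.

Let phi_cvg0 : phi n%:R @[n --> \oo] --> (0 : R).
Proof.
apply: (@squeeze_cvgr _ _ _ _ (cst 0) (fun n : nat => normal_peak 1 * 2 * n.+1%:R^-1)).
- near=> n; rewrite phi_ge0/= phiE -mulrA ler_wpM2l ?normal_peak_ge0//.
  rewrite expRN ler_pdivlMr ?ltr0n// [leLHS]mulrC ler_pdivrMr ?expR_gt0//.
  have := expR_ge1Dx (n%:R ^+ 2 / 2 : R); rewrite -(natr1 n).
  have : 0 <= (n%:R - 1 : R) ^+ 2 by exact: sqr_ge0.
  have : 0 <= n%:R :> R by [].
  set E := expR _; move: (n%:R : R) => r; nra.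
- exact: cvg_cst.
- rewrite -(mulr0 (normal_peak 1 * 2)); apply: cvgM; first exact: cvg_cst.
  exact: cvg_harmonic.
Unshelve. all: end_near. Qed.

Let integral_D th c : \int[mu]_x D th c x = 0.
Proof.
pose f_ (n : nat) (x : R) := (D th c \_ `[- n%:R, n%:R]) x.
have intn n : (\int[mu]_x (f_ n.+1 x)%:E = (phi n.+1%:R * sin (th * n.+1%:R + c)
    - phi (- n.+1%:R) * sin (th * - n.+1%:R + c))%:E)%E.
  have := @continuous_FTC2 R (D th c) (fun x => phi x * sin (th * x + c)) (- n.+1%:R) n.+1%:R.
  rewrite EFinB => <-.
  - rewrite [RHS]integral_mkcond; apply: eq_integral => x _.
    by rewrite /f_ !patchE; case: ifP.
  - by rewrite (@lt_le_trans _ _ 0)// oppr_lt0 ltr0n.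
  - exact: continuous_subspaceT (@continuous_D th c).
  - have cB x : {for x, continuous (fun x => phi x * sin (th * x + c))}.
      have [h _] := is_derive_D th c x.
      by apply: differentiable_continuous; apply/derivable1_diffP.
    split.
    + by move=> x _; have [] := is_derive_D th c x.
    + by apply: cvg_at_right_filter; exact: cB.
    + by apply: cvg_at_left_filter; exact: cB.
  - by move=> x _; rewrite derive1E; have [] := is_derive_D th c x.
have : (\int[mu]_x (f_ n x)%:E)%E @[n --> \oo] --> (\int[mu]_x (D th c x)%:E)%E.
  suff [] : [/\ mu.-integrable setT (EFin \o D th c), True &
      (\int[mu]_x (f_ n x)%:E)%E @[n --> \oo] --> (\int[mu]_x (D th c x)%:E)%E] by [].
  have [] := @dominated_convergence _ _ _ mu setT measurableT (fun n x => (f_ n x)%:E)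
    (EFin \o D th c) (abse \o (EFin \o D th c)); last by [].
  - move=> n; apply/measurable_EFinP.
    apply/(measurable_restrictT _ _).1 => //.
    by apply: measurable_funTS; exact: measurable_D.
  - by apply/measurable_EFinP; exact: measurable_D.
  - apply: aeW => x _; apply: cvg_near_cst.
    near=> n; rewrite /f_ patchE ifT//.
    rewrite inE/= in_itv/= -ler_norml.
    near: n; exact: nbhs_infty_ger.
  - exact: integrable_abse.
  - by apply: aeW => x n _; rewrite /= lee_fin /f_ patchE; case: ifP => _ //; rewrite normr0.
rewrite -cvg_shiftS/= => h1.
have h2 : (\int[mu]_x (f_ n.+1 x)%:E)%E @[n --> \oo] --> 0%:E.
  under eq_fun do rewrite intn.
  apply: cvg_EFin; first by apply: nearW.
  rewrite /comp/=.
  have h : (phi n.+1%:R + phi n.+1%:R) @[n --> \oo] --> (0 : R).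
    rewrite -[X in _ --> X]addr0; apply: cvgD; rewrite (cvg_shiftS (fun n => phi n%:R)); exact: phi_cvg0.
  apply: norm_cvg0; apply: (squeeze_cvgr _ (cvg_cst 0) h).
  apply: nearW => n; rewrite normr_ge0/=.
  apply: le_trans (ler_normB _ _) _; rewrite !normrM !(ger0_norm (phi_ge0 _)).
  have -> : phi (- n.+1%:R) = phi n.+1%:R by rewrite !phiE sqrrN.
  by apply: lerD; rewrite ler_piMr// sin_max.
by rewrite /Rintegral (cvg_unique _ h1 h2).
Unshelve. all: end_near. Qed.

Let integrable_cos th c : mu.-integrable setT (EFin \o (fun x => cos (th * x + c) * phi x)).
Proof. by apply: (@integrable_gauss_bounded _ 1) => // x; exact: cos_max. Qed.

Let integrable_xsin th c :
  mu.-integrable setT (EFin \o (fun x => x * sin (th * x + c) * phi x)).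
Proof.
apply: (@integrable_gauss_dom _ 1).
  by apply: measurable_funM => //; exact: measurable_funM.
move=> x; rewrite mul1r !normrM (ger0_norm (phi_ge0 x)); apply: le_trans (le_domx x).
by apply: ler_wpM2r => //; rewrite ler_piMr// sin_max.
Qed.

Let integral_xsin th c :
  \int[mu]_x (x * sin (th * x + c) * phi x) = th * cosint th c.
Proof.
apply/esym/eqP; rewrite -subr_eq0 -(integral_D th c) /D RintegralB//.
  by rewrite RintegralZl.
have -> : EFin \o (fun x => th * (cos (th * x + c) * phi x)) =
    (fun x => th%:E * (cos (th * x + c) * phi x)%:E)%E by [].
by apply: integrableZl => //; exact: integrable_cos.
Qed.

(** Differentiation under the integral, dominated by (1 + x^2) phi x. *)
Let is_derive_cosint th c : is_derive th 1 (cosint ^~ c) (- (th * cosint th c)).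
Proof.
have dcos (x t : R) : is_derive t 1 (fun t : R => cos (t * x + c) * phi x)
    (- (x * sin (t * x + c) * phi x)).
  have dl : is_derive t 1 (fun t : R => t * x + c) x.
    by apply: is_derive_eq; rewrite /GRing.scale/=; ring.
  have h := @is_derive1_comp R cos (fun t => t * x + c) t _ _ (is_derive_cos _) dl.
  by apply: is_derive_eq; rewrite /GRing.scale/=; ring.
pose f t x := cos (t * x + c) * phi x.
have p1 t x : partial1of2 f t x = - (x * sin (t * x + c) * phi x).
  by rewrite partial1of2E; have [] := dcos x t.
have I1 : `]th - 1, th + 1[%classic th by rewrite /= in_itv/=; apply/andP; split; lra.
have I2 : forall t, `]th - 1, th + 1[%classic t -> mu.-integrable setT (EFin \o f t).
  by move=> t _; exact: integrable_cos.
have I3 : forall t x, `]th - 1, th + 1[%classic t -> setT x -> derivable (f^~ x) t 1.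
  by move=> t x _ _; have [] := dcos x t.
have I4 : forall x, 0 <= (1 + x ^+ 2) * phi x.
  by move=> x; apply: mulr_ge0 => //; rewrite addr_ge0// sqr_ge0.
have I5 : mu.-integrable setT (EFin \o (fun x => (1 + x ^+ 2) * phi x)).
  apply: (@integrable_gauss_dom _ 1) => [|x]; last by rewrite mul1r ger0_norm.
  by apply: measurable_funM => //; apply: measurable_funD.
have I6 : forall t x, `]th - 1, th + 1[%classic t -> setT x ->
    `|partial1of2 f t x| <= (1 + x ^+ 2) * phi x.
  move=> t x _ _; rewrite p1 normrN !normrM (ger0_norm (phi_ge0 x)).
  apply: le_trans (le_domx x).
  by apply: ler_wpM2r => //; rewrite ler_piMr// sin_max.
have d1 := derivable_under_integral measurableT I1 I2 I3 I4 I5 I6.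
have d2 := differentiation_under_integral measurableT I1 I2 I3 I4 I5 I6.
apply: DeriveDef; first exact: d1.
rewrite -derive1E; rewrite [LHS]d2.
under eq_Rintegral do rewrite p1.
rewrite -mulN1r -integral_xsin -RintegralZl//.
by apply: eq_Rintegral => x _; rewrite mulN1r.
Qed.

(** The integral satisfies F' = - th F, so F exp (th^2 / 2) is constant. *)
Lemma gauss_cos th c : \int[mu]_x (cos (th * x + c) * phi x) = cos c * expR (- (th ^+ 2 / 2)).
Proof.
pose K t := cosint t c * expR (t ^+ 2 / 2).
have dK (t : R) : is_derive t (1 : R) K 0.
  have h1 := is_derive_cosint t c.
  have h2 : is_derive t 1 (fun t : R => expR (t ^+ 2 / 2)) (t * expR (t ^+ 2 / 2)).
    by apply: is_derive_eq; rewrite /GRing.scale/= mulr0 mulr0 add0r; field.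
  by apply: is_derive_eq; rewrite /GRing.scale/=; ring.
have := is_derive_0_is_cst th 0 dK; rewrite /K.
have -> : cosint 0 c = cos c.
  rewrite /cosint.
  transitivity (\int[mu]_x (cos c * phi x)).
    by apply: eq_Rintegral => x _; rewrite mul0r add0r.
  rewrite RintegralZl//; last exact: integrable_normal_pdf.
  by rewrite /Rintegral integral_normal_pdf/= mulr1.
rewrite expr0n/= mul0r expR0 mulr1 => h.
by rewrite expRN -h mulfK// gt_eqF// expR_gt0.
Qed.

End GaussianCharacteristic.

(** * From characteristic functions to distribution functions *)

Section FiniteMean.
Variables (R : realType) (T : finType).
Implicit Types (P X Y : T -> R).

Lemma fmeanD P X Y : fmean P (fun w => X w + Y w) = fmean P X + fmean P Y.
Proof. by rewrite /fmean -big_split; apply: eq_bigr => w _; rewrite mulrDr. Qed.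

Lemma fmeanZ P c X : fmean P (fun w => c * X w) = c * fmean P X.
Proof. by rewrite /fmean mulr_sumr; apply: eq_bigr => w _; rewrite mulrCA. Qed.

Lemma fmean_cst P c : \sum_w P w = 1 -> fmean P (fun=> c) = c.
Proof. by move=> P1; rewrite /fmean -mulr_suml P1 mul1r. Qed.

Lemma le_fmean P X Y : (forall w, 0 <= P w) -> (forall w, X w <= Y w) ->
  fmean P X <= fmean P Y.
Proof. by move=> P0 XY; apply: ler_sum => w _; rewrite ler_wpM2l. Qed.

Lemma fcdfE P X x : fcdf P X x = fmean P (fun w => (X w <= x)%R%:R).
Proof.
rewrite /fcdf /fmean big_mkcond; apply: eq_bigr => w _.
by case: ifP => _; rewrite ?mulr1 ?mulr0.
Qed.

End FiniteMean.

Section Continuity.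
Variable R : realType.
Let mu : {measure set _ -> \bar R} := @lebesgue_measure R.
Let phi : R -> R := normal_pdf 0 1.
Let gE (f : R -> R) := \int[mu]_x (f x * phi x).
Implicit Types f : R -> R.

Let trig_poly_bounded f : trig_poly f ->
  measurable_fun setT f /\ exists K, forall x, `|f x| <= K.
Proof.
elim=> [c th a|f1 f2 _ [m1 [K1 h1]] _ [m2 [K2 h2]]]; split.
- apply: measurable_funM => //; apply: continuous_measurable_fun => x.
  apply: (@continuous_comp _ _ _ (fun x => th * x + a) cos); last exact: continuous_cos.
  by apply: cvgD; [apply: cvgM; [exact: cvg_cst|exact: cvg_id]|exact: cvg_cst].
- by exists `|c| => x; rewrite normrM ler_piMr// cos_max.
- exact: measurable_funD.
- by exists (K1 + K2) => x; apply: le_trans (ler_normD _ _) _; exact: lerD.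
Qed.

Let trig_poly_integrable f : trig_poly f ->
  mu.-integrable setT (EFin \o (fun x => f x * phi x)).
Proof. by move=> /trig_poly_bounded[mf [K hK]]; exact: integrable_gauss_bounded hK. Qed.

Let gED f1 f2 : mu.-integrable setT (EFin \o (fun x => f1 x * phi x)) ->
  mu.-integrable setT (EFin \o (fun x => f2 x * phi x)) ->
  gE (fun x => f1 x + f2 x) = gE f1 + gE f2.
Proof.
by move=> i1 i2; rewrite /gE -RintegralD//; apply: eq_Rintegral => x _; rewrite mulrDl.
Qed.

Let gEZ c f1 : mu.-integrable setT (EFin \o (fun x => f1 x * phi x)) ->
  gE (fun x => c * f1 x) = c * gE f1.
Proof.
by move=> i1; rewrite /gE -RintegralZl//; apply: eq_Rintegral => x _; rewrite mulrA.
Qed.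

Let le_gE f1 f2 : mu.-integrable setT (EFin \o (fun x => f1 x * phi x)) ->
  mu.-integrable setT (EFin \o (fun x => f2 x * phi x)) ->
  (forall x, f1 x <= f2 x) -> gE f1 <= gE f2.
Proof.
move=> i1 i2 h; apply: le_Rintegral => // x _.
by apply: ler_wpM2r => //; exact: normal_pdf_ge0.
Qed.

Let gE_cst c : gE (fun=> c) = c.
Proof.
rewrite /gE RintegralZl//; last exact: integrable_normal_pdf.
by rewrite /Rintegral integral_normal_pdf/= mulr1.
Qed.

Let measurable_le (y : R) : measurable_fun setT (fun z : R => (z <= y)%R%:R : R).
Proof.
have -> : (fun z : R => (z <= y)%R%:R : R) = \1_`]-oo, y].
  by apply/funext => z; rewrite indicE mem_setE in_itv/=.
exact: measurable_indic.
Qed.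

Let gE_cdf y : fine (normal_prob 0 1 `]-oo, y]) = gE (fun z => (z <= y)%R%:R).
Proof.
rewrite /gE /normal_prob -[LHS]/(\int[mu]_(x in `]-oo, y]) phi x) Rintegral_mkcond.
apply: eq_Rintegral => x _; rewrite patchE mem_setE in_itv/=.
by case: ifP => _; rewrite ?mul1r ?mul0r.
Qed.

(** Outside [- M, M] the term z^2 / M^2 is at least 1 and takes over. *)
Let step_bounds f (y de e M : R) : 0 < de -> 0 < M -> 0 < e -> (forall z, 0 <= f z <= 1) ->
  (forall z, - M <= z -> z <= y -> 1 - e <= f z) ->
  (forall z, y + de <= z -> z <= M -> f z <= e) ->
  (forall z, (z <= y)%R%:R <= f z + (e + M ^- 2 * z ^+ 2)) /\
  (forall z, f z <= (z <= y + de)%R%:R + (e + M ^- 2 * z ^+ 2)).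
Proof.
move=> de0 M0 e0 f01 h1 h2.
have big z : M <= `|z| -> 1 <= M ^- 2 * z ^+ 2.
  move=> hz; rewrite mulrC ler_pdivlMr ?exprn_gt0// mul1r -(real_normK (num_real z)).
  by rewrite lerXn2r// nnegrE ltW.
have q0 z : 0 <= M ^- 2 * z ^+ 2 by rewrite mulr_ge0 ?sqr_ge0// invr_ge0 sqr_ge0.
split=> z; have /andP[f0 f1] := f01 z; have := q0 z.
- have [zy|_] /= := leP z y; last by move=> ?; rewrite !addr_ge0// ltW.
  have [zM|zM] := leP (- M) z; first by have := h1 _ zM zy; lra.
  suff : 1 <= M ^- 2 * z ^+ 2 by lra.
  by apply: big; rewrite -normrN (le_trans _ (ler_norm _))// lerNr ltW.
- have [_|zy] /= := leP z (y + de); first by lra.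
  have [zM|zM] := leP z M; first by have := h2 _ (ltW zy) zM; lra.
  suff : 1 <= M ^- 2 * z ^+ 2 by lra.
  by apply: big; rewrite (le_trans _ (ler_norm _))// ltW.
Qed.

Let integrableDr f1 f2 : mu.-integrable setT (EFin \o (fun x => f1 x * phi x)) ->
  mu.-integrable setT (EFin \o (fun x => f2 x * phi x)) ->
  mu.-integrable setT (EFin \o (fun x => (f1 x + f2 x) * phi x)).
Proof.
move=> i1 i2; rewrite (_ : EFin \o _ =
  (fun x => (f1 x * phi x)%:E + (f2 x * phi x)%:E)%E); first exact: integrableD.
by apply/funext => z /=; rewrite mulrDl.
Qed.

Let integrableZr c f1 : mu.-integrable setT (EFin \o (fun x => f1 x * phi x)) ->
  mu.-integrable setT (EFin \o (fun x => c * f1 x * phi x)).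
Proof.
move=> i1; rewrite (_ : EFin \o _ = (fun x => c%:E * (f1 x * phi x)%:E)%E).
  exact: integrableZl.
by apply/funext => z /=; rewrite -mulrA.
Qed.

(** The means of trigonometric polynomials converge.  Squeeze the distribution
    functions between two of them, up to terms controlled by the second
    moments, and use the continuity of the limit at x. *)
Lemma levy_continuity (T : nat -> finType) (P X : forall n, T n -> R) (K : R) :
  (forall n w, 0 <= P n w) -> (forall n, \sum_w P n w = 1) ->
  (\forall n \near \oo, fmean (P n) (fun w => X n w ^+ 2) <= K) ->
  (forall th c, fmean (P n) (fun w => cos (th * X n w + c)) @[n --> \oo] -->
     cos c * expR (- (th ^+ 2 / 2))) ->
  cvg_in_distribution (fun n => fcdf (P n) (X n)) (normal_prob 0 1).
Proof.
move=> P0 P1 PK Pcos x Phic.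
have lim_trig f : trig_poly f -> fmean (P n) (fun w => f (X n w)) @[n --> \oo] --> gE f.
  elim=> [c th a|f1 f2 t1 ih1 t2 ih2].
    under eq_fun do rewrite (fmeanZ _ c (fun w => cos (th * X _ w + a))).
    rewrite gEZ.
      by rewrite [gE _]gauss_cos; apply: cvgM; [exact: cvg_cst|exact: Pcos].
    have := trig_poly_integrable (trig_poly_cos 1 th a).
    by under eq_fun do rewrite mul1r.
  rewrite gED; [|exact: trig_poly_integrable..].
  under eq_fun do rewrite fmeanD.
  exact: cvgD.
set K' := gE (fun z => z ^+ 2).
have isqr : mu.-integrable setT (EFin \o (fun z => z ^+ 2 * phi z)) by exact: integrable_gauss_sqr.
have icst c : mu.-integrable setT (EFin \o (fun z => c * phi z)).
  by apply: (@integrable_gauss_bounded _ (fun=> c) `|c|) => //.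
have iind y : mu.-integrable setT (EFin \o (fun z => (z <= y)%R%:R * phi z)).
  apply: (@integrable_gauss_bounded _ (fun z => (z <= y)%R%:R) 1); first exact: measurable_le.
  by move=> z; rewrite normr_nat lern1 leq_b1.
apply/cvgrPdist_le => e e0.
(* each side costs one limit, two remainders of size 2 e' and one modulus of
   continuity, that is 6 e' *)
pose e' := e / 8.
have e'0 : 0 < e' by rewrite divr_gt0.
have [de de0 hde] : exists2 de, 0 < de & forall y, `|x - y| <= de ->
    `|gE (fun z => (z <= x)%R%:R) - gE (fun z => (z <= y)%R%:R)| <= e'.
  move/cvgrPdist_le : Phic => /(_ e' e'0)[d /= d0 hd].
  exists (d / 2); first by rewrite divr_gt0.
  move=> y xy; rewrite -!gE_cdf; apply: hd => /=.
  by apply: le_lt_trans xy _; rewrite ltr_pdivrMr// ltr_pMr// ltr1n.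
pose A := `|K| + `|K'| + 1.
have A0 : 0 < A by rewrite ltr_wpDl// addr_ge0.
have [M M0 hM] : exists2 M, 0 < M & M ^- 2 * A <= e'.
  exists (Num.sqrt (A / e')); first by rewrite sqrtr_gt0 divr_gt0.
  rewrite sqr_sqrtr; last by rewrite divr_ge0 ?ltW.
  by rewrite invfM invrK mulrAC mulVf ?mul1r// gt_eqF.
have hMB B : B <= A -> M ^- 2 * B <= e'.
  by move=> BA; apply: le_trans hM; rewrite ler_wpM2l// invr_ge0 sqr_ge0.
have KA : K <= A by rewrite /A; have := ler_norm K; have := normr_ge0 K'; lra.
have K'A : K' <= A by rewrite /A; have := ler_norm K'; have := normr_ge0 K; lra.
have key y : exists f, [/\ trig_poly f,
   forall z, (z <= y)%R%:R <= f z + (e' + M ^- 2 * z ^+ 2) &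
   forall z, f z <= (z <= y + de)%R%:R + (e' + M ^- 2 * z ^+ 2)].
  have [f [tf f01 h1 h2]] := trig_step y M de0 e'0.
  by have [k1 k2] := step_bounds de0 M0 e'0 f01 h1 h2; exists f.
have [fU' [tU' U1' U2']] := key x.
have [fL [tL L1 L2]] := key (x - de).
have irem : mu.-integrable setT (EFin \o (fun z => (e' + M ^- 2 * z ^+ 2) * phi z)).
  by apply: integrableDr => //; exact: integrableZr.
have gErem : gE (fun z => e' + M ^- 2 * z ^+ 2) <= 2 * e'.
  rewrite gED//; last exact: integrableZr.
  by rewrite gE_cst gEZ//; have := hMB _ K'A; rewrite -/K'; lra.
have iadd f : mu.-integrable setT (EFin \o (fun z => f z * phi z)) ->
   mu.-integrable setT (EFin \o (fun z => (f z + (e' + M ^- 2 * z ^+ 2)) * phi z)).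
  by move=> h; exact: integrableDr.
have gU : gE fU' <= gE (fun z => (z <= x + de)%R%:R) + 2 * e'.
  apply: le_trans (lerD (lexx _) gErem); rewrite -gED//; apply: le_gE => //.
  - exact: trig_poly_integrable.
  - exact: iadd.
have gL : gE (fun z => (z <= x - de)%R%:R) <= gE fL + 2 * e'.
  apply: le_trans (lerD (lexx _) gErem); rewrite -gED//; last exact: trig_poly_integrable.
  by apply: le_gE => //; apply: iadd => //; exact: trig_poly_integrable.
have hU := hde (x + de); have hL := hde (x - de).
rewrite opprD addNKr normrN (ger0_norm (ltW de0)) lexx in hU.
rewrite opprB addrC subrK (ger0_norm (ltW de0)) lexx in hL.
move: (hU isT) (hL isT); rewrite !ler_distl => /andP[hU1 _] /andP[_ hL1].
have /cvgrPdist_le/(_ e' e'0) nU := lim_trig _ tU'.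
have /cvgrPdist_le/(_ e' e'0) nL := lim_trig _ tL.
near=> n.
have rem : fmean (P n) (fun w => e' + M ^- 2 * X n w ^+ 2) <= 2 * e'.
  rewrite fmeanD fmean_cst// fmeanZ.
  have : fmean (P n) (fun w => X n w ^+ 2) <= K by near: n.
  by move=> h; have := hMB _ (le_trans h KA); lra.
have FU : fcdf (P n) (X n) x <= fmean (P n) (fun w => fU' (X n w)) + 2 * e'.
  by apply: le_trans (lerD (lexx _) rem); rewrite -fmeanD fcdfE; exact: le_fmean.
have FL : fmean (P n) (fun w => fL (X n w)) <= fcdf (P n) (X n) x + 2 * e'.
  apply: le_trans (lerD (lexx _) rem); rewrite fcdfE -fmeanD; apply: le_fmean => // w.
  by have := L2 (X n w); rewrite subrK.
have : `|gE fU' - fmean (P n) (fun w => fU' (X n w))| <= e' by near: n.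
have : `|gE fL - fmean (P n) (fun w => fL (X n w))| <= e' by near: n.
rewrite gE_cdf !ler_distl => /andP[a1 a2] /andP[b1 b2].
have eE : e = 8 * e' by rewrite /e' mulrCA divff ?mulr1.
rewrite eE.
by apply/andP; split; lra.
Unshelve. all: end_near. Qed.

End Continuity.

(** * Affine images with a bounded perturbation *)

Lemma eq_fmean (R : realType) (T : finType) (P X Y : T -> R) :
  (forall w, P w != 0 -> X w = Y w) -> fmean P X = fmean P Y.
Proof.
move=> h; apply: eq_bigr => w _.
by have [->|/h ->] := eqVneq (P w) 0; rewrite ?mul0r.
Qed.

Section Slutsky.
Variables (R : realType) (T : nat -> finType) (P X B L : forall n, T n -> R).
Variables (a : nat -> R) (l s2 C : R).
Arguments P : clear implicits.
Arguments X : clear implicits.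
Arguments B : clear implicits.
Arguments L : clear implicits.
Hypothesis P_ge0 : forall n w, 0 <= P n w.
Hypothesis P_sum1 : forall n, \sum_w P n w = 1.
Hypothesis l_gt0 : 0 < l.
Hypothesis s2_gt0 : 0 < s2.
Hypothesis B_bound : forall n w, 0 <= B n w <= C.
Hypothesis L_def : forall n w, L n w = a n - Num.sqrt n%:R * (l * X n w) - B n w.
Local Notation E n := (fmean (P n)).
Hypothesis mean_X : E n (X n) @[n --> \oo] --> 0.
Hypothesis sqr_X : E n (fun w => X n w ^+ 2) @[n --> \oo] --> s2.
Hypothesis cos_X : forall th c, E n (fun w => cos (th * X n w + c)) @[n --> \oo] -->
  cos c * expR (- (th ^+ 2 * s2 / 2)).
Local Notation V n := (fvariance (P n) (L n)).
Local Notation s := (invsqrt R).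

Let sqrt_invsqrt n : (0 < n)%N -> Num.sqrt n%:R * s n = 1.
Proof. by move=> n0; rewrite divff// gt_eqF// sqrtr_gt0 ltr0n. Qed.

Let EB n : 0 <= E n (B n) <= C.
Proof.
apply/andP; split.
  by rewrite -(fmean_cst 0 (P_sum1 n)); apply: le_fmean => // w; case/andP: (B_bound w).
by rewrite -(fmean_cst C (P_sum1 n)); apply: le_fmean => // w; case/andP: (B_bound w).
Qed.

Let C_ge0 : 0 <= C. Proof. by have /andP[] := EB 0; exact: le_trans. Qed.

Let EL n : E n (L n) = a n - Num.sqrt n%:R * (l * E n (X n)) - E n (B n).
Proof.
rewrite (_ : L n = (fun w => a n + (- (Num.sqrt n%:R * l) * X n w + (-1) * B n w))).
  by rewrite fmeanD fmean_cst// fmeanD !fmeanZ; ring.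
by apply/funext => w; rewrite L_def; ring.
Qed.

(** The fluctuation has order sqrt n and B is bounded. *)
Lemma mean_asymptotics : (E n (L n) - a n) / n%:R @[n --> \oo] --> 0.
Proof.
have h : s n * (l * `|E n (X n)| + C) @[n --> \oo] --> 0.
  rewrite -(mul0r (l * 0 + C)); apply: cvgM; first exact: cvg_invsqrt.
  apply: cvgD; last exact: cvg_cst.
  apply: cvgM; first exact: cvg_cst.
  by rewrite -(@normr0 _ R); exact: cvg_norm.
apply: norm_cvg0; apply: (squeeze_cvgr _ (cvg_cst 0) h).
near=> n; rewrite normr_ge0/=.
have n0 : (0 < n)%N by near: n; exact: nbhs_infty_gt.
have s0 : 0 <= s n by exact: invsqrt_ge0.
have s1 : s n <= 1 by near: n; apply: near_invsqrt.
rewrite EL -sqr_invsqrt.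
have -> : (a n - Num.sqrt n%:R * (l * E n (X n)) - E n (B n) - a n) * s n ^+ 2 =
   s n * (- ((Num.sqrt n%:R * s n) * (l * E n (X n))) - s n * E n (B n)) by ring.
rewrite (sqrt_invsqrt n0) mul1r normrM (ger0_norm s0) ler_wpM2l//.
apply: le_trans (ler_normB _ _) _; rewrite normrN !normrM (gtr0_norm l_gt0) lerD2l (ger0_norm s0).
have /andP[b0 b1] := EB n.
rewrite (ger0_norm b0) -[leRHS]mul1r; exact: ler_pM.
Unshelve. all: end_near. Qed.

(** The centred variable, divided by - sqrt n: its square has a limiting mean. *)
Let Y n w := l * (X n w - E n (X n)) + s n * (B n w - E n (B n)).

Arguments Y : clear implicits.

Let centredE n w : (0 < n)%N -> L n w - E n (L n) = - (Num.sqrt n%:R * Y n w).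
Proof.
move=> n0; rewrite L_def EL /Y.
have -> : Num.sqrt n%:R * (l * (X n w - E n (X n)) + s n * (B n w - E n (B n))) =
  Num.sqrt n%:R * (l * (X n w - E n (X n))) + (Num.sqrt n%:R * s n) * (B n w - E n (B n)) by ring.
by rewrite sqrt_invsqrt//; ring.
Qed.

Let varE n : (0 < n)%N -> V n = n%:R * E n (fun w => Y n w ^+ 2).
Proof.
move=> n0; rewrite /fvariance -fmeanZ; congr fmean; apply/funext => w.
by rewrite centredE// sqrrN exprMn sqr_sqrtr.
Qed.

Let dev_B n w : `|B n w - E n (B n)| <= C.
Proof.
have /andP[h1 h2] := B_bound w; have /andP[h3 h4] := EB n.
by rewrite ler_norml; apply/andP; split; lra.
Qed.

Let varX n : E n (fun w => (X n w - E n (X n)) ^+ 2) =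
  E n (fun w => X n w ^+ 2) - E n (X n) ^+ 2.
Proof.
rewrite (_ : (fun w => _) = (fun w => X n w ^+ 2 + (- 2 * E n (X n) * X n w + E n (X n) ^+ 2))).
  by rewrite fmeanD fmeanD fmeanZ fmean_cst//; ring.
by apply/funext => w; ring.
Qed.

Let EY2 n : E n (fun w => Y n w ^+ 2) =
  l ^+ 2 * (E n (fun w => X n w ^+ 2) - E n (X n) ^+ 2) +
  s n * E n (fun w => 2 * l * (X n w - E n (X n)) * (B n w - E n (B n)) +
                      s n * (B n w - E n (B n)) ^+ 2).
Proof.
by rewrite -varX -!fmeanZ -fmeanD; congr fmean; apply/funext => w; rewrite /Y; ring.
Qed.

Let norm_fmean n (Z Z' : T n -> R) : (forall w, `|Z w| <= Z' w) -> `|E n Z| <= E n Z'.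
Proof.
move=> h; rewrite ler_norml; apply/andP; split.
  rewrite -mulN1r -fmeanZ; apply: le_fmean => // w; rewrite mulN1r.
  by have := h w; rewrite ler_norml => /andP[].
by apply: le_fmean => // w; apply: le_trans (h w); exact: ler_norm.
Qed.

Let cvg_EY2 : E n (fun w => Y n w ^+ 2) @[n --> \oo] --> l ^+ 2 * s2.
Proof.
have h : s n * (C * l * (1 + E n (fun w => (X n w - E n (X n)) ^+ 2)) + C ^+ 2) @[n --> \oo] --> 0.
  rewrite -(mul0r (C * l * (1 + (s2 - 0 ^+ 2)) + C ^+ 2)); apply: cvgM; first exact: cvg_invsqrt.
  apply: cvgD; last exact: cvg_cst.
  apply: cvgM; first exact: cvg_cst.
  apply: cvgD; first exact: cvg_cst.
  rewrite (_ : (fun n => _) = (fun n => E n (fun w => X n w ^+ 2) - E n (X n) ^+ 2)).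
    by apply: cvgB => //; rewrite expr2; under eq_fun do rewrite expr2; exact: cvgM.
  by apply/funext => n; exact: varX.
under eq_fun do rewrite EY2.
rewrite -(addr0 (l ^+ 2 * s2)); apply: cvgD.
  have -> : l ^+ 2 * s2 = l ^+ 2 * (s2 - 0 ^+ 2) by ring.
  apply: cvgM; first exact: cvg_cst.
  by apply: cvgB => //; rewrite expr2; under eq_fun do rewrite expr2; exact: cvgM.
apply: norm_cvg0; apply: (squeeze_cvgr _ (cvg_cst 0) h).
near=> n; rewrite normr_ge0/=.
have s0 : 0 <= s n by exact: invsqrt_ge0.
have s1 : s n <= 1 by near: n; apply: near_invsqrt.
rewrite normrM (ger0_norm s0) ler_wpM2l//.
have -> : C * l * (1 + E n (fun w => (X n w - E n (X n)) ^+ 2)) + C ^+ 2 =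
   E n (fun w => (C * l + C ^+ 2) + C * l * (X n w - E n (X n)) ^+ 2).
  by rewrite fmeanD fmean_cst// fmeanZ; ring.
apply: norm_fmean => w; apply: le_trans (ler_normD _ _) _.
have d := dev_B w.
have d0 := normr_ge0 (B n w - E n (B n)).
have x0 := normr_ge0 (X n w - E n (X n)).
rewrite !normrM (ger0_norm s0) (gtr0_norm l_gt0) (ger0_norm (ler0n _ 2)).
rewrite -(real_normK (num_real (X n w - _))).
set x := `|X n w - _| in x0 *; set b := `|B n w - _| in d d0 *.
have h1 : 2 * l * x * b <= C * l + C * l * x ^+ 2.
  have h2 : 2 * l * x * b <= 2 * l * x * C by rewrite ler_wpM2l// !mulr_ge0// ltW.
  apply: le_trans h2 _; have := mulr_ge0 (mulr_ge0 C_ge0 (ltW l_gt0)) (sqr_ge0 (x - 1)); lra.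
have h3 : s n * (b * b) <= C ^+ 2.
  rewrite -[leRHS]mul1r expr2; apply: ler_pM => //; first by rewrite mulr_ge0.
  exact: ler_pM.
lra.
Unshelve. all: end_near. Qed.

Lemma variance_asymptotics : V n / n%:R @[n --> \oo] --> l ^+ 2 * s2.
Proof.
apply: cvg_trans cvg_EY2; apply: near_eq_cvg; near=> n.
have n0 : (0 < n)%N by near: n; exact: nbhs_infty_gt.
by rewrite varE// mulrAC divff ?mul1r// pnatr_eq0 -lt0n.
Unshelve. all: end_near. Qed.

(** The normalized variable is - X / sqrt s2 up to an error that tends to 0 in
    mean, and the cosine is Lipschitz.  Its second moment is 1 by construction. *)
Lemma normalized_clt : cvg_in_distribution
  (fun n => fcdf (P n) (fun w => (L n w - E n (L n)) / Num.sqrt (V n))) (normal_prob 0 1).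
Proof.
pose si := Num.sqrt s2.
have si0 : 0 < si by rewrite sqrtr_gt0.
have si2 : si ^+ 2 = s2 by rewrite sqr_sqrtr ?ltW.
pose v n := E n (fun w => Y n w ^+ 2).
have vlim : v n @[n --> \oo] --> l ^+ 2 * s2 := cvg_EY2.
have ls0 : 0 < l ^+ 2 * s2 by rewrite mulr_gt0// exprn_gt0.
have vpos : \forall n \near \oo, l ^+ 2 * s2 / 2 < v n.
  by move/cvgr_gt: vlim; apply; rewrite ltr_pdivrMr// ltr_pMr// ltr1n.
have rtv : (Num.sqrt (v n))^-1 @[n --> \oo] --> (l * si)^-1.
  have -> : l * si = Num.sqrt (l ^+ 2 * s2) by rewrite sqrtrM ?sqr_ge0// sqrtr_sqr gtr0_norm.
  apply: cvgV; first by rewrite gt_eqF// sqrtr_gt0.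
  by apply: (cvg_comp v Num.sqrt vlim); exact: sqrt_continuous.
have normE n w : (0 < n)%N -> (L n w - E n (L n)) / Num.sqrt (V n) = - (Y n w / Num.sqrt (v n)).
  move=> n0; rewrite centredE// varE// sqrtrM ?ler0n//.
  rewrite mulNr -mulf_div divff ?mul1r// gt_eqF// sqrtr_gt0 ltr0n//.
apply: (@levy_continuity R T P _ 1) => //.
- near=> n.
  have n0 : (0 < n)%N by near: n; exact: nbhs_infty_gt.
  have v0 : 0 < v n.
    have h : l ^+ 2 * s2 / 2 < v n by near: n.
    by apply: lt_trans h; rewrite divr_gt0.
  under eq_fun do rewrite normE//.
  rewrite (_ : (fun w => _) = (fun w => (v n)^-1 * Y n w ^+ 2)).
    by rewrite fmeanZ -/(v n) mulVf// gt_eqF.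
  by apply/funext => w; rewrite sqrrN expr_div_n sqr_sqrtr ?(ltW v0)// mulrC.
- move=> th c.
  have lim := @cos_X (- th / si) c.
  have -> : th ^+ 2 / 2 = (- th / si) ^+ 2 * s2 / 2.
    by rewrite -si2; field; rewrite gt_eqF.
  pose r n := (Num.sqrt (v n))^-1.
  pose K n := `|th| * (`|r n * l - si^-1| * (1 + E n (fun w => X n w ^+ 2)) +
     r n * (l * `|E n (X n)| + s n * C)).
  have Klim : K n @[n --> \oo] --> 0.
    rewrite -(mulr0 `|th|); apply: cvgM; first exact: cvg_cst.
    rewrite -(addr0 (0 : R)); apply: cvgD.
      rewrite -(mul0r (1 + s2)); apply: cvgM; last by apply: cvgD; [exact: cvg_cst|].
      rewrite -(@normr0 _ R); apply: cvg_norm.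
      rewrite -(subrr si^-1); apply: cvgB; last exact: cvg_cst.
      have -> : si^-1 = (l * si)^-1 * l by field; rewrite !gt_eqF.
      by apply: cvgM; [exact: rtv|exact: cvg_cst].
    rewrite -(mulr0 (l * si)^-1); apply: cvgM; first exact: rtv.
    rewrite -(addr0 (0 : R)); apply: cvgD.
      rewrite -(mulr0 l); apply: cvgM; first exact: cvg_cst.
      by rewrite -(@normr0 _ R); exact: cvg_norm.
    by rewrite -(mul0r C); apply: cvgM; [exact: cvg_invsqrt|exact: cvg_cst].
  rewrite -[cos c * _]addr0.
  rewrite (_ : (fun n => _) = (fun n => E n (fun w => cos (- th / si * X n w + c)) +
    (E n (fun w => cos (th * ((L n w - E n (L n)) / Num.sqrt (V n)) + c)) -
     E n (fun w => cos (- th / si * X n w + c))))); last by apply/funext => n; rewrite addrC subrK.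
  apply: cvgD => //; apply: norm_cvg0; apply: (squeeze_cvgr _ (cvg_cst 0) Klim).
  near=> n; rewrite normr_ge0/=.
  have n0 : (0 < n)%N by near: n; exact: nbhs_infty_gt.
  have s0 : 0 <= s n by exact: invsqrt_ge0.
  have r0 : 0 <= r n by rewrite invr_ge0 sqrtr_ge0.
  rewrite (_ : _ - _ = E n (fun w => cos (th * ((L n w - E n (L n)) / Num.sqrt (V n)) + c) +
     (-1) * cos (- th / si * X n w + c))); last by rewrite fmeanD fmeanZ mulN1r.
  have -> : K n = E n (fun w => `|th| * (`|r n * l - si^-1| * (1 + X n w ^+ 2) +
     r n * (l * `|E n (X n)| + s n * C))).
    by rewrite fmeanZ fmeanD fmeanZ fmeanD !fmean_cst.
  apply: norm_fmean => w; rewrite mulN1r normE//.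
  have -> : th * - (Y n w / Num.sqrt (v n)) + c = (- th / si * X n w + c) +
     (- th) * ((r n * l - si^-1) * X n w + r n * (- (l * E n (X n)) + s n * (B n w - E n (B n)))).
    by rewrite /Y -/(r n); field; rewrite gt_eqF.
  apply: le_trans (cos_lip _ _) _; rewrite normrM normrN ler_wpM2l//.
  apply: le_trans (ler_normD _ _) _; apply: lerD.
    rewrite normrM ler_wpM2l// -(real_normK (num_real (X n w))).
    by have := sqr_ge0 (`|X n w| - 1); have := normr_ge0 (X n w); nra.
  rewrite normrM (ger0_norm r0) ler_wpM2l//.
  apply: le_trans (ler_normD _ _) _; rewrite normrN !normrM (gtr0_norm l_gt0) (ger0_norm s0).
  by rewrite lerD2l ler_wpM2l.
Unshelve. all: end_near. Qed.

End Slutsky.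

(** * The log-density of the uniform matching *)

Lemma ln_prod (R : realType) (I : finType) (F : I -> R) : (forall i, 0 < F i) ->
  ln (\prod_i F i) = \sum_i ln (F i).
Proof.
move=> F0; suff [] : 0 < \prod_i F i /\ ln (\prod_i F i) = \sum_i ln (F i) by [].
apply: (big_rec2 (fun x y => 0 < x /\ ln x = y)); first by rewrite ln1.
by move=> i x y _ [y0 yE]; rewrite mulr_gt0// lnM ?posrE// yE.
Qed.

Section LogDensity.
Variables (R : realType) (s t : nat).
Hypotheses (hs : (0 < s)%N) (ht : (0 < t)%N).
Local Notation G := (fun n => type_graph n s t).
Local Notation M n := (perfect_matchings (G n)).

Lemma card_matchings_gt0 n : (0 : R) < #|M n|%:R.
Proof. by rewrite ltr0n card_gt0; apply/set0Pn; exists 1%g; exact: perfect_matching1. Qed.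

Lemma fmean_uniform n (X : {perm 'I_n} -> R) :
  fmean (uniform_law R (G n)) X = (\sum_(p in M n) X p) / #|M n|%:R.
Proof.
rewrite /fmean /uniform_law mulr_suml [RHS]big_mkcond; apply: eq_bigr => p _.
by case: ifP => _; rewrite ?mul0r// mul1r mulrC.
Qed.

Lemma uniform_law_ge0 n p : 0 <= uniform_law R (G n) p.
Proof. by rewrite divr_ge0. Qed.

Lemma uniform_law_sum1 n : \sum_p uniform_law R (G n) p = 1.
Proof.
have := fmean_uniform (fun _ : {perm 'I_n} => 1); rewrite /fmean.
under eq_bigr do rewrite mulr1; move=> ->.
by rewrite sumr_const divff// gt_eqF// card_matchings_gt0.
Qed.

Lemma uniform_law_supp n p : uniform_law R (G n) p != 0 -> p \in M n.
Proof. by rewrite /uniform_law; case: (p \in M n) => //; rewrite mul0r eqxx. Qed.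

(** The logarithm of the number of choices in a free step far from the boundary. *)
Definition ln_choices : R := ln t.+1%:R.

Lemma ln_choices_gt0 : 0 < ln_choices. Proof. by rewrite ln_gt0// ltr1n. Qed.

(** What is lost because fewer than t + 1 columns remain in the last t rows. *)
Definition boundary_deficit n (p : {perm 'I_n}) : R :=
  \sum_(i : 'I_n) (if (p i + s == i)%N then 0 else ln_choices - ln (minn t.+1 (n - i))%:R).

Lemma log_densityE n (p : {perm 'I_n}) : p \in M n ->
  log_density R (G n) p =
  - ln #|M n|%:R + ln_choices * (n%:R - (forced_steps s p)%:R) - boundary_deficit p.
Proof.
move=> pM; rewrite /log_density /rn_density /uniform_law pM topdown_lawE// prodfV invrK.
have pos (i : 'I_n) : 0 < (if (p i + s == i)%N then 1 else (minn t.+1 (n - i))%:R : R).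
  by case: ifP => // _; rewrite ltr0n; have := ltn_ord i; lia.
rewrite mul1r lnM ?posrE ?invr_gt0 ?card_matchings_gt0//; last exact: prodr_gt0.
rewrite lnV ?posrE ?card_matchings_gt0// ln_prod// -addrA; congr (_ + _).
have -> : ln_choices * (n%:R - (forced_steps s p)%:R) =
    \sum_(i : 'I_n) (if (p i + s == i)%N then 0 else ln_choices).
  have NE : (forced_steps s p)%:R = \sum_(i : 'I_n) ((p i + s == i)%N : nat)%:R :> R.
    rewrite /forced_steps -sum1dep_card natr_sum big_mkcond; apply: eq_bigr => i _.
    by case: eqP.
  have nE : n%:R = \sum_(i : 'I_n) 1 :> R by rewrite sumr_const card_ord.
  rewrite NE nE -sumrB mulr_sumr; apply: eq_bigr => i _.
  by case: ifP => _; [rewrite subrr mulr0|rewrite subr0 mulr1].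
rewrite /boundary_deficit -sumrB; apply: eq_bigr => i _.
by case: ifP => _; [rewrite ln1 subrr|ring].
Qed.

Lemma deficit_bound n (p : {perm 'I_n}) : 0 <= boundary_deficit p <= ln_choices * t%:R.
Proof.
have term (i : 'I_n) : 0 <= (if (p i + s == i)%N then 0 else ln_choices - ln (minn t.+1 (n - i))%:R)
    <= ln_choices * (n - i <= t)%N%:R.
  have i0 := ltn_ord i.
  case: ifP => _; first by rewrite lexx mulr_ge0// ltW// ln_choices_gt0.
  have h0 : (1 : R) <= (minn t.+1 (n - i))%:R by rewrite ler1n; lia.
  apply/andP; split.
    rewrite subr_ge0 ler_ln ?posrE ?ltr0n//; last by lia.
    by rewrite ler_nat geq_minl.
  case: leqP => h; first by rewrite mulr1 gerBl ln_ge0.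
  by rewrite mulr0 (minn_idPl h) subrr.
apply/andP; split; first by apply: sumr_ge0 => i _; case/andP: (term i).
apply: (@le_trans _ _ (\sum_(i < n) ln_choices * (n - i <= t)%N%:R)).
  by apply: ler_sum => i _; case/andP: (term i).
rewrite -mulr_sumr; apply: ler_wpM2l; first exact/ltW/ln_choices_gt0.
rewrite -natr_sum ler_nat.
rewrite (reindex_inj rev_ord_inj)/=.
have -> : (\sum_(j < n) (n - (n - j.+1) <= t) = \sum_(j < n) (j < t))%N.
  by apply: eq_bigr => j _; congr nat_of_bool; have := ltn_ord j; lia.
elim: n {p term} => [|n ih]; first by rewrite big_ord0.
have h : (\sum_(j < n) (j < t) <= n)%N.
  rewrite -[leqRHS]card_ord -sum1_card; apply: leq_sum => j _; exact: leq_b1.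
rewrite big_ord_recr/=; case: (ltnP n t) => nt /=; last by rewrite addn0.
by rewrite addn1; apply: leq_ltn_trans h nt.
Qed.

(** A forced row moves down by s and any other row moves up by at most t, while
    the total displacement of a permutation is 0. *)
Lemma forced_steps_le n (p : {perm 'I_n}) : p \in M n ->
  ((s + t) * forced_steps s p <= t * n)%N.
Proof.
move=> /matchingP pB.
have sumE : (\sum_(i < n) p i = \sum_(i < n) i)%N by rewrite [RHS](reindex_inj (@perm_inj _ p)).
have : (\sum_(i < n) (p i + s) <= \sum_(i < n) (i + (s + t) * ~~ (p i + s == i)%N))%N.
  apply: leq_sum => i _; have := pB i; case: eqP => /=; lia.
rewrite !big_split/= sumE leq_add2l sum_nat_const card_ord -big_distrr/=.
have : (\sum_(i < n) ~~ (p i + s == i) + forced_steps s p = n)%N.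
  rewrite /forced_steps -sum1dep_card [X in (_ + X)%N]big_mkcond -big_split/=.
  rewrite -[RHS]card_ord -sum1_card; apply: eq_bigr => i _; by case: eqP.
move: (\sum_(i < n) _)%N => k; move: (forced_steps s p) => N <-.
rewrite !mulnDr !mulnDl; lia.
Qed.

(** The cyclic shift i -> i + 1 sends its last row s to 0. *)
Lemma exists_forced : exists2 p : {perm 'I_s.+1}, p \in M s.+1 & (0 < forced_steps s p)%N.
Proof.
pose p := perm (@ordS_inj s.+1).
have pE (i : 'I_s.+1) : p i = (i.+1 %% s.+1)%N :> nat by rewrite permE.
exists p.
  apply/matchingP => i; rewrite pE; have := ltn_ord i; rewrite ltnS leq_eqVlt => /orP[/eqP ->|h].
    by rewrite modnn; lia.
  by rewrite modn_small//; lia.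
by rewrite card_gt0; apply/set0Pn; exists ord_max; rewrite inE pE /= modnn add0n.
Qed.

Lemma forced_steps1 n : forced_steps s (1%g : {perm 'I_n}) = 0%N.
Proof.
by apply/eqP; rewrite cards_eq0; apply/eqP/setP => i; rewrite !inE perm1; apply/negbTE; lia.
Qed.

(** [walk_clt] for the transfer matrix.  The variance is positive because the
    number of forced steps is not a function of n alone, and m < 1 because of
    the bound (s + t) N <= t n. *)
Lemma forced_steps_clt : exists m s2 : R, [/\ m < 1, 0 < s2 &
  let X n (p : {perm 'I_n}) := invsqrt R n * ((forced_steps s p)%:R - n%:R * m) in
  let E n := fmean (uniform_law R (G n)) in
  [/\ E n (X n) @[n --> \oo] --> 0, E n (fun p => X n p ^+ 2) @[n --> \oo] --> s2 &
    forall th c, E n (fun p => cos (th * X n p + c)) @[n --> \oo] -->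
      cos c * expR (- (th ^+ 2 * s2 / 2))]].
Proof.
have [m [s2 [s20 [H1 H2 H3 H4]]]] := walk_clt (@forced_weight R s t)
  (@transfer_ge0 R s t) (transfer_start R hs ht) (@transfer_connected R s t).
have Z n : walk_sum (@transfer R s t) (@forced_weight R s t) (start_state s t) n (fun=> 1)
    (start_state s t) 0 = #|M n|%:R.
  by rewrite -sum_matchings_walk sumr_const.
have EWE n (U : R -> R) :
   walk_sum (@transfer R s t) (@forced_weight R s t) (start_state s t) n
     (fun y => U (invsqrt R n * (y - n%:R * m))) (start_state s t) 0 /
   walk_sum (@transfer R s t) (@forced_weight R s t) (start_state s t) n (fun=> 1) (start_state s t) 0 =
   fmean (uniform_law R (G n)) (fun p => U (invsqrt R n * ((forced_steps s p)%:R - n%:R * m))).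
  rewrite Z fmean_uniform -(sum_matchings_walk s t n
    (fun y => U (invsqrt R n * (y - n%:R * m)))) //.
have {}H1 : fmean (uniform_law R (G n)) (fun p => invsqrt R n * ((forced_steps s p)%:R - n%:R * m))
    @[n --> \oo] --> 0.
  by move: H1; under eq_fun do rewrite (EWE _ id).
have m1 : m < 1.
  have st0 : 0 < (s + t)%:R :> R by rewrite ltr0n addn_gt0 hs.
  pose r : R := t%:R / (s + t)%:R.
  have r1 : r < 1 by rewrite ltr_pdivrMr// mul1r ltr_nat; lia.
  suff : m <= r by move=> h; exact: le_lt_trans r1.
  rewrite leNgt; apply/negP => rm.
  suff : 0 <= r - m by lra.
  move/cvg_lim : (H1) => <- //; apply: limr_le; first by apply/cvg_ex; exists 0.
  near=> n.
  have n0 : (0 < n)%N by near: n; exact: nbhs_infty_gt.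
  rewrite -(fmean_cst (r - m) (uniform_law_sum1 n)).
  rewrite fmean_uniform fmean_uniform ler_pM2r ?invr_gt0 ?card_matchings_gt0//.
  apply: ler_sum => p pM.
  have : (forced_steps s p)%:R <= r * n%:R.
    by rewrite /r mulrAC ler_pdivlMr// -!natrM ler_nat mulnC forced_steps_le.
  move=> h.
  have s0 : 0 < invsqrt R n by rewrite invr_gt0 sqrtr_gt0 ltr0n.
  have sn : 1 <= invsqrt R n * n%:R.
    have s1 : invsqrt R n <= 1.
      rewrite /invsqrt invf_le1 ?sqrtr_gt0 ?ltr0n//.
      by rewrite -[leLHS]sqrtr1 ler_sqrt ?ler1n// ltr0n.
    apply: (@le_trans _ _ (n%:R * invsqrt R n ^+ 2)); first by rewrite mul_invsqrt.
    rewrite mulrC; apply: ler_wpM2r => //.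
    by rewrite expr2; apply: ler_piMl => //; exact: ltW.
  apply: (@le_trans _ _ (invsqrt R n * (r * n%:R - n%:R * m))).
    by apply: ler_wpM2l; [exact: ltW|rewrite lerD2r].
  have -> : invsqrt R n * (r * n%:R - n%:R * m) = (invsqrt R n * n%:R) * (r - m) by ring.
  by apply: ler_neMl => //; lra.
have s2_gt0 : 0 < s2.
  rewrite lt_neqAle s20 andbT eq_sym; apply/eqP => s2E.
  have key n (p : {perm 'I_n}) : p \in M n -> (forced_steps s p)%:R = n%:R * m :> R.
    move=> pM; have := H4 s2E n (fun y => (y - n%:R * m) ^+ 2).
    rewrite -sum_matchings_walk// subrr expr0n/= mul0r => /psumr_eq0P h.
    apply/eqP; rewrite -subr_eq0 -sqrf_eq0 h// => q _; exact: sqr_ge0.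
  have := key 1%N 1%g (perfect_matching1 _ _ _); rewrite forced_steps1 mul1r => m0.
  have [p pM p0] := exists_forced.
  by have := key _ p pM; rewrite -m0 mulr0 => /eqP; rewrite pnatr_eq0 => /eqP pE; rewrite pE in p0.
exists m, s2; split => // X E; split.
- exact: H1.
- by move: H2; under eq_fun do rewrite (EWE _ (fun y => y ^+ 2)).
- by move=> th c; have := @H3 th c; under eq_fun do rewrite (EWE _ (fun y => cos (th * y + c))).
Unshelve. all: end_near. Qed.

End LogDensity.

Theorem theorem3p2 (R : realType) (s t : nat) (hs : (1 <= s)%N) (ht : (1 <= t)%N) :
  let G := fun n : nat => type_graph n s t in
  let nu := fun n : nat => uniform_law R (G n) in
  let logrho := fun n : nat => log_density R (G n) in
  let E := fun n : nat => fmean (nu n) (logrho n) in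
  let V := fun n : nat => fvariance (nu n) (logrho n) in
  (exists c1 c2 : R,
    [/\ 0 < c1, 0 < c2,
        (fun n : nat => E n + ln #|perfect_matchings (G n)|%:R : R^o)
          = (fun n : nat => c1 * n%:R : R^o) +o_\oo (fun n : nat => n%:R : R^o)
      & (fun n : nat => V n : R^o)
          = (fun n : nat => c2 * n%:R : R^o) +o_\oo (fun n : nat => n%:R : R^o)])
  /\ cvg_in_distribution
       (fun n : nat => fcdf (nu n)
          (fun p : {perm 'I_n} => (logrho n p - E n) / Num.sqrt (V n)))
       (normal_prob (0 : R) 1).
Proof.
move=> G nu logrho E V.
have [m [s2 [m1 s20 [X1 X2 X3]]]] := forced_steps_clt R hs ht.
pose X n (p : {perm 'I_n}) := invsqrt R n * ((forced_steps s p)%:R - n%:R * m).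
pose l := ln_choices R t.
have l0 : 0 < l by exact: ln_choices_gt0.
pose a n := - ln #|perfect_matchings (G n)|%:R + l * (n%:R * (1 - m)).
pose L n (p : {perm 'I_n}) := a n - Num.sqrt n%:R * (l * X n p) - boundary_deficit R s t p.
have LE n p : nu n p != 0 -> logrho n p = L n p.
  move=> /uniform_law_supp pM; rewrite /logrho log_densityE// /L /a.
  have -> : Num.sqrt n%:R * (l * X n p) = l * ((forced_steps s p)%:R - n%:R * m).
    have [n0|n0] := posnP n.
      have -> : forced_steps s p = 0%N.
        by apply/eqP; rewrite -leqn0 (leq_trans (max_card _))// card_ord n0.
      have -> : n%:R = 0 :> R by rewrite n0.
      by rewrite sqrtr0 !mul0r subr0 mulr0.
    rewrite /X; have sn : Num.sqrt n%:R * invsqrt R n = 1.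
      by rewrite divff// gt_eqF// sqrtr_gt0 ltr0n.
    by rewrite -[RHS]mul1r -[X in _ = X * _]sn; ring.
  by rewrite /l; ring.
have nu0 n p : 0 <= nu n p by exact: uniform_law_ge0.
have nu1 n : \sum_p nu n p = 1 by exact: uniform_law_sum1.
have EL n : E n = fmean (nu n) (L n) by apply: eq_fmean => p; exact: LE.
have VL n : V n = fvariance (nu n) (L n).
  rewrite /V /fvariance -/(E n) EL; apply: eq_fmean => p np.
  by rewrite (LE _ _ np).
have hB n (p : {perm 'I_n}) : 0 <= boundary_deficit R s t p <= l * t%:R by exact: deficit_bound.
have Ldef n p : L n p = a n - Num.sqrt n%:R * (l * X n p) - boundary_deficit R s t p by [].
have mean := mean_asymptotics nu0 nu1 l0 hB Ldef X1.
have var := variance_asymptotics nu0 nu1 l0 hB Ldef X1 X2.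
have clt := normalized_clt nu0 nu1 l0 s20 hB Ldef X1 X2 X3.
split.
  exists (l * (1 - m)), (l ^+ 2 * s2); split.
  - by rewrite mulr_gt0// subr_gt0.
  - by rewrite mulr_gt0// exprn_gt0.
  - apply/eqaddoP => e e0; move/cvgrPdist_le : mean => /(_ e e0) mean; near=> n.
    have n0 : 0 < n%:R :> R by rewrite ltr0n; near: n; exact: nbhs_infty_gt.
    have : `|0 - (fmean (nu n) (L n) - a n) / n%:R| <= e by near: n.
    rewrite sub0r normrN normrM normfV ler_pdivrMr ?normr_gt0 ?gt_eqF// => h.
    rewrite -[X in `|X|]/(E n + ln #|perfect_matchings (G n)|%:R - l * (1 - m) * n%:R).
    rewrite EL; have -> : fmean (nu n) (L n) + ln #|perfect_matchings (G n)|%:R -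
      l * (1 - m) * n%:R = fmean (nu n) (L n) - a n by rewrite /a; ring.
    exact: h.
  - apply/eqaddoP => e e0; move/cvgrPdist_le : var => /(_ e e0) var; near=> n.
    have n0 : 0 < n%:R :> R by rewrite ltr0n; near: n; exact: nbhs_infty_gt.
    have : `|l ^+ 2 * s2 - fvariance (nu n) (L n) / n%:R| <= e by near: n.
    rewrite -VL distrC => h.
    rewrite -[X in `|X|]/(V n - l ^+ 2 * s2 * n%:R).
    have -> : V n - l ^+ 2 * s2 * n%:R = (V n / n%:R - l ^+ 2 * s2) * n%:R.
      by field; rewrite gt_eqF.
    by rewrite normrM ler_wpM2r.
move=> x /clt; apply: cvg_trans; apply: near_eq_cvg; apply: nearW => n.
rewrite !fcdfE; apply: eq_fmean => p np.
by rewrite (LE _ _ np) EL VL.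
Unshelve. all: end_near. Qed.
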